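(* Let $r\ge 1$ be a fixed integer. For every $n=1,2,\ldots$ let $(X_{n,t})_{t=1}^{\infty}$ be a strictly stationary sequence of real random variables satisfying the absolute regularity condition with coefficients $\beta_n(t)$, i.e. $\beta_n(t)\downarrow 0$ as $t\to\infty$ for each $n$. For every $n$ let $\{f_{n;j_1,\ldots,j_r}: 1\le j_1<\ldots<j_r\le n\}$ be a family of measurable functions $\mathbb{R}^r\to\mathbb{R}$ with $|f_{n;j_1,\ldots,j_r}|\le F_n<\infty$, and put $$U_n=\sum_{1\le j_1<\ldots<j_r\le n} f_{n;j_1,\ldots,j_r}(X_{n,j_1},\ldots,X_{n,j_r}),\qquad U_n^*=\frac{U_n-\mathbf{E}U_n}{\sqrt{\mathbf{D}U_n}},$$ where $\mathbf{D}U_n>0$. Suppose there are a sequence of positive integers $(m_n)$ and a number $b_0\in(0,2/3]$ such that for all $b\in(0,b_0]$ $$\frac{F_n^2\, m_n^{2-b}\, n^{2(r-1)+b}\, r^{4-2b}}{\mathbf{D}U_n}+\bigl(\beta_n(m_n)\bigr)^{b}\,\frac{F_n^{2}\, n^{2r}}{\mathbf{D}U_n}\longrightarrow 0\qquad (n\to\infty).$$ Then, as $n\to\infty$, the moments and the distribution function of $U_n^*$ converge to the moments and the distribution function of the standard normal law; that is, for every integer $k\ge 1$, $\mathbf{E}(U_n^* )^k\to\mathbf{E}N^k$ with $N\sim\mathcal N(0,1)$, and $\mathbf{P}(U_n^*\le x)\to\mathbf{P}(N\le x)$ for every $x\in\mathbb{R}$.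
   Context: $\mathbf{E}$ and $\mathbf{D}$ denote expectation and variance. The distribution of the sequence $(X_{n,t})_{t\ge1}$, the functions $f_{n;j_1,\ldots,j_r}$, and the numbers $F_n$, $m_n$ may all depend on $n$ (triangular array scheme). Strict stationarity: for all $k\ge1$ and $t_1,\ldots,t_k,\tau\ge 1$, the vectors $(X_{n,t_1+\tau},\ldots,X_{n,t_k+\tau})$ and $(X_{n,t_1},\ldots,X_{n,t_k})$ have the same distribution. Absolute regularity: the stationary sequence $(X_{n,t})_{t\ge 1}$ is extended (in law) to a two-sided stationary sequence indexed by $t\in\mathbb{Z}$, $\mathcal F_a^b$ denotes the $\sigma$-algebra generated by $X_{n,t}$, $a\le t\le b$, and $$\beta_n(t)=\mathbf{E}\Bigl\{\sup_{A\in\mathcal F_t^{\infty}}\bigl|\mathbf{P}\{A\mid\mathcal F_{-\infty}^{0}\}-\mathbf{P}\{A\}\bigr|\Bigr\},\qquad t=1,2,\ldots,$$ the supremum being understood as an essential supremum. The sequence satisfies the absolute regularity condition if $\beta_n(t)\downarrow0$ as $t\to\infty$. *)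

(* Defs.v *)
From HB Require Import structures.
From mathcomp Require Import all_boot all_order all_algebra.
From mathcomp Require Import all_classical all_reals all_analysis.
From mathcomp Require Import measurable_realfun.

Set Implicit Arguments.
Unset Strict Implicit.
Unset Printing Implicit Defensive.
Import Order.TTheory GRing.Theory Num.Theory.
Import numFieldNormedType.Exports.
Local Open Scope classical_set_scope.
Local Open Scope ring_scope.

Definition sample {T I U : Type} (X : I -> T -> U) {k : nat} (t : k.-tuple I)
  (w : T) : k.-tuple U := [tuple X (tnth t i) w | i < k].

Definition same_law {R : realType} {d d' e : measure_display}
    {T : measurableType d} {T' : measurableType d'} {S : measurableType e}
    (P : probability T R) (V : T -> S) (P' : probability T' R) (V' : T' -> S) :=
  forall B : set S, measurable B -> pushforward P V B = pushforward P' V' B.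

(* A one-sided sequence is a function on [nat] of which only the values at the
   times [t >= 1] are meaningful. *)
Definition strictly_stationary {R : realType} {d : measure_display}
    {T : measurableType d} (P : probability T R) (X : nat -> {RV P >-> R}) :=
  forall (k : nat) (t : k.-tuple nat) (tau : nat), (1 <= k)%N ->
    all (leq 1) t -> (1 <= tau)%N ->
    same_law P (sample X [tuple of map (addn^~ tau) t]) P (sample X t).

Definition strictly_stationaryZ {R : realType} {d : measure_display}
    {T : measurableType d} (P : probability T R) (Y : int -> {RV P >-> R}) :=
  forall (k : nat) (t : k.-tuple int) (tau : int), (1 <= k)%N ->
    same_law P (sample Y [tuple of map (+%R^~ tau) t]) P (sample Y t).

(* The extension is in law: the two sequences may live on different spaces. *)
Definition two_sided_extension {R : realType} {d d' : measure_display}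
    {T : measurableType d} {T' : measurableType d'}
    (P : probability T R) (X : nat -> {RV P >-> R})
    (P' : probability T' R) (Y : int -> {RV P' >-> R}) :=
  strictly_stationaryZ Y /\
  forall (k : nat) (t : k.-tuple nat), (1 <= k)%N -> all (leq 1) t ->
    same_law P (sample X t) P' (sample Y [tuple of map Posz t]).

Definition sigma_gen {R : realType} {d : measure_display}
    {T : measurableType d} {I : Type} (Y : I -> T -> R) (D : set I) :
    set (set T) :=
  <<s \bigcup_(s in D) preimage_set_system [set: T] (Y s) (@measurable _ R) >>.

(* [c] is a version of the conditional probability of [A] given the
   sub-sigma-algebra [G]. *)
Definition is_cond_prob {R : realType} {d : measure_display}
    {T : measurableType d} (P : probability T R) (G : set (set T)) (A : set T)
    (c : T -> R) :=
  [/\ forall B : set R, measurable B -> G (c @^-1` B),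
      P.-integrable [set: T] (EFin \o c) &
      forall B : set T, G B -> (\int[P]_(w in B) (c w)%:E = P (A `&` B))%E].

Definition cond_prob {R : realType} {d : measure_display}
    {T : measurableType d} (P : probability T R) (G : set (set T)) (A : set T) :
    T -> R :=
  xget (cst 0) (is_cond_prob P G A).

(* Essential supremum of a possibly uncountable family of random variables, as
   opposed to [ess_sup], which is that of a single function. *)
Definition is_ess_sup_family {R : realType} {d : measure_display}
    {T : measurableType d} (P : probability T R) (Phi : set (T -> R))
    (g : T -> R) :=
  [/\ measurable_fun [set: T] g,
      forall f, Phi f -> {ae P, forall w, f w <= g w} &
      forall h : T -> R, measurable_fun [set: T] h ->
        (forall f, Phi f -> {ae P, forall w, f w <= h w}) ->
        {ae P, forall w, g w <= h w}].

Definition ess_sup_family {R : realType} {d : measure_display}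
    {T : measurableType d} (P : probability T R) (Phi : set (T -> R)) :
    T -> R :=
  xget (cst 0) (is_ess_sup_family P Phi).

Definition cond_prob_deviations {R : realType} {d : measure_display}
    {T : measurableType d} (P : probability T R) (G H : set (set T)) :
    set (T -> R) :=
  [set (fun w => `|cond_prob P G A w - fine (P A)|) | A in H].

Definition beta_coef {R : realType} {d : measure_display}
    {T : measurableType d} (P : probability T R) (Y : int -> {RV P >-> R})
    (t : nat) : R :=
  fine 'E_P[ess_sup_family P (cond_prob_deviations P
    (sigma_gen Y [set s : int | s <= 0]) (sigma_gen Y [set s : int | t%:Z <= s]))].

Definition absolutely_regular {R : realType} {d : measure_display}
    {T : measurableType d} (P : probability T R) (Y : int -> {RV P >-> R}) :=
  (forall s t : nat, (1 <= s)%N -> (s <= t)%N ->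
    beta_coef Y t <= beta_coef Y s) /\
  (beta_coef Y t @[t --> \oo] --> 0).

(* [j_1, ..., j_r] with [1 <= j_1 < ... < j_r <= n]; the upper bound is in the
   type ['I_n.+1]. *)
Definition increasing_index {r n : nat} (j : r.-tuple 'I_n.+1) : bool :=
  path ltn 0%N (map val j).

Definition U_stat {R : realType} {T : Type} {r n : nat}
    (f : r.-tuple 'I_n.+1 -> r.-tuple R -> R) (X : nat -> T -> R) (w : T) : R :=
  \sum_(j : r.-tuple 'I_n.+1 | increasing_index j)
    f j (sample X [tuple of map val j] w).

Definition standardized {R : realType} {d : measure_display}
    {T : measurableType d} (P : probability T R) (V : T -> R) (w : T) : R :=
  (V w - fine 'E_P[V]) / Num.sqrt (fine 'V_P[V]).

(* The objects picked by [xget] above exist: [is_cond_probP] and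
   [ess_sup_cond_prob_deviationsP]. *)
Section conditional_probability.
Context {R : realType} {d : measure_display} {T : measurableType d}.
Variable P : probability T R.
Variable G : set (set T).
Hypotheses (GS : sigma_algebra [set: T] G) (Gm : G `<=` measurable).

Let id' : T -> g_sigma_algebraType G := idfun.

Let mid : measurable_fun [set: T] id'.
Proof.
by move=> _ B /=; rewrite setTI /id' preimage_id /measurable/= sigma_algebra_id// => /Gm.
Qed.

Let mG (B : set (g_sigma_algebraType G)) : measurable B = G B.
Proof. by rewrite /measurable/= sigma_algebra_id. Qed.

Lemma is_cond_probP (A : set T) : measurable A -> is_cond_prob P G A (cond_prob P G A).
Proof.
move=> mA; apply: xgetPex.

pose mid_mixin := isMeasurableFun.Build _ _ _ _ id' mid.
pose midp : {mfun T >-> g_sigma_algebraType G} := HB.pack id' mid_mixin.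

pose mu : {sigma_finite_measure set (g_sigma_algebraType G) -> \bar R} := distribution P midp.
pose nu0 : {measure set (g_sigma_algebraType G) -> \bar R} := @measure_function_pushforward__canonical__measure_function_Measure _ _ _ _ _ (mrestr P mA) midp mid.
have nu0E B : nu0 B = P (B `&` A) by [].
have nufin : fin_num_fun (nu0).
  move=> B /[1!mG] GB; rewrite nu0E fin_num_measure//.
  by apply: measurableI => //; exact: Gm.
pose nuF := Measure_isFinite.Build _ _ _ nu0 nufin.
pose nu : {finite_measure set (g_sigma_algebraType G) -> \bar R} := HB.pack (Measure.sort nu0) nuF.
have numu : nu `<< mu.
  apply/null_content_dominatesP => B; rewrite mG => GB muB.
  apply/eqP; rewrite -measure_le0 /= nu0E -[leRHS](muB : P B = 0%E) le_measure// inE.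
    by apply: measurableI => //; exact: Gm.
  exact: Gm.
have [h [h0 hfin hint hE]] := radon_nikodym_sigma_finite numu.
have mh := measurable_int _ hint.
pose h' : T -> \bar R := fun w => h w.
have mhi : measurable_fun [set: T] h'.
  move=> _ B mB; rewrite setTI; have := mh measurableT _ mB.
  by rewrite setTI mG => /Gm.
have ihE B : G B -> (\int[mu]_(x in B) h x = \int[P]_(w in B) h' w)%E.
  move=> GB; rewrite (ge0_integral_pushforward mid P (D := B) (f := h)) ?mG//.
  exact: measurable_funTS.
have hP : P.-integrable [set: T] h'.
  apply/integrableP; split; first exact: mhi.
  case/integrableP: hint => _; rewrite (ge0_integral_pushforward mid P (f := (fun x => `|h x|)%E))//.
  exact: measurableT_comp.
exists (fine \o h); split.
- move=> B mB; rewrite -mG -[X in measurable X]setTI.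
  exact: (measurableT_comp (f := fine) _ mh).
- by apply: eq_integrable hP => // w _ /=; rewrite fineK.
- move=> B GB; rewrite setIC -nu0E.
  transitivity (\int[mu]_(x in B) h x)%E; last by rewrite -hE// mG.
  by rewrite ihE//; apply: eq_integral => w _ /=; rewrite fineK.
Qed.

End conditional_probability.

Section essential_supremum.
Context {R : realType} {d : measure_display} {T : measurableType d}.
Variables (P : probability T R) (Phi : set (T -> R)) (M : R) (f0 : T -> R).
Hypotheses (M0 : 0 <= M) (Phif0 : Phi f0).
Hypothesis Phi_meas : forall f, Phi f -> measurable_fun [set: T] f.
Hypothesis Phi_ge0 : forall f, Phi f -> forall w, 0 <= f w.
Hypothesis Phi_le : forall f, Phi f -> {ae P, forall w, f w <= M}.

Let tr (f : T -> R) w : \bar R := (Num.min (f w) M)%:E.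
Let S (u : nat -> T -> R) w := esups (fun n => tr (u n) w) 0.

Let trS u n w : (tr (u n) w <= S u w)%E.
Proof. by apply: ereal_sup_ubound; exists n. Qed.

Let S_le u w y : (forall n, (tr (u n) w <= y)%E) -> (S u w <= y)%E.
Proof. by move=> H; apply: ge_ereal_sup => _ [n _ <-]. Qed.

Let S_leM u w : (S u w <= M%:E)%E.
Proof. by apply: S_le => n; rewrite lee_fin ge_min lexx orbT. Qed.

Let S_ge0 u w : (forall n, Phi (u n)) -> (0 <= S u w)%E.
Proof.
move=> Pu; apply: le_trans (trS u 0 w); rewrite lee_fin le_min M0 andbT.
exact: Phi_ge0.
Qed.

Let mS u : (forall n, Phi (u n)) -> measurable_fun [set: T] (S u).
Proof.
move=> Pu; apply: (measurable_fun_esups (f := fun n w => tr (u n) w)) => n.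
apply/measurable_EFinP; apply: measurable_minr => //; exact: Phi_meas.
Qed.

Let S_fin u w : (forall n, Phi (u n)) -> S u w \is a fin_num.
Proof.
by move=> Pu; rewrite ge0_fin_numE ?(S_ge0 w Pu)//; apply: le_lt_trans (S_leM u w) _; rewrite ltry.
Qed.

Let I u : \bar R := (\int[P]_w S u w)%E.

Let SP u : (forall n, Phi (u n)) -> P.-integrable [set: T] (S u).
Proof.
move=> Pu; apply: (@le_integrable _ _ _ _ _ _ _ (EFin \o cst M)) => //.
- exact: mS.
- by move=> w _ /=; rewrite gee0_abs ?(S_ge0 w Pu)// ger0_norm// S_leM.
- exact: finite_measure_integrable_cst.
Qed.

Let I_mono u v : (forall n, Phi (u n)) -> (forall n, Phi (v n)) ->
  (forall w, (S u w <= S v w)%E) -> (I u <= I v)%E.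
Proof.
move=> Pu Pv uv; apply: ge0_le_integral => //.
- by move=> w _; exact: S_ge0.
- exact: mS.
- exact: mS.
Qed.

Lemma ess_sup_familyP : is_ess_sup_family P Phi (ess_sup_family P Phi).
Proof.
apply: xgetPex.
pose C := [set I u | u in [set u : nat -> T -> R | forall n, Phi (u n)]].
have C0 : C != set0 by apply/set0P; exists (I (fun=> f0)), (fun=> f0).
have [y Cy ycvg] := ereal_sup_seq C0.
have /choice[u /all_and2[Pu Iu]] : forall k, exists u, (forall n, Phi (u n)) /\ I u = y k.
  by move=> k; have [u Pu <-] := Cy k; exists u.
pose U n := if unpickle n is Some ki then u ki.1 ki.2 else f0.
have PU n : Phi (U n) by rewrite /U; case: unpickle => // -[k i]; exact: Pu.
have UI k : (I (u k) <= I U)%E.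
  apply: I_mono => // w; apply: S_le => n.
  have -> : u k n = U (pickle (k, n)) by rewrite /U pickleK.
  exact: trS.
have supI : (ereal_sup C <= I U)%E.
  rewrite -(cvg_lim _ ycvg)//; apply: lime_le.
    by apply/cvg_ex; exists (ereal_sup C); exact: ycvg.
  by apply: nearW => k; rewrite -Iu.
exists (fine \o S U); split.
- exact: (measurableT_comp (f := fine) _ (mS PU)).
- move=> f Pf; pose V n := if n is n'.+1 then U n' else f.
  have PV n : Phi (V n) by case: n => [|n] /=; [exact: Pf|exact: PU].
  have UV w : (S U w <= S V w)%E by apply: S_le => n; exact: (trS V n.+1 w).
  have IUV : I V = I U.
    apply/eqP; rewrite eq_le (I_mono PU PV UV) andbT; apply: le_trans supI.
    by apply: ereal_sup_ubound; exists V.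
  have : (\int[P]_w `|S V w - S U w| = 0)%E.
    transitivity (\int[P]_w (S V w - S U w))%E.
      by apply: eq_integral => w _; rewrite gee0_abs// sube_ge0 ?S_fin.
    rewrite integralB//; [|exact: SP..].
    by rewrite -/(I V) -/(I U) IUV subee// integrable_fin_num//; exact: SP.
  move/ae_eq_integral_abs => /(_ measurableT) H.
  have /H : measurable_fun [set: T] (fun w => S V w - S U w)%E.
    by apply: emeasurable_funB; exact: mS.
  have := Phi_le Pf; apply: filterS2 => w /= fM /(_ Logic.I) VU.
  have := trS V 0 w; rewrite /tr/= (min_idPl fM).
  have <- : S V w = S U w.
    by rewrite -[LHS](@subeK _ _ (S U w)) ?(S_fin w PU)// VU add0e.
  by rewrite -lee_fin fineK ?(S_fin w PV).
- move=> h mh hub.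
  have : {ae P, forall w, forall n, U n w <= h w}.
    by apply: ae_foralln => n; exact: hub.
  apply: filterS => w Uh /=; rewrite -lee_fin fineK ?S_fin//.
  by apply: S_le => n; rewrite lee_fin ge_min Uh.
Qed.
End essential_supremum.

Section deviations.
Context {R : realType} {d : measure_display} {T : measurableType d}.
Variable P : probability T R.

Let ae_notin (B : set T) (g : T -> \bar R) : measurable B ->
  P.-integrable [set: T] g -> (forall w, B w -> 0 < g w)%E ->
  (\int[P]_(w in B) g w <= 0)%E -> {ae P, forall w, ~ B w}.
Proof.
move=> mB ig g0 Ig.
have : (\int[P]_(w in B) `|g w| = 0)%E.
  apply/eqP; rewrite eq_le integral_ge0//= andbT; apply: le_trans Ig.
  rewrite le_eqVlt; apply/orP; left; apply/eqP.
  by apply: eq_integral => w /[!inE] Bw; rewrite gee0_abs// ltW// g0.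
move/ae_eq_integral_abs => /(_ mB) H.
have /H : measurable_fun B g by apply: measurable_funTS; exact: measurable_int ig.
by apply: filterS => w /= H' Bw; have := g0 _ Bw; rewrite H'// ltxx.
Qed.

Lemma cond_prob_deviation_le1 (G : set (set T)) (A : set T) (c : T -> R) :
  G `<=` measurable -> measurable A -> is_cond_prob P G A c ->
  {ae P, forall w, `|c w - fine (P A)| <= 1}.
Proof.
move=> Gm mA [cG ci cE].
have PAfin : P A \is a fin_num by exact: fin_num_measure.
have : {ae P, forall w, ~ (c @^-1` `]-oo, 0[) w}.
  have GB := cG `]-oo, 0[%classic (measurable_itv _).
  apply: (@ae_notin _ (fun w => - (c w)%:E)%E); first exact: Gm.
  - exact: integrableN.
  - by move=> w /=; rewrite in_itv/= lte_fin oppr_gt0.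
  - have ciB : P.-integrable (c @^-1` `]-oo, 0[) (EFin \o c).
      by apply: (integrableS measurableT (Gm _ GB) _ ci).
    rewrite (integralN (integrable_add_def (Gm _ GB) ciB)) [X in (- X)%E](cE _ GB).
    by rewrite oppe_le0.
have : {ae P, forall w, ~ (c @^-1` `]1, +oo[) w}.
  have GB := cG `]1, +oo[%classic (measurable_itv _).
  have mB := Gm _ GB.
  apply: (@ae_notin _ (fun w => (c w)%:E - (cst 1 w)%:E)%E) => //.
  - apply: integrableB => //; exact: finite_measure_integrable_cst.
  - by move=> w /=; rewrite in_itv/= andbT lte_fin subr_gt0.
  - rewrite integralB//=; last 2 first.
    + exact: (integrableS measurableT mB _ ci).
    + exact: finite_measure_integrable_cst.
    rewrite [X in (X - _)%E](cE _ GB) integral_cst// mul1e sube_le0.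
    by apply: le_measure; rewrite ?inE//; exact: measurableI.
apply: filterS2 => w /= /negP c1 /negP c0.
move: c0 c1; rewrite !in_itv/= andbT -!leNgt => c0 c1.
have p0 : 0 <= fine (P A) by exact: fine_ge0.
have p1 : fine (P A) <= 1 by rewrite -lee_fin fineK// probability_le1.
rewrite ler_norml; apply/andP; split.
  by rewrite lerBrDr (le_trans _ c0)// addrC subr_le0.
by rewrite lerBlDr (le_trans c1)// lerDl.
Qed.

Lemma sigma_gen_measurable {I : Type} (Y : I -> {RV P >-> R}) (D : set I) :
  sigma_gen Y D `<=` measurable.
Proof.
apply: smallest_sub; first exact: sigma_algebra_measurable.
by move=> _ [s _ [B mB <-]]; exact: measurable_funP.
Qed.

Lemma ess_sup_cond_prob_deviationsP (Y : int -> {RV P >-> R}) (t : nat) :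
  let Phi := cond_prob_deviations P
    (sigma_gen Y [set s : int | s <= 0]) (sigma_gen Y [set s : int | t%:Z <= s]) in
  is_ess_sup_family P Phi (ess_sup_family P Phi).
Proof.
move=> Phi; have Gm := @sigma_gen_measurable _ Y [set s : int | s <= 0].
have Hm := @sigma_gen_measurable _ Y [set s : int | t%:Z <= s].
have GS : sigma_algebra [set: T] (sigma_gen Y [set s : int | s <= 0]).
  exact: smallest_sigma_algebra.
have H0 : sigma_gen Y [set s : int | t%:Z <= s] set0.
  by case: (smallest_sigma_algebra setT (\bigcup_(s in [set s : int | t%:Z <= s]) preimage_set_system [set: T] (Y s) measurable)).
apply: (@ess_sup_familyP _ _ _ P Phi 1) => //.
- by exists set0.
- move=> f [A /Hm mA <-]; have [cG _ _] := is_cond_probP P GS Gm mA.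
  have mc : measurable_fun [set: T] (cond_prob P (sigma_gen Y [set s : int | s <= 0]) A).
    by move=> _ B mB; rewrite setTI; apply: Gm; apply: cG.
  by apply: (measurableT_comp (@normr_measurable _ _)); exact: measurable_funB.
- by move=> f [A _ <-] w.
- move=> f [A /Hm mA <-].
  exact: cond_prob_deviation_le1 Gm mA (is_cond_probP P GS Gm mA).
Qed.
End deviations.

(* Main.v *)
Require Import Defs.
From HB Require Import structures.
From mathcomp Require Import all_boot all_order all_algebra.
From mathcomp Require Import all_classical all_reals all_analysis.
From mathcomp Require Import measurable_realfun.
From mathcomp Require Import ring lra zify.
Set Implicit Arguments.
Unset Strict Implicit.
Unset Printing Implicit Defensive.
Import Order.TTheory GRing.Theory Num.Theory.
Import numFieldNormedType.Exports.
Local Open Scope classical_set_scope.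
Local Open Scope ring_scope.

(** The standardized statistic is [2 F / sigma] times a sum of at most
[(n + 1) ^ r] centred terms bounded by [1]. A joint cumulant of [k + 1] of them
splits off an absolute regularity coefficient unless the index tuples form a
connected cluster at range [m], and there are at most
[C n ^ r (m n ^ (r - 1)) ^ k] such clusters. With [L = F n ^ r / sigma] and
[delta = m / n] the cumulant of order [k + 1] is therefore
[O(L ^ (k + 1) (delta ^ k + beta))], and the growth condition makes it vanish in
the limit as soon as [2 <= (k + 1) b0].

Vanishing of all cumulants beyond some order forces a normal limit of the
moments (Janson): the moments stay bounded, and in the limit along an
ultrafilter only finitely many cumulants survive, so that the moment generating
function is the exponential of a polynomial; by Marcinkiewicz that polynomial
has degree at most two. The entire series being determined by its coefficients,
moments converging to those of the normal law give convergence of the means of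
[cos (t y + th)], hence of trigonometric polynomials, and these squeeze the
indicator of a half-line on a bounded range while Chebyshev's inequality
controls the rest. *)

(** * Joint cumulants *)

(** The absolute regularity coefficient compares one past with one future, whereas two groups of
    index tuples mutually at distance [m] may interleave in time. Blocks are therefore cut off with
    an independent copy and later glued back, at a cost proportional to the number of time points
    involved and not to [n].

    In the cumulant of order [k + 1] the coefficient is multiplied by [L ^ (k + 1)], while the
    growth condition pairs only [L ^ 2] with [beta ^ b]. Taking [b <= 2 / (k + 1)] restores the
    balance; this is where arbitrarily small [b] enter.

    Boundedness of the moments comes from homogeneity: when [th ^ p] is the moment of order [p + 2],
    every product of a cumulant and a moment of positive order in the recursion for it falls short
    by a factor [th ^ 2], so [th] is bounded as soon as the remaining cumulant is.

    A limit along an ultrafilter provides numbers, not a random variable. Positivity survives as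
    that of Hankel forms, and the argument of Marcinkiewicz is run on these, with pairs of real
    series for the values at complex points. *)

Section joint_cumulants.
Context {R : realFieldType} {J : eqType}.
Implicit Types (e g h : seq J -> R) (s u : seq J) (x a : J) (q : pred J).

Fixpoint splits s : seq (seq J * seq J) :=
  if s is a :: s' then
    [seq (a :: p.1, p.2) | p <- splits s'] ++
    [seq (p.1, a :: p.2) | p <- splits s']
  else [:: ([::], [::])].

(** The product of exponential generating functions, indexed by lists: [g \o cons a] plays the part
    of a partial derivative, and [conv_cons] is the Leibniz rule. *)
Definition conv g h s : R := \sum_(p <- splits s) g p.1 * h p.2.

Lemma conv_cons g h a s :
  conv g h (a :: s) = conv (g \o cons a) h s + conv g (h \o cons a) s.
Proof. by rewrite /conv /= big_cat !big_map. Qed.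

Lemma size_splits s : size (splits s) = (2 ^ size s)%N.
Proof.
elim: s => //= a s IH.
by rewrite size_cat !size_map IH expnS mul2n addnn.
Qed.

Lemma splitsP s p : p \in splits s ->
  [/\ subseq p.1 s, subseq p.2 s & (size p.1 + size p.2 = size s)%N].
Proof.
elim: s p => [|a s IH] p /=; first by rewrite inE => /eqP->.
rewrite mem_cat => /orP[] /mapP[p' /IH[s1 s2 s3] ->] /=; split => //.
- by rewrite eqxx.
- exact: subseq_trans s2 (subseq_cons _ _).
- by rewrite addSn s3.
- exact: subseq_trans s1 (subseq_cons _ _).
- by rewrite eqxx.
- by rewrite addnS s3.
Qed.

Lemma sum_splits_full (F : seq J * seq J -> R) s :
  \sum_(p <- splits s | ~~ (size p.1 < size s)%N) F p = F (s, [::]).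
Proof.
elim: s F => [|a s IH] F /=; first by rewrite big_seq1.
rewrite big_cat !big_map /= [X in _ + X]big1_seq ?addr0.
  exact: (IH (fun p => F (a :: p.1, p.2))).
by move=> p /andP[sp /splitsP[_ _ sz]]; move: sp; rewrite -sz ltnS leq_addr.
Qed.

(* The cumulant of [x :: s] is defined by [e (x :: s) = conv (cumulant e x) e s];
   the fuel makes the recursion structural. *)
Fixpoint cumulant_fuel e n x s : R :=
  if n is n'.+1 then
    e (x :: s) - \sum_(p <- splits s | (size p.1 < size s)%N)
                   cumulant_fuel e n' x p.1 * e p.2
  else 0.

Definition cumulant e x s := cumulant_fuel e (size s).+1 x s.

Lemma cumulant_fuelE e n x s :
  (size s < n)%N -> cumulant_fuel e n x s = cumulant e x s.
Proof.
suff H N : forall s n1 n2, (size s < N)%N -> (size s < n1)%N ->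
    (size s < n2)%N -> cumulant_fuel e n1 x s = cumulant_fuel e n2 x s.
  by move=> sn; apply: (H (size s).+1).
elim: N => // N IH {}s [|n1] [|n2] //= sN s1 s2; congr (_ - _).
apply: eq_bigr => p sp; congr (_ * _); apply: IH.
- exact: leq_trans sp _.
- exact: leq_trans sp _.
- exact: leq_trans sp _.
Qed.

Lemma cumulant_rec e x s :
  cumulant e x s = e (x :: s) - \sum_(p <- splits s | (size p.1 < size s)%N)
                                  cumulant e x p.1 * e p.2.
Proof.
rewrite {1}/cumulant /=; congr (_ - _); apply: eq_bigr => p sp.
by rewrite cumulant_fuelE.
Qed.

Lemma cumulant_conv e x s : e [::] = 1 -> e (x :: s) = conv (cumulant e x) e s.
Proof.
move=> e1; rewrite /conv (bigID (fun p => size p.1 < size s)%N) /=.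
by rewrite sum_splits_full /= e1 mulr1 cumulant_rec addrC subrK.
Qed.

(** An entry outside [q] cannot enter [p.1], so it goes to [p.2], where the filter erases it; what
    is left is a free splitting of the filtered list. *)
Lemma sum_splits_all q g h s :
  \sum_(p <- splits s | all q p.1) g p.1 * h (seq.filter q p.2) =
  conv g h (seq.filter q s).
Proof.
elim: s g h => [|a s IH] g h /=; first by rewrite /conv !(big_cons, big_nil).
rewrite big_cat !big_map /=; case: ifP => qa /=.
  rewrite conv_cons -!IH.
  by congr (_ + _).
rewrite big_pred0_eq add0r; exact: IH.
Qed.

Lemma splits_filter q s p : p \in splits s -> all q p.1 ->
  seq.filter (predC q) p.2 = seq.filter (predC q) s.
Proof.
elim: s p => [|a s IH] p /=; first by rewrite inE => /eqP->.
rewrite mem_cat => /orP[] /mapP[p' ps ->] /=.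
  by case/andP => -> /= ap; exact: IH.
by move=> ap; rewrite (IH p').
Qed.

(** A crude bound for cumulants when all moments are bounded by 1: the recursion has [2 ^ k] splits,
    each controlled by the preceding constant. *)
Fixpoint cumulant_cst k : R :=
  if k is k'.+1 then 1 + 2 ^+ k * cumulant_cst k' else 1.

Lemma cumulant_cst_ge1 k : 1 <= cumulant_cst k.
Proof.
elim: k => //= k IH; rewrite lerDl mulr_ge0 ?exprn_ge0//.
exact: le_trans IH.
Qed.

Lemma cumulant_cst_le i k : (i <= k)%N -> cumulant_cst i <= cumulant_cst k.
Proof.
move=> /subnK<-; elim: (_ - _)%N => // j IH.
rewrite (le_trans IH)//=.
have c1 := cumulant_cst_ge1 (j + i).
have : 1 <= 2 ^+ (j + i).+1 :> R by rewrite exprn_ege1// ler1n.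
by move=> h; nra.
Qed.

Lemma sum_splits_le (P : pred (seq J * seq J)) (F : seq J * seq J -> R) c s :
  0 <= c -> (forall p, p \in splits s -> P p -> F p <= c) ->
  \sum_(p <- splits s | P p) F p <= 2 ^+ size s * c.
Proof.
move=> c0 Fc; apply: (@le_trans _ _ (\sum_(p <- splits s) c)).
  rewrite [leLHS]big_seq_cond [leRHS]big_seq_cond.
  rewrite [leRHS](bigID P) /= -[leLHS]addr0 lerD//.
    rewrite [leRHS](eq_bigl (fun p => (p \in splits s) && P p)); last first.
      by move=> p; rewrite andbT.
    by apply: ler_sum => p /andP[] /Fc.
  exact: sumr_ge0.
by rewrite big_const_seq count_predT size_splits iter_addr_0 -[in leRHS]natrX mulr_natl.
Qed.

Lemma cumulant_le e x s : (forall u, `|e u| <= 1) ->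
  `|cumulant e x s| <= cumulant_cst (size s).
Proof.
move=> e1; have [k] := ubnP (size s); elim: k s => // k IH s sk.
rewrite cumulant_rec; apply: le_trans (ler_normB _ _) _.
case: s sk => [|a s] sk.
  rewrite big_pred0 ?normr0 ?addr0//.
rewrite [cumulant_cst _]/= lerD ?e1// (le_trans (ler_norm_sum _ _ _))//.
apply: sum_splits_le; first by rewrite (le_trans _ (cumulant_cst_ge1 _)).
move=> p _ sp; rewrite normrM -[leRHS]mulr1 ler_pM//.
rewrite (le_trans (IH _ _))//; last exact: cumulant_cst_le.
exact: leq_trans sp _.
Qed.

(** The three summands match the three errors in [cumulant_split_le]: the defect of the whole list,
    the splits whose first part leaves [q], handled by induction, and the splits inside [q], where a
    bounded cumulant multiplies a defect. *)
Fixpoint cumulant_split_cst k : R :=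
  if k is k'.+1 then
    1 + 2 ^+ k * cumulant_split_cst k' + 2 ^+ k * cumulant_cst k'
  else 0.

Lemma cumulant_split_cst_ge0 k : 0 <= cumulant_split_cst k.
Proof.
elim: k => //= k IH; rewrite !addr_ge0 ?mulr_ge0 ?exprn_ge0//.
exact: le_trans (cumulant_cst_ge1 k).
Qed.

Lemma cumulant_split_cst_le i k :
  (i <= k)%N -> cumulant_split_cst i <= cumulant_split_cst k.
Proof.
move=> /subnK<-; elim: (_ - _)%N => // j IH.
rewrite (le_trans IH)//=.
have c1 := cumulant_cst_ge1 (j + i).
have c0 := cumulant_split_cst_ge0 (j + i).
have : 1 <= 2 ^+ (j + i).+1 :> R by rewrite exprn_ege1// ler1n.
by move=> h; nra.
Qed.

(** In the splits whose first part lies in [q], [e p.2] is replaced by a product whose second factor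
    is the same for all of them. By [cumulant_conv] for the filtered list the main terms add up to
    the product of the moments of the two sides, which cancels against [e (x :: s)]. Splits whose
    first part leaves [q] are small by induction. *)
Lemma cumulant_split_le e q x s (eta : R) : e [::] = 1 -> (forall u, `|e u| <= 1) ->
  0 <= eta -> q x -> has (predC q) s ->
  (forall u, subseq u (x :: s) ->
     `|e u - e (seq.filter q u) * e (seq.filter (predC q) u)| <= eta) ->
  `|cumulant e x s| <= cumulant_split_cst (size s) * eta.
Proof.
move=> e0 e1 eta0 qx; have [k] := ubnP (size s); elim: k s => // k IH s sk qs Hs.
have [n sn] : exists n, size s = n.+1.
  by case: s qs {sk Hs} => // a s; exists (size s).
(* Some entry outside [q] stays in [p.2], so the condition that [p.1] be shorter is automatic on
   these splits, and the full convolution over the filtered list appears. *)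
have lt_good p : p \in splits s -> all q p.1 -> (size p.1 < size s)%N.
  move=> pb ap; have [_ _ <-] := splitsP pb; rewrite -addn1 leq_add2l lt0n.
  apply/negP => /nilP p20; move: qs; rewrite has_filter.
  by rewrite -(splits_filter pb ap) p20.
rewrite cumulant_rec (bigID (fun p => all q p.1)) /=.
rewrite (eq_bigr (fun p => cumulant e x p.1 *
  (e p.2 - e (seq.filter q p.2) * e (seq.filter (predC q) s)) +
  cumulant e x p.1 * e (seq.filter q p.2) * e (seq.filter (predC q) s))); last first.
  by move=> p _; rewrite -mulrA -mulrDr subrK.
rewrite big_split /= -mulr_suml.
have -> : \sum_(p <- splits s | (size p.1 < size s)%N && all q p.1)
    cumulant e x p.1 * e (seq.filter q p.2) = e (seq.filter q (x :: s)).
  have -> t : seq.filter q (x :: t) = x :: seq.filter q t by rewrite /= qx.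
  rewrite cumulant_conv// -sum_splits_all.
  rewrite big_seq_cond [RHS]big_seq_cond; apply: eq_bigl => p.
  case pb: (p \in splits s) => //=; case ap: (all q p.1); rewrite ?andbF ?andbT//.
  exact: lt_good.
have fE t : seq.filter (predC q) (x :: t) = seq.filter (predC q) t by rewrite /= qx.
set S1 := \sum_(_ <- _ | _) _; set S2 := \sum_(_ <- _ | _) _.
have S1le : `|S1| <= 2 ^+ n.+1 * (cumulant_cst n * eta).
  rewrite (le_trans (ler_norm_sum _ _ _))// -sn; apply: sum_splits_le.
    by rewrite mulr_ge0// (le_trans _ (cumulant_cst_ge1 _)).
  move=> p pb /andP[sp ap]; rewrite normrM ler_pM//.
    by rewrite (le_trans (cumulant_le _ _ e1))// cumulant_cst_le// -ltnS -sn.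
  rewrite -(splits_filter pb ap); apply: Hs.
  have [_ + _] := splitsP pb => /subseq_trans; apply; exact: subseq_cons.
have S2le : `|S2| <= 2 ^+ n.+1 * (cumulant_split_cst n * eta).
  rewrite (le_trans (ler_norm_sum _ _ _))// -sn; apply: sum_splits_le.
    by rewrite mulr_ge0// cumulant_split_cst_ge0.
  move=> p pb /andP[sp ap]; rewrite normrM -[leRHS]mulr1 ler_pM//.
  apply: (@le_trans _ _ (cumulant_split_cst (size p.1) * eta)).
    apply: IH; first exact: leq_trans sp _.
      by rewrite has_predC ap.
    move=> u ux; apply: Hs; apply: subseq_trans ux _ => /=; rewrite eqxx.
    by have [] := splitsP pb.
  by rewrite ler_wpM2r// cumulant_split_cst_le// -ltnS -sn.
have := Hs _ (subseq_refl _); rewrite fE => H0.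
rewrite (_ : _ - _ = (e (x :: s) - e (seq.filter q (x :: s)) *
  e (seq.filter (predC q) s)) - S1 - S2); last by ring.
rewrite (le_trans (ler_normB _ _))// sn /=.
rewrite (_ : _ * eta = eta + 2 ^+ n.+1 * (cumulant_cst n * eta) +
   2 ^+ n.+1 * (cumulant_split_cst n * eta)); last by rewrite /=; ring.
by rewrite lerD// (le_trans (ler_normB _ _))// lerD.
Qed.

End joint_cumulants.

(** The induction step of a binomial expansion; it serves both the sums over lists and the sums of
    cosines. *)
Lemma sum_bin_pascal (R : pzRingType) (F : nat -> nat -> R) k :
  \sum_(i < k.+1) 'C(k, i)%:R * F i.+1 (k - i)%N +
  \sum_(i < k.+1) 'C(k, i)%:R * F i (k.+1 - i)%N =
  \sum_(i < k.+2) 'C(k.+1, i)%:R * F i (k.+1 - i)%N.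
Proof.
rewrite [RHS]big_ord_recl [in RHS]big_ord_recr /= !bin0.
rewrite big_ord_recr [in X in _ + X]big_ord_recl /= !bin0 !binn.
rewrite [in RHS](eq_bigr (fun i : 'I_k => 'C(k, i)%:R * F i.+1 (k - i)%N +
    'C(k, i.+1)%:R * F i.+1 (k - i)%N)); last first.
  by move=> i _; rewrite /bump add1n binS natrD !mulrDl addrC subSS.
rewrite big_split /= /bump !add1n !subnn !subn0.
rewrite [X in _ + (_ + X) = _](eq_bigr (fun i : 'I_k =>
  'C(k, i.+1)%:R * F i.+1 (k - i)%N)); last by move=> i _; rewrite add1n subSS.
by rewrite [LHS]addrC -!addrA; congr (_ + _); rewrite [LHS]addrCA.
Qed.

(** * Sums over lists and the counting of connected clusters *)

Section sum_lists.
Context {R : realFieldType} {J : finType}.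
Implicit Types (e g h : seq J -> R) (s u T : seq J) (x a : J) (q : pred J).

Fixpoint sum_lists k g : R :=
  if k is k'.+1 then \sum_(j : J) sum_lists k' (g \o cons j) else g [::].

Lemma le_sum_lists k g h :
  (forall s, size s = k -> g s <= h s) -> sum_lists k g <= sum_lists k h.
Proof.
elim: k g h => [|k IH] g h H /=; first exact: H.
by apply: ler_sum => j _; apply: IH => s sk; apply: H; rewrite /= sk.
Qed.

Lemma eq_sum_lists k g h :
  (forall s, size s = k -> g s = h s) -> sum_lists k g = sum_lists k h.
Proof.
move=> H; apply/eqP; rewrite eq_le; apply/andP.
by split; apply: le_sum_lists => s /H ->.
Qed.

Lemma sum_listsD k g h :
  sum_lists k (fun s => g s + h s) = sum_lists k g + sum_lists k h.
Proof.
elim: k g h => [|k IH] g h //=; rewrite -big_split; apply: eq_bigr => j _.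
exact: IH.
Qed.

Lemma sum_listsZ k c g : sum_lists k (fun s => c * g s) = c * sum_lists k g.
Proof.
elim: k g => [|k IH] g //=; rewrite mulr_sumr; apply: eq_bigr => j _.
exact: IH.
Qed.

Lemma sum_lists_cst k c : sum_lists k (fun=> c) = #|J|%:R ^+ k * c.
Proof.
elim: k => [|k IH] /=; first by rewrite mul1r.
rewrite (eq_bigr (fun=> #|J|%:R ^+ k * c)); last by move=> j _; exact: IH.
by rewrite sumr_const -[LHS]mulr_natl exprS mulrA.
Qed.

Lemma norm_sum_lists k g : `|sum_lists k g| <= sum_lists k (fun s => `|g s|).
Proof.
elim: k g => [|k IH] g //=; rewrite (le_trans (ler_norm_sum _ _ _))//.
by apply: ler_sum => j _; exact: IH.
Qed.

(** Splits with a first part of length [i] choose [i] of the [k] positions, and the entries at both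
    groups of positions range freely. *)
Lemma sum_lists_conv k g h : sum_lists k (conv g h) =
  \sum_(i < k.+1) 'C(k, i)%:R * sum_lists i g * sum_lists (k - i) h.
Proof.
elim: k g h => [|k IH] g h.
  by rewrite big_ord1 /= /conv big_seq1 bin0 mul1r.
have -> : sum_lists k.+1 (conv g h) =
    \sum_(i < k.+1) 'C(k, i)%:R * sum_lists i.+1 g * sum_lists (k - i) h +
    \sum_(i < k.+1) 'C(k, i)%:R * sum_lists i g * sum_lists (k.+1 - i) h.
  rewrite -big_split /= .
  rewrite (eq_bigr (fun j => \sum_(i < k.+1)
     ('C(k, i)%:R * sum_lists i (g \o cons j) * sum_lists (k - i) h +
      'C(k, i)%:R * sum_lists i g * sum_lists (k - i) (h \o cons j)))).
    rewrite exchange_big /=; apply: eq_bigr => i _; rewrite big_split /=.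
    rewrite (subSn (_ : i <= k)%N); last by rewrite -ltnS.
    by rewrite mulr_sumr mulr_suml mulr_sumr.
  move=> j _; rewrite big_split /= -!IH -sum_listsD; apply: eq_sum_lists => s _.
  by rewrite /= conv_cons.
under eq_bigr do rewrite -mulrA; under [X in _ + X]eq_bigr do rewrite -mulrA.
under [RHS]eq_bigr do rewrite -mulrA.
exact: (sum_bin_pascal (fun i j => sum_lists i g * sum_lists j h)).
Qed.

Fixpoint picks s : seq (J * seq J) :=
  if s is a :: s' then (a, s') :: [seq (p.1, a :: p.2) | p <- picks s']
  else [::].

Lemma picksP s p : p \in picks s -> perm_eq s (p.1 :: p.2).
Proof.
elim: s p => //= a s IH p; rewrite inE => /predU1P[->//|/mapP[p' /IH ps ->]] /=.
rewrite -[X in perm_eq _ X]/([:: p'.1; a] ++ p'.2).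
rewrite perm_sym (perm_catCA [:: p'.1] [:: a]) /= perm_cons perm_sym.
exact: ps.
Qed.

Lemma picks_mem s a : a \in s -> exists2 p, p \in picks s & p.1 = a.
Proof.
elim: s => //= b s IH; rewrite inE => /predU1P[->|/IH[p ps pa]].
  by exists (b, s); rewrite ?mem_head.
by exists (p.1, b :: p.2) => //; rewrite inE map_f ?orbT.
Qed.

(** Each of the [k + 1] positions of the removed entry contributes the same sum. *)
Lemma sum_lists_picks k (G : J -> seq J -> R) :
  sum_lists k.+1 (fun s => \sum_(p <- picks s) G p.1 p.2) =
  k.+1%:R * \sum_(j : J) sum_lists k (G j).
Proof.
elim: k G => [|k IH] G.
  by rewrite mul1r; apply: eq_bigr => j _ /=; rewrite big_seq1.
have -> : sum_lists k.+2 (fun s => \sum_(p <- picks s) G p.1 p.2) =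
   \sum_j sum_lists k.+1 (fun s => G j s +
                             \sum_(p <- picks s) G p.1 (j :: p.2)).
  rewrite [LHS]/=; apply: eq_bigr => j _ /=; apply: eq_bigr => i _.
  by apply: eq_sum_lists => s _ /=; rewrite !big_cons !big_map.
rewrite (eq_bigr (fun j => sum_lists k.+1 (G j) +
   k.+1%:R * \sum_i sum_lists k (fun s => G i (j :: s)))); last first.
  by move=> j _; rewrite sum_listsD (IH (fun i s => G i (j :: s))).
rewrite big_split /= -mulr_sumr exchange_big /=.
rewrite -[k.+2]add1n natrD mulrDl mul1r; congr (_ + _ * _).
Qed.

Variable nb : rel J.

(* The entries of [s] can be ordered so that each is a neighbour of an element of
   [T] or of an earlier entry. *)
Fixpoint reach k T s : bool :=
  if k is k'.+1 then
    has (fun p => has (nb p.1) T && reach k' (p.1 :: T) p.2) (picks s)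
  else true.

(** A union bound over the entry attached next: [k + 1] positions and at most [size T * D] values,
    after which [T] has one more element. Bounding every intermediate size of [T] by the final one
    gives the power of [size T + k]. *)
Lemma reach_count (D : R) k T : 0 <= D ->
  (forall t, #|[pred j | nb j t]|%:R <= D) ->
  sum_lists k (fun s => (reach k T s)%:R) <=
  k`!%:R * (size T + k)%:R ^+ k * D ^+ k.
Proof.
move=> D0 HD; elim: k T => [|k IH] T /=; first by rewrite !mulr1.
pose G j s : R := (has (nb j) T)%:R * (reach k (j :: T) s)%:R.
apply: (@le_trans _ _ (sum_lists k.+1 (fun s => \sum_(p <- picks s) G p.1 p.2))).
  apply: (le_sum_lists (k := k.+1)) => s _ /=.
  elim: (picks s) => [|p l IHl] /=; first by rewrite big_nil.
  rewrite big_cons {1}/G -natrM mulnb.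
  case: (_ && _) => /=; last by rewrite add0r.
  rewrite lerDl sumr_ge0// => p' _; by rewrite mulr_ge0.
rewrite sum_lists_picks.
pose c : R := k`!%:R * (size T + k.+1)%:R ^+ k * D ^+ k.
have c0 : 0 <= c by rewrite !mulr_ge0 ?exprn_ge0.
have h1 : \sum_j sum_lists k (G j) <= \sum_j (has (nb j) T)%:R * c.
  apply: ler_sum => j _; rewrite sum_listsZ ler_wpM2l//.
  by rewrite (le_trans (IH _))//= addSnnS.
have h2 : \sum_j (has (nb j) T)%:R <= (size T)%:R * D :> R.
  elim: T {IH G c c0 h1} => [|t T IHT]; first by rewrite big1// mul0r.
  apply: (@le_trans _ _ (\sum_j ((nb j t)%:R + (has (nb j) T)%:R))).
    by apply: ler_sum => j _ /=; case: (nb j t) => //=; rewrite ?add0r// lerDl.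
  rewrite big_split /= -[in leRHS]natr1 mulrDl mul1r addrC lerD//.
  apply: le_trans (HD t); rewrite -sum1_card natr_sum [leRHS]big_mkcond /=.
  by apply: ler_sum => j _; rewrite inE; case: (nb j t).
rewrite -mulr_suml in h1.
apply: (@le_trans _ _ (k.+1%:R * ((size T)%:R * D * c))).
  by rewrite ler_wpM2l// (le_trans h1)// ler_wpM2r.
rewrite /c factS natrM !exprS.
rewrite (_ : k.+1%:R * _ = (k.+1%:R * k`!%:R * (size T + k.+1)%:R ^+ k * D ^+ k * D) * (size T)%:R); last by ring.
rewrite [leRHS](_ : _ = (k.+1%:R * k`!%:R * (size T + k.+1)%:R ^+ k * D ^+ k * D) * (size T + k.+1)%:R); last by ring.
rewrite ler_wpM2l ?ler_nat ?leq_addr//.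
by rewrite !mulr_ge0 ?exprn_ge0.
Qed.

(** Entries that neighbour the cluster are absorbed one at a time. When this stops with entries left
    over, membership in the cluster is the separating predicate. *)
Lemma reach_split k T s : reflexive nb -> size s = k -> ~~ reach k T s ->
  exists q, [/\ all q T, has (predC q) s &
    {in T ++ s &, forall a b, q a -> ~~ q b -> ~~ nb b a}].
Proof.
move=> nbr; elim: k T s => // k IH T s sk /hasPn H.
have [/hasP[a as_ nbT]|/hasPn noN] := boolP (has (fun a => has (nb a) T) s).
  have [p ps pa] := picks_mem as_.
  have := H _ ps; rewrite pa nbT /= -pa => nr.
  have psE := picksP ps.
  have pk : size p.2 = k by have /perm_size := psE; rewrite sk => -[].
  have [q [qT qs qN]] := IH (p.1 :: T) p.2 pk nr.
  exists q; split.
  - by case/andP: qT.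
  - by rewrite (perm_has _ psE) /= qs orbT.
  - have memE : T ++ s =i (p.1 :: T) ++ p.2.
      move=> u; rewrite !mem_cat (perm_mem psE) !inE.
      by case: (u == p.1); rewrite ?orbT.
    by move=> u v uT vT; apply: qN; rewrite -memE.
(* Reflexivity of [nb] enters here: a remaining entry equal to an element of the cluster would be
   its own neighbour. Hence a predicate on values can tell the remaining entries from the
   cluster. *)
have sT v : v \in s -> v \notin T.
  move=> vs; apply/negP => vT; have /negP := noN _ vs; apply.
  by apply/hasP; exists v => //; exact: nbr.
exists (mem T); split.
- by apply/allP.
- case: s sk {H noN} sT => // a s _ sT; rewrite /= sT ?mem_head//.
- move=> u v _; rewrite mem_cat => /orP[vT _|vs uT _]; first by rewrite inE vT.
  apply/negP => vu; have /negP := noN _ vs; apply.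
  by apply/hasP; exists u.
Qed.

(** Lists connected to [x] are few and have bounded cumulants. For the others [reach_split] supplies
    a separating predicate and [cumulant_split_le] a small cumulant, so that counting all lists is
    affordable. *)
Lemma sum_cumulant_le e (D eta : R) k : e [::] = 1 -> (forall u, `|e u| <= 1) ->
  0 <= eta -> 0 <= D -> reflexive nb ->
  (forall t, #|[pred j | nb j t]|%:R <= D) ->
  (forall q u, (size u <= k.+1)%N ->
    {in u &, forall a b, q a -> ~~ q b -> ~~ nb b a} ->
    `|e u - e (seq.filter q u) * e (seq.filter (predC q) u)| <= eta) ->
  `|\sum_x sum_lists k (cumulant e x)| <=
    cumulant_cst k * k`!%:R * (1 + k)%:R ^+ k * (#|J|%:R * D ^+ k) +
    cumulant_split_cst k * #|J|%:R ^+ k.+1 * eta.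
Proof.
move=> e0 e1 eta0 D0 nbr HD He.
have c0 := cumulant_split_cst_ge0 (R := R) k.
have c1 : 0 <= cumulant_cst k :> R by exact: le_trans (cumulant_cst_ge1 _).
rewrite (le_trans (ler_norm_sum _ _ _))//.
pose B : R := cumulant_cst k * (k`!%:R * (1 + k)%:R ^+ k * D ^+ k) +
   #|J|%:R ^+ k * (cumulant_split_cst k * eta).
apply: (@le_trans _ _ (\sum_(x : J) B)); last first.
  have -> : \sum_(x : J) B = #|J|%:R * B by rewrite sumr_const [RHS]mulr_natl.
  rewrite le_eqVlt; apply/orP; left; apply/eqP; rewrite /B exprS; ring.
apply: ler_sum => x _; rewrite (le_trans (norm_sum_lists _ _))//.
apply: (@le_trans _ _ (sum_lists k (fun s =>
    cumulant_cst k * (reach k [:: x] s)%:R + cumulant_split_cst k * eta))).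
  apply: le_sum_lists => s sk.
  have [rs|nrs] := boolP (reach k [:: x] s).
    by rewrite mulr1 -sk (le_trans (cumulant_le _ _ e1))// lerDl mulr_ge0 ?sk.
  rewrite mulr0 add0r.
  have [q [/= /andP[qx _] qs qN]] := reach_split nbr sk nrs.
  rewrite -sk; apply: (cumulant_split_le e0 e1 eta0 qx qs) => u us.
  apply: He; first by rewrite (leq_trans (size_subseq us))//= sk.
  by move=> a b au bu; apply: qN; [exact: (mem_subseq us)|exact: (mem_subseq us)].
rewrite sum_listsD sum_listsZ sum_lists_cst lerD2r ler_wpM2l//.
exact: (@reach_count D k [:: x]).
Qed.

(** Summing the recursion for joint moments over all lists gives the recursion between the moments
    and the cumulants of a single sum; the sums over [x] and over lists of length [i] are its
    cumulants of order [i + 1]. *)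
Lemma sum_lists_recursion e k : e [::] = 1 ->
  sum_lists k.+1 e = \sum_(i < k.+1) 'C(k, i)%:R *
    (\sum_x sum_lists i (cumulant e x)) * sum_lists (k - i) e.
Proof.
move=> e0 /=; rewrite (eq_bigr (fun x => sum_lists k (conv (cumulant e x) e))).
  under eq_bigr do rewrite sum_lists_conv.
  rewrite exchange_big; apply: eq_bigr => i _.
  by rewrite mulr_sumr mulr_suml.
move=> x _; apply: eq_sum_lists => s _ /=; exact: cumulant_conv.
Qed.

End sum_lists.

(** * Bounded integrals *)

Lemma indic_bool (R : pzRingType) (T : Type) (b : T -> bool) :
  \1_[set x | b x] = (fun x => (b x)%:R) :> (T -> R).
Proof.
apply/funext => x; rewrite indicE; congr (_%:R); congr nat_of_bool.
by apply/idP/idP; rewrite inE.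
Qed.

Section Rintegral_facts.
Context {R : realType} {d : measure_display} {T : measurableType d}.
Variable mu : {measure set T -> \bar R}.

Lemma integrable_EFinD (f g : T -> R) : mu.-integrable [set: T] (EFin \o f) ->
  mu.-integrable [set: T] (EFin \o g) ->
  mu.-integrable [set: T] (EFin \o (fun x => f x + g x)).
Proof. exact: integrableD. Qed.

Lemma integrable_EFinZ (c : R) (f : T -> R) : mu.-integrable [set: T] (EFin \o f) ->
  mu.-integrable [set: T] (EFin \o (fun x => c * f x)).
Proof. exact: integrableZl. Qed.

Lemma Rintegral_sum (I : eqType) (s : seq I) (F : I -> T -> R) :
  (forall i, i \in s -> mu.-integrable [set: T] (EFin \o F i)) ->
  mu.-integrable [set: T] (EFin \o (fun x => \sum_(i <- s) F i x)) /\
  \int[mu]_x (\sum_(i <- s) F i x) = \sum_(i <- s) \int[mu]_x F i x.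
Proof.
elim: s => [|i s IH] Fi.
  have E : (fun x => \sum_(i <- [::]) F i x) = cst 0.
    by apply/funext => x; rewrite big_nil.
  split; first by rewrite E; exact: integrable0.
  by rewrite big_nil E /Rintegral; under eq_integral do rewrite /=; rewrite integral0.
have [|si sE] := IH; first by move=> j js; apply: Fi; rewrite inE js orbT.
have Fii : mu.-integrable [set: T] (EFin \o F i) by apply: Fi; rewrite mem_head.
have E : (fun x => \sum_(j <- i :: s) F j x) = (fun x => F i x + \sum_(j <- s) F j x).
  by apply/funext => x; rewrite big_cons.
rewrite E big_cons; split; last by rewrite RintegralD// sE.
exact: integrable_EFinD.
Qed.

Lemma Rintegral_bool (b : T -> bool) : measurable [set x | b x] ->
  \int[mu]_x (b x)%:R = fine (mu [set x | b x]).
Proof.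
move=> mb; rewrite /Rintegral -(setIT [set x | b x]) -integral_indic//.
by congr fine; apply: eq_integral => x _; rewrite indic_bool.
Qed.

End Rintegral_facts.

Section bounded_integration.
Context {R : realType} {d : measure_display} {T : measurableType d}.
Variable P : probability T R.

Lemma bounded_integrable (f : T -> R) (M : R) : measurable_fun [set: T] f ->
  (forall x, `|f x| <= M) -> P.-integrable [set: T] (EFin \o f).
Proof.
move=> mf fM; apply: (@le_integrable _ _ _ _ _ _ _ (EFin \o cst M)) => //.
- exact/measurable_EFinP.
- by move=> x _ /=; rewrite lee_fin (le_trans (fM x))// ler_norm.
- exact: finite_measure_integrable_cst.
Qed.

Lemma Rintegral_bounded (f : T -> R) (M : R) : measurable_fun [set: T] f ->
  (forall x, `|f x| <= M) -> `|\int[P]_x f x| <= M.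
Proof.
move=> mf fM; have fi := bounded_integrable mf fM.
rewrite (le_trans (le_normr_Rintegral _ _))//.
rewrite [leRHS](_ : M = \int[P]_x (cst M x)); last first.
  by rewrite (Rintegral_cst P measurableT) (_ : fine _ = 1) ?mulr1//= (probability_setT P).
apply: le_Rintegral => //.
- apply: (@bounded_integrable _ M) => [|x]; last by rewrite normr_id.
  exact: measurableT_comp.
- exact: finite_measure_integrable_cst.
Qed.

Lemma Rintegral_sub_bounded (f g : T -> R) (M c : R) :
  measurable_fun [set: T] f -> measurable_fun [set: T] g ->
  (forall x, `|f x| <= M) -> (forall x, `|g x| <= M) ->
  (forall x, `|f x - g x| <= c) -> `|\int[P]_x f x - \int[P]_x g x| <= c.
Proof.
move=> mf mg fM gM fg.
rewrite -RintegralB//; [|exact: bounded_integrable fM|exact: bounded_integrable gM].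
by apply: Rintegral_bounded => //; exact: measurable_funB.
Qed.

End bounded_integration.

Lemma measurable_Rintegral2 {R : realType} {d1 d2 : measure_display}
    {T1 : measurableType d1} {T2 : measurableType d2} (P2 : probability T2 R)
    (f : T1 * T2 -> R) (M : R) :
  measurable_fun [set: T1 * T2] f -> (forall z, `|f z| <= M) ->
  measurable_fun [set: T1] (fun x => \int[P2]_y f (x, y)).
Proof.
move=> mf fM.
(* Adding [M] makes the integrand nonnegative, so that the measurability part of Tonelli's theorem
   applies; the constant is subtracted afterwards. *)
have mfM : measurable_fun [set: T1 * T2] (fun z => f z + M) by exact: measurable_funD.
have mE : measurable_fun [set: T1 * T2] (EFin \o (fun z => f z + M)) by exact/measurable_EFinP.
have := @measurable_fun_fubini_tonelli_F _ _ _ _ _ P2 _ mE; move=> mF.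
have -> : (fun x => \int[P2]_y f (x, y)) =
    (fun x => fine (fubini_F P2 (EFin \o (fun z => f z + M)) x) - M).
  apply/funext => x; rewrite /fubini_F.
  have mfx : measurable_fun [set: T2] (fun y => f (x, y)).
    exact: measurableT_comp mf (pair1_measurable x).
  have fi := bounded_integrable P2 mfx (fun y => fM (x, y)).
  have ci : P2.-integrable [set: T2] (EFin \o cst M) by exact: finite_measure_integrable_cst.
  rewrite -[X in X - _]/(\int[P2]_y (f (x, y) + M)) RintegralD// Rintegral_cst//.
  by rewrite (_ : fine _ = 1) ?mulr1 ?addrK//= (probability_setT P2).
apply: measurable_funB => //; apply: measurableT_comp => //; apply: mF.
by move=> z; rewrite lee_fin -lerBlDr sub0r; have := fM z; rewrite ler_norml => /andP[].
Qed.

Section bounded_fubini.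
Context {R : realType} {d1 d2 : measure_display} {T1 : measurableType d1}
  {T2 : measurableType d2}.
Variables (P1 : probability T1 R) (P2 : probability T2 R).
Lemma product_probability_setT : (P1 \x P2)%E [set: T1 * T2] = 1%E.
Proof.
rewrite -setXTT product_measure1E//.
transitivity (1 * 1 : \bar R)%E; last by rewrite mule1.
by congr (_ * _)%E; exact: probability_setT.
Qed.

Variables (f : T1 * T2 -> R) (M : R).
Hypotheses (mf : measurable_fun [set: T1 * T2] f) (fM : forall z, `|f z| <= M).

Lemma bounded_integrable_prod : (P1 \x P2)%E.-integrable [set: T1 * T2] (EFin \o f).
Proof.
apply: measurable_bounded_integrable => //.
  by rewrite [X in (X < _)%E]product_probability_setT ltry.
exists M; split; first exact: num_real.
by move=> x Mx z _ /=; rewrite (le_trans (fM z))// ltW.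
Qed.

Let inner1 x : measurable_fun [set: T2] (fun y => f (x, y)).
Proof. exact: measurableT_comp mf (pair1_measurable x). Qed.

Let inner2 y : measurable_fun [set: T1] (fun x => f (x, y)).
Proof. exact: measurableT_comp mf (pair2_measurable y). Qed.

Let inner1E x : (\int[P2]_y (f (x, y))%:E = (\int[P2]_y f (x, y))%:E)%E.
Proof.
rewrite fineK//; apply: integrable_fin_num => //.
exact: bounded_integrable (inner1 x) (fun y => fM (x, y)).
Qed.

Let inner2E y : (\int[P1]_x (f (x, y))%:E = (\int[P1]_x f (x, y))%:E)%E.
Proof.
rewrite fineK//; apply: integrable_fin_num => //.
exact: bounded_integrable (inner2 y) (fun x => fM (x, y)).
Qed.

Lemma Rfubini : \int[P1]_x \int[P2]_y f (x, y) = \int[P2]_y \int[P1]_x f (x, y).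
Proof.
rewrite /Rintegral; congr fine.
transitivity (\int[P1]_x \int[P2]_y (f (x, y))%:E)%E.
  by apply: eq_integral => x _; rewrite inner1E.
rewrite (Fubini bounded_integrable_prod).
by apply: eq_integral => x _; rewrite inner2E.
Qed.

Lemma Rfubini_prod : \int[P1]_x \int[P2]_y f (x, y) = fine (\int[P1 \x P2]_z (f z)%:E)%E.
Proof.
rewrite -(integral12_prod_meas1 bounded_integrable_prod) /Rintegral; congr fine.
by apply: eq_integral => x _; rewrite /fubini_F /= inner1E.
Qed.

End bounded_fubini.

(** * Decoupling a past and a future *)

Lemma measure_bigcup_finType {R : realType} {d : measure_display}
    {T : measurableType d} (mu : {measure set T -> \bar R}) (I : finType)
    (F : I -> set T) :
  (forall i, measurable (F i)) -> trivIset [set: I] F ->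
  mu (\bigcup_i F i) = (\sum_(i : I) mu (F i))%E.
Proof.
move=> mF tF; rewrite (measure_fin_bigcup mu)//; last exact: finite_finset.
rewrite [RHS](@bigfs _ _ _ _ (index_enum I) predT)//.
- by rewrite (_ : [set` _] = setT)//; apply/seteqP; split.
- exact: index_enum_uniq.
- by move=> i _; rewrite mem_index_enum.
Qed.

(** The sum counts the naturals below both [y] and [n]. With [y = n h] it writes a function, up to
    [1 / n], as an average of indicators of its superlevel sets. *)
Lemma sum_indic_bounds {R : realFieldType} (y : R) n : 0 <= y ->
  Num.min n%:R y <= \sum_(i < n) ((i%:R : R) < y)%R%:R <= y + 1.
Proof.
move=> y0; elim: n => [|n /andP[IH1 IH2]].
  by rewrite big_ord0 ge_min lexx /= addr_ge0.
have lenn : \sum_(i < n) ((i%:R : R) < y)%R%:R <= n%:R :> R.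
  rewrite -[n in leRHS]card_ord -sum1_card natr_sum ler_sum// => i _.
  by case: (_ < _).
rewrite big_ord_recr /=; case: ltP => ny /=.
  rewrite (min_idPl (ltW ny)) in IH1.
  by rewrite ge_min -natr1 !lerD2r IH1 (le_trans lenn (ltW ny)).
by rewrite addr0 IH2 andbT (le_trans _ IH1)// (min_idPr ny) ge_min lexx orbT.
Qed.

Section decoupling.
Context {R : realType} {d d1 d2 : measure_display} {T : measurableType d}
  {S1 : measurableType d1} {S2 : measurableType d2}.
Variable P : probability T R.
Variables (G H : set (set T)) (g : T -> R).
Hypotheses (GS : sigma_algebra [set: T] G) (Gm : G `<=` measurable)
  (Hm : H `<=` measurable).
Hypotheses (g0 : forall w, 0 <= g w) (gi : P.-integrable [set: T] (EFin \o g)).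
Hypothesis gH : forall B, H B ->
  {ae P, forall w, `|cond_prob P G B w - fine (P B)| <= g w}.

Let mg : measurable_fun [set: T] g.
Proof. by apply/measurable_EFinP; exact: measurable_int gi. Qed.

Let b : \bar R := (\int[P]_w (g w)%:E)%E.

(* [g] is the essential supremum of the deviations of the conditional
   probabilities, so [b] is the absolute regularity coefficient. *)
Lemma decouple_rectangle A B : G A -> H B ->
  (P (A `&` B) <= P A * P B + \int[P]_(w in A) (g w)%:E)%E.
Proof.
move=> GA HB; have mA := Gm GA; have mB := Hm HB.
have [cG ci cE] := is_cond_probP P GS Gm mB.
set c := cond_prob P G B in cG ci cE *.
have mc : measurable_fun [set: T] c.
  by apply/measurable_EFinP; exact: measurable_int ci.
rewrite setIC -(cE _ GA).
have PBf : P B \is a fin_num by exact: fin_num_measure.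
have ciA : P.-integrable A (EFin \o c) by exact: integrableS ci.
have giA : P.-integrable A (EFin \o g) by exact: integrableS gi.
have mc0 : measurable_fun A (EFin \o c^\+).
  apply: measurable_funTS; apply/measurable_EFinP; exact: measurable_funrpos.
have cA : P.-integrable A (cst (P B)).
  by rewrite -(fineK PBf); apply: finite_measure_integrable_cst.
apply: (@le_trans _ _ (\int[P]_(w in A) ((c^\+) w)%:E)%E).
  apply: le_integral => //.
  - exact: integrable_funrpos.
  - by move=> w _; rewrite lee_fin /funrpos le_max lexx.
apply: (@le_trans _ _ (\int[P]_(w in A) (P B + (g w)%:E))%E).
  apply: ae_ge0_le_integral => //.
  - by move=> w _; rewrite lee_fin /funrpos le_max lexx orbT.
  - by move=> w _; rewrite adde_ge0// lee_fin.
  - by apply: emeasurable_funD => //; apply/measurable_EFinP; exact: measurable_funTS.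
  - have := gH HB; apply: filterS => w cw _.
    rewrite -(fineK PBf) lee_fin /funrpos ge_max addr_ge0 ?fine_ge0// andbT.
    by rewrite -lerBlDl (le_trans _ cw)// ler_norm.
by rewrite integralD// integral_cst// muleC.
Qed.

Variables (V1 : T -> S1) (V2 : T -> S2).
Hypotheses (V1G : forall B, measurable B -> G (V1 @^-1` B))
  (V2H : forall B, measurable B -> H (V2 @^-1` B)).

Let mV1 : measurable_fun [set: T] V1.
Proof. by move=> _ B mB; rewrite setTI; exact/Gm/V1G. Qed.

Let mV2 : measurable_fun [set: T] V2.
Proof. by move=> _ B mB; rewrite setTI; exact/Hm/V2H. Qed.

Let V w := (V1 w, V2 w).
Let W (z : T * T) := (V1 z.1, V2 z.2).

Let mV : measurable_fun [set: T] V.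
Proof. exact: measurable_fun_pair. Qed.

Let mW : measurable_fun [set: T * T] W.
Proof.
apply: measurable_fun_pair.
  exact: measurableT_comp mV1 measurable_fst.
exact: measurableT_comp mV2 measurable_snd.
Qed.

Let mVC (C : set (S1 * S2)) : measurable C -> measurable (V @^-1` C).
Proof. by move=> mC; rewrite -[X in measurable X]setTI; exact: mV. Qed.

Let mWC (C : set (S1 * S2)) : measurable C -> measurable (W @^-1` C).
Proof. by move=> mC; rewrite -[X in measurable X]setTI; exact: mW. Qed.

(** Finite unions of rectangles with disjoint bases: the section over [x] depends only on the
    finitely valued [p x]. Two such sets are combined over the product partition, which makes the
    ring operations easy. Disjoint bases let the costs [\int[P]_(w in A) g] of the single rectangles
    add up to at most [b], whatever their number. *)
Let step_rect (C : set (S1 * S2)) := exists (I : finType) (p : S1 -> I)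
  (B : I -> set S2), [/\ forall i, measurable (p @^-1` [set i]),
    forall i, measurable (B i) & C = [set z | B (p z.1) z.2]].

Let step_rect_setring : setring step_rect.
Proof.
have pairE (I1 I2 : finType) (p1 : S1 -> I1) (p2 : S1 -> I2) i :
    (forall i, measurable (p1 @^-1` [set i])) ->
    (forall i, measurable (p2 @^-1` [set i])) ->
    measurable ((fun x => (p1 x, p2 x)) @^-1` [set i]).
  move=> m1 m2; rewrite (_ : _ @^-1` _ = (p1 @^-1` [set i.1]) `&` (p2 @^-1` [set i.2])).
    exact: measurableI.
  by apply/seteqP; split=> x /=; [move=> <-|case: i => i1 i2 [/= -> ->]].
split.
- exists unit, (fun=> tt), (fun=> set0); split => //.
  move=> []; rewrite (_ : _ @^-1` _ = setT)//.
  by apply/seteqP; split.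
- move=> C D [I1 [p1 [B1 [m1 mB1 ->]]]] [I2 [p2 [B2 [m2 mB2 ->]]]].
  exists (I1 * I2)%type, (fun x => (p1 x, p2 x)), (fun i => B1 i.1 `|` B2 i.2).
  split=> // i; first exact: pairE.
  exact: measurableU.
- move=> C D [I1 [p1 [B1 [m1 mB1 ->]]]] [I2 [p2 [B2 [m2 mB2 ->]]]].
  exists (I1 * I2)%type, (fun x => (p1 x, p2 x)), (fun i => B1 i.1 `\` B2 i.2).
  split=> // i; first exact: pairE.
  exact: measurableD.
Qed.

Let measurable_step_rect (C : set (S1 * S2)) : measurable C -> <<sr step_rect>> C.
Proof.
rewrite measurable_prod_measurableType.
have rect A B : measurable A -> measurable B -> step_rect (A `*` B).
  move=> mA mB; exists bool, (fun x => x \in A), (fun i => if i then B else set0).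
  split=> //.
  - case; last first.
      rewrite (_ : _ @^-1` _ = ~` A); first exact: measurableC.
      by apply/seteqP; split=> x /=; [move/negbT; rewrite notin_setE|move=> nA; apply/negbTE; rewrite notin_setE].
    rewrite (_ : _ @^-1` _ = A)//.
    by apply/seteqP; split=> x /=; [exact: set_mem|exact: mem_set].
  - by case.
  - apply/seteqP; split=> -[x y] /=.
      by case=> Ax By; rewrite mem_set.
    by case: ifPn => //; rewrite inE => Ax By.
have [r0 rD rU] := smallest_sigma_ring step_rect.
apply: smallest_sub; last by move=> _ [A mA [B mB <-]]; apply: sub_g_sigma_ring; exact: rect.
split => // A mA; apply: rD => //; apply: sub_g_sigma_ring.
by rewrite -setXTT; exact: rect.
Qed.

Let b_fin : b \is a fin_num.
Proof. exact: integrable_fin_num gi. Qed.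

Let decouple_step_rect C : step_rect C ->
  measurable C /\ (P (V @^-1` C) <= (P \x P) (W @^-1` C) + b)%E.
Proof.
move=> [I [p [B [mp mB CE]]]].
have CU : C = \bigcup_i ((p @^-1` [set i]) `*` B i).
  rewrite CE; apply/seteqP; split=> [[x y] /= Bxy|[x y] [i _ [/= <-]]//].
  by exists (p x).
have mC : measurable C.
  rewrite CU; apply: fin_bigcup_measurable; first exact: finite_finset.
  by move=> i _; exact: measurableX.
split=> //.
pose A i := V1 @^-1` (p @^-1` [set i]); pose D i := V2 @^-1` B i.
have GA i : G (A i) by exact: V1G.
have HD i : H (D i) by exact: V2H.
have mA i : measurable (A i) by exact: Gm.
have mD i : measurable (D i) by exact: Hm.
have tA : trivIset [set: I] A by move=> i j _ _ [w [/= <- <-]].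
have -> : V @^-1` C = \bigcup_i (A i `&` D i).
  by rewrite CU preimage_bigcup.
have -> : W @^-1` C = \bigcup_i (A i `*` D i).
  by rewrite CU preimage_bigcup.
rewrite measure_bigcup_finType; last 2 first.
- by move=> i; exact: measurableI.
- by move=> i j _ _ [w [[/= <- _] [<- _]]].
rewrite measure_bigcup_finType; last 2 first.
- by move=> i; exact: measurableX.
- by move=> i j _ _ [w [[/= <- _] [<- _]]].
apply: (@le_trans _ _ (\sum_(i : I) (P (A i) * P (D i) + \int[P]_(w in A i) (g w)%:E))%E).
  by apply: lee_sum => i _; exact: decouple_rectangle.
rewrite big_split /= leeD//.
  by apply: lee_sum => i _; rewrite product_measure1E.
rewrite -ge0_integral_bigsetU//=.
- apply: ge0_subset_integral => //.
    by apply: bigsetU_measurable.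
    exact/measurable_EFinP.
  by move=> w _; rewrite lee_fin.
- exact: index_enum_uniq.
- by move=> i j _ _ [w [/= <- <-]].
- by apply: measurable_funTS; apply/measurable_EFinP.
- by move=> w _; rewrite lee_fin.
Qed.

(** A monotone class argument: the inequality passes to limits of increasing and, the measures being
    finite, of decreasing sequences, and the sets [step_rect] form a ring generating the product
    sigma-algebra. *)
Lemma decouple_set C : measurable C -> (P (V @^-1` C) <= (P \x P) (W @^-1` C) + b)%E.
Proof.
pose M := [set C : set (S1 * S2) |
  measurable C /\ (P (V @^-1` C) <= (P \x P) (W @^-1` C) + b)%E].
suff MM : monotone M.
  by move=> /measurable_step_rect /(monotone_setring_sub_g_sigma_ring MM
    step_rect_setring (fun C => @decouple_step_rect C)) [].
split=> F F_mono MF.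
  have mF i : measurable (F i) by have [] := MF i.
  have mU : measurable (\bigcup_n F n) by exact: bigcup_measurable.
  split=> //; rewrite [in leLHS]preimage_bigcup.
  have /cvg_lim <- // : (P \o (fun n => V @^-1` F n)) n @[n --> \oo] -->
      P (\bigcup_n V @^-1` F n).
    apply: nondecreasing_cvg_mu; first by move=> i; exact: mVC.
      by apply: bigcup_measurable => i _; exact: mVC.
    by move=> i j ij; apply/subsetPset => w /=; have /subsetPset := F_mono _ _ ij; exact.
  apply: lime_le.
    apply/cvg_ex; exists (P (\bigcup_n V @^-1` F n)).
    apply: nondecreasing_cvg_mu; first by move=> i; exact: mVC.
      by apply: bigcup_measurable => i _; exact: mVC.
    by move=> i j ij; apply/subsetPset => w /=; have /subsetPset := F_mono _ _ ij; exact.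
  apply: nearW => n /=; have [_ /le_trans] := MF n; apply.
  rewrite leeD2r// le_measure ?inE//; [exact: mWC|exact: mWC|].
  by move=> z Fz; exists n.
have mF i : measurable (F i) by have [] := MF i.
have mU : measurable (\bigcap_n F n) by exact: bigcap_measurable.
split=> //; rewrite -leeBlDr//.
have cvgW : (((P \x P)%E \o (fun n => W @^-1` F n)) n @[n --> \oo] -->
    (P \x P)%E (W @^-1` (\bigcap_n F n))).
  rewrite preimage_bigcap; apply: nonincreasing_cvg_mu.
  - apply: (@le_lt_trans _ _ ((P \x P)%E [set: T * T])).
      by apply: le_measure; rewrite ?inE//; exact: mWC.
    rewrite -setXTT [X in (X < _)%E]product_measure1E//.
    by rewrite lte_mul_pinfty// ?ltey_eq ?fin_num_measure//.
  - by move=> i; exact: mWC.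
  - by apply: bigcap_measurable => // i _; exact: mWC.
  - by move=> i j ij; apply/subsetPset => w /=; have /subsetPset := F_mono _ _ ij; exact.
rewrite -(cvg_lim _ cvgW)//; apply: lime_ge; first by apply/cvg_ex; eexists; exact: cvgW.
apply: nearW => n /=; rewrite leeBlDr//; have [_] := MF n; apply: le_trans.
rewrite le_measure ?inE//; [exact: mVC|exact: mVC|].
by move=> w Fw; exact: Fw.
Qed.

(** The function is approximated from above within [1 / n] by an average of [n] indicators of
    superlevel sets. Each indicator costs [b], and so does their average. *)
Let decouple_unit (h : S1 * S2 -> R) : measurable_fun [set: S1 * S2] h ->
  (forall z, 0 <= h z <= 1) ->
  \int[P]_w h (V w) <= \int[P]_w \int[P]_w' h (V1 w, V2 w') + fine b.
Proof.
move=> mh h01.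
have h1 z : `|h z| <= 1 by have /andP[h0 ?] := h01 z; rewrite ger0_norm.
have mhW : measurable_fun [set: T * T] (h \o W) by exact: measurableT_comp.
have mhV : measurable_fun [set: T] (h \o V) by exact: measurableT_comp.
rewrite (@Rfubini_prod _ _ _ _ _ P P (h \o W) 1)//; last by move=> z; exact: h1.
apply/ler_addgt0Pr => /= e e0.
pose n := (Num.bound e^-1).+1.
have n0 : 0 < n%:R :> R by rewrite ltr0n.
have ne : n%:R^-1 <= e.
  rewrite invf_ple ?posrE//; apply: (le_trans (ltW (archi_boundP _))).
    by rewrite invr_ge0 ltW.
  by rewrite ler_nat.
pose K i := [set z | i%:R < n%:R * h z].
pose s (z : S1 * S2) : R := n%:R^-1 * \sum_(i < n) (i%:R < n%:R * h z)%R%:R.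
have s_bd z : h z <= s z <= h z + n%:R^-1.
  have /andP[h0 hz1] := h01 z.
  have /andP[l u] := sum_indic_bounds n (mulr_ge0 (ltW n0) h0).
  move: l; rewrite min_r; last by rewrite ler_piMr// ltW.
  move=> l; apply/andP; split; rewrite /s.
    by rewrite ler_pdivlMl.
  by rewrite ler_pdivrMl// mulrDr mulfV ?lt0r_neq0.
have mK (i : nat) : measurable (K i).
  have mnh : measurable_fun [set: S1 * S2] (fun z => n%:R * h z) by exact: measurable_funM.
  rewrite (_ : K i = (fun z => n%:R * h z) @^-1` `]i%:R, +oo[%classic).
    by rewrite -[X in measurable X]setTI; apply: mnh => //; exact: measurable_itv.
  by apply/seteqP; split=> z /=; rewrite in_itv/= andbT.
have mb i : measurable_fun [set: S1 * S2] (fun z => (i%:R < n%:R * h z)%R%:R : R).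
  rewrite (_ : (fun _ => _) = \1_(K i)); first exact: measurable_indic.
  by rewrite indic_bool.
have b1 i z : `|(i%:R < n%:R * h z)%R%:R : R| <= 1.
  by case: (_ < _); rewrite ?normr1 ?normr0.
have iV i : P.-integrable [set: T] (EFin \o (fun w => (i%:R < n%:R * h (V w))%R%:R : R)).
  apply: (@bounded_integrable _ _ _ _ _ 1) => //.
  exact: (measurableT_comp (mb i) mV).
have iW i : (P \x P)%E.-integrable [set: T * T]
    (EFin \o (fun w => (i%:R < n%:R * h (W w))%R%:R : R)).
  apply: (@bounded_integrable_prod _ _ _ _ _ _ _ _ 1) => //.
  exact: (measurableT_comp (mb i) mW).
have [sVi sV] := @Rintegral_sum _ _ _ P _ (index_enum 'I_n)
  (fun (i : 'I_n) w => (i%:R < n%:R * h (V w))%R%:R) (fun i _ => iV i).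
have [sWi sW] := @Rintegral_sum _ _ _ (P \x P)%E _ (index_enum 'I_n)
  (fun (i : 'I_n) w => (i%:R < n%:R * h (W w))%R%:R) (fun i _ => iW i).
have ihW : (P \x P)%E.-integrable [set: T * T] (EFin \o (h \o W)).
  by apply: (@bounded_integrable_prod _ _ _ _ _ _ _ _ 1) => // z; exact: h1.
have PK (i : nat) : \int[P]_w (i%:R < n%:R * h (V w))%R%:R <=
    \int[(P \x P)%E]_w (i%:R < n%:R * h (W w))%R%:R + fine b.
  rewrite (Rintegral_bool P (b := fun w => i%:R < n%:R * h (V w))); last exact: (mVC (mK i)).
  rewrite (Rintegral_bool (P \x P)%E (b := fun w => i%:R < n%:R * h (W w))); last exact: (mWC (mK i)).
  have PPf : (P \x P)%E (W @^-1` K i) \is a fin_num.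
    have := @integrable_fin_num _ _ _ _ _ measurableT _ (iW i).
    rewrite (_ : (\int[_]_(_ in _) _)%E = (P \x P)%E (W @^-1` K i))//.
    rewrite -[X in _ = (_ X)](setIT) -integral_indic//; last exact: (mWC (mK i)).
    by apply: eq_integral => w _ /=; rewrite (indic_bool _ (fun w => i%:R < n%:R * h (W w))).
  rewrite -fineD// fine_le//.
  - by rewrite fin_num_measure//; exact: (mVC (mK i)).
  - by rewrite fin_numD PPf.
  - exact: (decouple_set (mK i)).
apply: (@le_trans _ _ (\int[P]_w s (V w))).
  apply: le_Rintegral => //.
  - by apply: (@bounded_integrable _ _ _ _ _ 1) => // w; exact: h1.
  - exact: integrable_EFinZ.
  - by move=> w _; have /andP[] := s_bd (V w).
rewrite RintegralZl//= sV.
apply: (@le_trans _ _ (n%:R^-1 * \sum_(i < n)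
   (\int[(P \x P)%E]_w (i%:R < n%:R * h (W w))%R%:R + fine b))).
  by rewrite ler_wpM2l ?invr_ge0 ?(ltW n0)//; apply: ler_sum => i _; exact: PK.
rewrite big_split /= sumr_const card_ord mulrDr -[X in _ + _ * X]mulr_natl mulKf ?lt0r_neq0//.
rewrite addrAC lerD2r -sW -RintegralZl//.
apply: (@le_trans _ _ (\int[(P \x P)%E]_w ((h \o W) w + n%:R^-1))).
  have iC : (P \x P)%E.-integrable [set: T * T] (EFin \o cst (n%:R^-1 : R)).
    by apply: (@bounded_integrable_prod _ _ _ _ _ _ _ _ n%:R^-1) => // z /=; rewrite ger0_norm ?invr_ge0 ?(ltW n0).
  apply: le_Rintegral => //.
  - exact: integrable_EFinZ.
  - exact: integrable_EFinD.
  - by move=> w _; have /andP[] := s_bd (W w).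
have iC : (P \x P)%E.-integrable [set: T * T] (EFin \o cst (n%:R^-1 : R)).
  by apply: (@bounded_integrable_prod _ _ _ _ _ _ _ _ n%:R^-1) => // z /=; rewrite ger0_norm ?invr_ge0 ?(ltW n0).
rewrite RintegralD// lerD2l (_ : \int[_]_w _ = n%:R^-1)//.
by rewrite Rintegral_cst// [X in fine X]product_probability_setT mulr1.
Qed.

(** Applied to [(1 + h) / 2] and [(1 - h) / 2], which take values in the unit interval, the
    one-sided bound gives both signs; undoing the halving doubles [b]. *)
Lemma decouple_fun (h : S1 * S2 -> R) : measurable_fun [set: S1 * S2] h ->
  (forall z, `|h z| <= 1) ->
  `|\int[P]_w h (V1 w, V2 w) - \int[P]_w \int[P]_w' h (V1 w, V2 w')| <= 2 * fine b.
Proof.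
move=> mh h1.
have mhV : measurable_fun [set: T] (h \o V) by exact: measurableT_comp.
have mhW : measurable_fun [set: T * T] (h \o W) by exact: measurableT_comp.
have mhWw w : measurable_fun [set: T] (fun w' => h (V1 w, V2 w')).
  exact: (measurableT_comp mhW (pair1_measurable w)).
have half (e : R) : `|e| = 1 -> e * \int[P]_w h (V1 w, V2 w) <=
    e * \int[P]_w \int[P]_w' h (V1 w, V2 w') + 2 * fine b.
  move=> e1.
  pose k z := (1 + e * h z) / 2.
  have mk : measurable_fun [set: S1 * S2] k.
    by apply: measurable_funM => //; apply: measurable_funD => //; exact: measurable_funM.
  have k01 z : 0 <= k z <= 1.
    have : `|e * h z| <= 1 by rewrite normrM e1 mul1r.
    rewrite ler_norml => /andP[l u]; rewrite /k; apply/andP; split; lra.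
  have cE (f : T -> R) : measurable_fun [set: T] f -> (forall w, `|f w| <= 1) ->
      \int[P]_w ((1 + e * f w) / 2) = (1 + e * \int[P]_w f w) / 2.
    move=> mf f1; have fi := bounded_integrable P mf f1.
    have efi : P.-integrable [set: T] (EFin \o (fun w => e * f w)).
      apply: (@bounded_integrable _ _ _ _ _ 1); first exact: measurable_funM.
      by move=> w; rewrite normrM e1 mul1r.
    have ci : P.-integrable [set: T] (EFin \o cst (1 : R)) by exact: finite_measure_integrable_cst.
    rewrite RintegralZr//; last first.
      exact: integrable_EFinD.
    rewrite RintegralD// RintegralZl// Rintegral_cst//.
    by rewrite (_ : fine _ = 1) ?mul1r//= (probability_setT P).
  have := decouple_unit mk k01; rewrite /k cE//.
  under [X in _ <= X + _ -> _]eq_Rintegral do rewrite cE//.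
  rewrite cE//.
  - by move=> ?; lra.
  - by apply: (measurable_Rintegral2 P (f := h \o W) (M := 1)) => // z; exact: h1.
  - by move=> w; apply: Rintegral_bounded.
have := half 1 (normr1 _); have := half (-1) (normrN1 _).
rewrite !mul1r !mulN1r ler_norml => ? ?; apply/andP; split; lra.
Qed.

End decoupling.

(** * Decoupling interleaved sets of times *)

Section decorrelation.
Context {R : realType} {d : measure_display} {T : measurableType d}.
Variables (P : probability T R) (N : nat) (V : T -> N.-tuple R) (m : nat) (c : R).
Hypotheses (mV : measurable_fun [set: T] V) (m_gt0 : (0 < m)%N) (c0 : 0 <= c).

Local Notation S := (N.-tuple R).

(** Both arguments are whole windows, so that some coordinates of an argument may be replaced by
    those of an independent copy without changing the type of [G]. *)
Definition depends_on (T1 T2 : pred 'I_N) (G : S * S -> R) :=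
  forall x x' y y' : S, (forall i, T1 i -> tnth x i = tnth x' i) ->
    (forall i, T2 i -> tnth y i = tnth y' i) -> G (x, y) = G (x', y').

(* Two blocks separated at time [a] decouple at cost [c]; interleaved time sets are
   treated below by cutting off their last blocks one at a time. *)
Hypothesis cut : forall (a : nat) (h : S * S -> R),
  measurable_fun [set: S * S] h -> (forall z, `|h z| <= 1) ->
  depends_on (fun i => i <= a)%N (fun i => a + m <= i)%N h ->
  `|\int[P]_w h (V w, V w) - \int[P]_w \int[P]_w' h (V w, V w')| <= c.

Let splice a (y z : S) : S := [tuple if (i <= a)%N then tnth y i else tnth z i | i < N].

Let measurable_splice a d' (T' : measurableType d') (y z : T' -> S) :
  measurable_fun [set: T'] y -> measurable_fun [set: T'] z ->
  measurable_fun [set: T'] (fun t => splice a (y t) (z t)).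
Proof.
move=> /measurable_fun_tnthP my /measurable_fun_tnthP mz.
apply/measurable_fun_tnthP => i.
have -> : (tnth (T:=R))^~ i \o (fun t => splice a (y t) (z t)) =
    (fun t => if (i <= a)%N then tnth (y t) i else tnth (z t) i).
  by apply/funext => t /=; rewrite tnth_mktuple.
by case: (i <= a)%N; [exact: my|exact: mz].
Qed.

Let Rintegral_const (k : R) : \int[P]_w k = k.
Proof.
by rewrite Rintegral_cst// (_ : fine _ = 1) ?mulr1//= (probability_setT P).
Qed.

Let separated (T1 T2 : {set 'I_N}) := forall i j, i \in T1 -> j \in T2 ->
  (i + m <= j)%N \/ (j + m <= i)%N.

(** The last time [a] of [T1] precedes some time of [T2]. The part of [T2] beyond [a] is first drawn
    from an independent copy [v], at cost [c]. For fixed [v] the function depends on fewer times,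
    and the induction hypothesis separates its two arguments. Finally the two pieces of the second
    argument are rejoined, again at cost [c]. The successive integrals are [A0] to [A3]. *)
Let decorrelate_step p (T1 T2 : {set 'I_N}) (G : S * S -> R) (t1 t2 : 'I_N) :
  (forall (T1 T2 : {set 'I_N}) (G : S * S -> R),
    (#|T1| + #|T2| <= p)%N -> separated T1 T2 ->
    measurable_fun [set: S * S] G -> (forall z, `|G z| <= 1) ->
    depends_on (mem T1) (mem T2) G ->
    `|\int[P]_w G (V w, V w) - \int[P]_w \int[P]_w' G (V w, V w')| <= p%:R * (2 * c)) ->
  (#|T1| + #|T2| <= p.+1)%N -> separated T1 T2 ->
  measurable_fun [set: S * S] G -> (forall z, `|G z| <= 1) ->
  depends_on (mem T1) (mem T2) G ->
  t1 \in T1 -> (forall i, i \in T1 -> i <= t1)%N -> t2 \in T2 -> (t1 < t2)%N ->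
  `|\int[P]_w G (V w, V w) - \int[P]_w \int[P]_w' G (V w, V w')| <= p.+1%:R * (2 * c).
Proof.
move=> IH sz sep mG G1 dep t1T t1max t2T t12.
pose a : nat := t1.
have T2a j : j \in T2 -> (a < j)%N -> (a + m <= j)%N.
  by move=> jT aj; have [//|] := sep _ _ t1T jT; rewrite /a in aj *; lia.
have mGc d' (T' : measurableType d') (x y : T' -> S) : measurable_fun [set: T'] x ->
    measurable_fun [set: T'] y -> measurable_fun [set: T'] (fun t => G (x t, y t)).
  by move=> mx my; apply: measurableT_comp mG _; exact: measurable_fun_pair.
pose A0 := \int[P]_w G (V w, V w).
pose A1 := \int[P]_w \int[P]_v G (V w, splice a (V w) (V v)).
pose A2 := \int[P]_v \int[P]_w \int[P]_w' G (V w, splice a (V w') (V v)).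
pose A3 := \int[P]_w \int[P]_w' G (V w, V w').
have spliceE y : splice a y y = y.
  by apply: eq_from_tnth => i; rewrite tnth_mktuple; case: ifP.
have h01 : `|A0 - A1| <= c.
  have -> : A0 = \int[P]_w G (V w, splice a (V w) (V w)).
    by apply: eq_Rintegral => w _; rewrite spliceE.
  apply: (@cut a (fun z => G (z.1, splice a z.1 z.2))) => //.
  - by apply: mGc; [exact: measurable_fst|apply: measurable_splice; [exact: measurable_fst|exact: measurable_snd]].
  - move=> x x' y y' xx yy /=; apply: dep.
      by move=> i iT; apply: xx; exact: t1max.
    move=> i iT; rewrite !tnth_mktuple; case: leqP => ia; first exact: xx.
    by apply: yy; exact: T2a.
have h12 : `|A1 - A2| <= p%:R * (2 * c).
  have -> : A1 = \int[P]_v \int[P]_w G (V w, splice a (V w) (V v)).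
    apply: (Rfubini P P (f := fun z => G (V z.1, splice a (V z.1) (V z.2))) (M := 1)) => //.
    apply: mGc; first exact: measurableT_comp mV measurable_fst.
    by apply: measurable_splice; [exact: measurableT_comp mV measurable_fst|exact: measurableT_comp mV measurable_snd].
  have m1 : measurable_fun [set: T * T] (fun z => G (V z.2, splice a (V z.2) (V z.1))).
    apply: mGc; first exact: measurableT_comp mV measurable_snd.
    by apply: measurable_splice; [exact: measurableT_comp mV measurable_snd|exact: measurableT_comp mV measurable_fst].
  have m3 : measurable_fun [set: (T * T) * T] (fun z => G (V z.1.2, splice a (V z.2) (V z.1.1))).
    apply: mGc; first exact: measurableT_comp mV (measurableT_comp measurable_snd measurable_fst).
    by apply: measurable_splice; [exact: measurableT_comp mV measurable_snd|exact: measurableT_comp mV (measurableT_comp measurable_fst measurable_fst)].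
  have m2 := measurable_Rintegral2 P m3 (fun z => G1 _).
  apply: (@Rintegral_sub_bounded _ _ _ _ _ _ 1).
  - exact: (measurable_Rintegral2 P m1 (fun z => G1 _)).
  - apply: (measurable_Rintegral2 P (f := fun z => \int[P]_w' G (V z.2, splice a (V w') (V z.1))) (M := 1)) => // z.
    apply: Rintegral_bounded => //; exact: measurableT_comp m3 (pair1_measurable z).
  - move=> v; apply: Rintegral_bounded => //; exact: measurableT_comp m1 (pair1_measurable v).
  - move=> v; apply: Rintegral_bounded.
      exact: measurableT_comp m2 (pair1_measurable v).
    move=> w; apply: Rintegral_bounded => //; exact: measurableT_comp m3 (pair1_measurable (v, w)).
  - move=> v.
    apply: (IH T1 [set j in T2 | (j <= a)%N] (fun z => G (z.1, splice a z.2 (V v)))) => //.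
    + have : (#|[set j in T2 | (j <= a)%N]| < #|T2|)%N.
        apply: proper_card; apply/properP; split.
          by apply/fintype.subsetP => j; rewrite inE => /andP[].
        by exists t2 => //; rewrite inE t2T /= -ltnNge.
      by move: sz; lia.
    + by move=> i j iT; rewrite inE => /andP[jT _]; exact: sep.
    + by apply: mGc; [exact: measurable_fst|apply: measurable_splice; [exact: measurable_snd|exact: measurable_cst]].
    + move=> x x' y y' xx yy /=; apply: dep => // i iT; rewrite !tnth_mktuple.
      case: leqP => // ia; apply: yy.
      have iT2 : i \in T2 by [].
      by have : i \in [set j in T2 | (j <= a)%N] by rewrite inE iT2.
have h23 : `|A2 - A3| <= c.
  have m3 : measurable_fun [set: (T * T) * T] (fun z => G (V z.1.2, splice a (V z.2) (V z.1.1))).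
    apply: mGc; first exact: measurableT_comp mV (measurableT_comp measurable_snd measurable_fst).
    by apply: measurable_splice; [exact: measurableT_comp mV measurable_snd|exact: measurableT_comp mV (measurableT_comp measurable_fst measurable_fst)].
  have m3' : measurable_fun [set: (T * T) * T] (fun z => G (V z.1.1, splice a (V z.1.2) (V z.2))).
    apply: mGc; first exact: measurableT_comp mV (measurableT_comp measurable_fst measurable_fst).
    by apply: measurable_splice; [exact: measurableT_comp mV (measurableT_comp measurable_snd measurable_fst)|exact: measurableT_comp mV measurable_snd].
  have m2' := measurable_Rintegral2 P m3' (fun z => G1 _).
  have m1 w : measurable_fun [set: T * T] (fun z => G (V w, splice a (V z.1) (V z.2))).
    apply: mGc; first exact: measurable_cst.
    by apply: measurable_splice; [exact: measurableT_comp mV measurable_fst|exact: measurableT_comp mV measurable_snd].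
  have -> : A2 = \int[P]_w \int[P]_w' \int[P]_v G (V w, splice a (V w') (V v)).
    rewrite /A2 (Rfubini P P (f := fun z => \int[P]_w' G (V z.2, splice a (V w') (V z.1))) (M := 1)).
    - apply: eq_Rintegral => w _; apply/esym.
      by apply: (Rfubini P P (f := fun z => G (V w, splice a (V z.1) (V z.2))) (M := 1)).
    - exact: (measurable_Rintegral2 P m3 (fun z => G1 _)).
    - move=> z; apply: Rintegral_bounded => //; exact: measurableT_comp m3 (pair1_measurable z).
  have mVV : measurable_fun [set: T * T] (fun z => G (V z.1, V z.2)).
    by apply: mGc; [exact: measurableT_comp mV measurable_fst|exact: measurableT_comp mV measurable_snd].
  apply: (@Rintegral_sub_bounded _ _ _ _ _ _ 1).
  - apply: (measurable_Rintegral2 P (f := fun z => \int[P]_v G (V z.1, splice a (V z.2) (V v))) (M := 1)) => // z.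
    apply: Rintegral_bounded => //; exact: measurableT_comp m3' (pair1_measurable z).
  - exact: (measurable_Rintegral2 P mVV (fun z => G1 _)).
  - move=> w; apply: Rintegral_bounded.
      exact: measurableT_comp m2' (pair1_measurable w).
    move=> w'; apply: Rintegral_bounded => //; exact: measurableT_comp m3' (pair1_measurable (w, w')).
  - move=> w; apply: Rintegral_bounded => //; exact: measurableT_comp mVV (pair1_measurable w).
  (* For fixed [w] the cut at [a] is used backwards: it replaces two independent copies in the
     second argument by a single one. *)
  - move=> w; rewrite distrC.
    have -> : \int[P]_w' G (V w, V w') = \int[P]_w' G (V w, splice a (V w') (V w')).
      by apply: eq_Rintegral => w' _; rewrite spliceE.
    apply: (@cut a (fun z => G (V w, splice a z.1 z.2))) => //.
    + by apply: mGc; [exact: measurable_cst|apply: measurable_splice; [exact: measurable_fst|exact: measurable_snd]].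
    + move=> x x' y y' xx yy /=; apply: dep => // i iT; rewrite !tnth_mktuple.
      by case: leqP => ia; [exact: xx|apply: yy; exact: T2a].
rewrite (_ : p.+1%:R * (2 * c) = c + p%:R * (2 * c) + c); last by rewrite -natr1; ring.
rewrite (_ : _ - _ = (A0 - A1) + (A1 - A2) + (A2 - A3)); last by rewrite /A0 /A3; ring.
by rewrite (le_trans (ler_normD _ _))// lerD// (le_trans (ler_normD _ _))// lerD.
Qed.

(** Induction on the number of times involved. The group containing the latest time loses its part
    beyond the other group, Fubini's theorem exchanging the roles if needed; as [m] is positive, the
    two last times differ. When a group is empty, [G] ignores the corresponding argument and the two
    integrals agree. *)
Lemma decorrelate p (T1 T2 : {set 'I_N}) (G : S * S -> R) :
  (#|T1| + #|T2| <= p)%N -> separated T1 T2 ->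
  measurable_fun [set: S * S] G -> (forall z, `|G z| <= 1) ->
  depends_on (mem T1) (mem T2) G ->
  `|\int[P]_w G (V w, V w) - \int[P]_w \int[P]_w' G (V w, V w')| <= p%:R * (2 * c).
Proof.
elim: p T1 T2 G => [|p IH] T1 T2 G sz sep mG G1 dep; last first.
  have [T10|[i1 i1T]] := set_0Vmem T1; last have [T20|[i2 i2T]] := set_0Vmem T2.
  - rewrite (_ : \int[P]_w \int[P]_w' _ = \int[P]_w G (V w, V w)).
      by rewrite subrr normr0 mulr_ge0// mulr_ge0.
    rewrite -[RHS]Rintegral_const; apply: eq_Rintegral => w _.
    apply: eq_Rintegral => w' _; apply: dep => // i iT.
    by have : i \in T1 := iT; rewrite T10 inE.
  - rewrite (_ : \int[P]_w \int[P]_w' _ = \int[P]_w G (V w, V w)).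
      by rewrite subrr normr0 mulr_ge0// mulr_ge0.
    apply: eq_Rintegral => w _; rewrite -[RHS]Rintegral_const.
    apply: eq_Rintegral => w' _; apply: dep => // i iT.
    by have : i \in T2 := iT; rewrite T20 inE.
  - have [t1 t1T t1max] := @arg_maxnP _ i1 (mem T1) (@nat_of_ord N) i1T.
    have [t2 t2T t2max] := @arg_maxnP _ i2 (mem T2) (@nat_of_ord N) i2T.
    have [t12|t21] : (t1 < t2)%N \/ (t2 < t1)%N.
      by have := sep _ _ t1T t2T; lia.
    + exact: (decorrelate_step IH sz sep mG G1 dep t1T t1max t2T t12).
    + have mG' : measurable_fun [set: S * S] (fun z => G (z.2, z.1)).
        by apply: measurableT_comp mG _; apply: measurable_fun_pair; [exact: measurable_snd|exact: measurable_fst].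
      rewrite (Rfubini P P (f := fun z => G (V z.1, V z.2)) (M := 1))//; last first.
        apply: measurableT_comp mG _; apply: measurable_fun_pair.
          exact: measurableT_comp mV measurable_fst.
        exact: measurableT_comp mV measurable_snd.
      apply: (@decorrelate_step p T2 T1 (fun z => G (z.2, z.1)) t2 t1) => //.
      * by rewrite addnC.
      * by move=> i j iT jT; have := sep _ _ jT iT; tauto.
      * by move=> x x' y y' xx yy /=; apply: dep.
have /eqP/cards0_eq T10 : (#|T1| == 0)%N by move: sz; lia.
rewrite mul0r (_ : \int[P]_w \int[P]_w' _ = \int[P]_w G (V w, V w)) ?subrr ?normr0//.
rewrite -[RHS]Rintegral_const; apply: eq_Rintegral => w _.
apply: eq_Rintegral => w' _; apply: dep => // i iT.
by have : i \in T1 := iT; rewrite T10 inE.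
Qed.

End decorrelation.

Lemma same_law_Rintegral {R : realType} {d d' e : measure_display}
    {T : measurableType d} {T' : measurableType d'} {S : measurableType e}
    (P : probability T R) (V : T -> S) (P' : probability T' R) (V' : T' -> S)
    (f : S -> R) (M : R) :
  measurable_fun [set: T] V -> measurable_fun [set: T'] V' ->
  same_law P V P' V' -> measurable_fun [set: S] f -> (forall x, `|f x| <= M) ->
  \int[P]_w f (V w) = \int[P']_w f (V' w).
Proof.
move=> mV mV' VV' mf fM.
pose VM : {mfun T >-> S} := HB.pack V (isMeasurableFun.Build _ _ _ _ V mV).
pose VM' : {mfun T' >-> S} := HB.pack V' (isMeasurableFun.Build _ _ _ _ V' mV').
have mEf : measurable_fun [set: S] (EFin \o f) by exact/measurable_EFinP.
have i1 : P.-integrable [set: T] ((EFin \o f) \o VM).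
  by apply: (@bounded_integrable _ _ _ _ _ M) => //; exact: measurableT_comp.
have i2 : P'.-integrable [set: T'] ((EFin \o f) \o VM').
  by apply: (@bounded_integrable _ _ _ _ _ M) => //; exact: measurableT_comp.
rewrite /Rintegral; congr fine.
have e1 := integral_distribution mEf i1.
have e2 := integral_distribution mEf i2.
transitivity (\int[distribution P VM]_y (EFin \o f) y)%E; first by rewrite e1.
transitivity (\int[distribution P' VM']_y (EFin \o f) y)%E; last by rewrite e2.
apply: eq_measure_integral => A mA _; exact: VV'.
Qed.

(** * Absolute regularity of the two-sided sequence *)

Section beta_mixing.
Context {R : realType} {d : measure_display} {T : measurableType d}.
Variables (P : probability T R) (Y : int -> {RV P >-> R}).

Let past := sigma_gen Y [set s : int | s <= 0].
Let future (m : nat) := sigma_gen Y [set s : int | m%:Z <= s].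

Let past_sigma : sigma_algebra [set: T] past.
Proof. exact: smallest_sigma_algebra. Qed.

Let future_sigma m : sigma_algebra [set: T] (future m).
Proof. exact: smallest_sigma_algebra. Qed.

Let past_measurable : past `<=` measurable.
Proof. exact: sigma_gen_measurable. Qed.

Let future_measurable m : future m `<=` measurable.
Proof. exact: sigma_gen_measurable. Qed.

(** The essential supremum lies between 0 and 1 only almost surely, whereas the decoupling asks for
    nonnegativity at every point. Clipping to the unit interval changes it on a null set and keeps
    its mean. *)
Lemma beta_coef_majorant m : exists g : T -> R, [/\ forall w, 0 <= g w,
  P.-integrable [set: T] (EFin \o g),
  forall B, future m B ->
    {ae P, forall w, `|cond_prob P past B w - fine (P B)| <= g w} &
  fine (\int[P]_w (g w)%:E)%E = beta_coef Y m].
Proof.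
set Phi := cond_prob_deviations P past (future m).
have [mE ub least] := ess_sup_cond_prob_deviationsP Y m.
rewrite -/past -/(future m) -/Phi in mE ub least.
set E := ess_sup_family P Phi in mE ub least.
have dev B : future m B ->
    Phi (fun w => `|cond_prob P past B w - fine (P B)|) by exists B.
have E0 : {ae P, forall w, 0 <= E w}.
  have [F0 _ _] := future_sigma m.
  by have := ub _ (dev _ F0); apply: filterS => w; apply: le_trans.
have E1 : {ae P, forall w, E w <= 1}.
  apply: least => // f [B /future_measurable mB <-].
  apply: (cond_prob_deviation_le1 past_measurable mB).
  exact: is_cond_probP.
pose g w := Num.min (Num.max (E w) 0) 1.
have mg : measurable_fun [set: T] g.
  by apply: measurable_minr => //; exact: measurable_maxr.
have gE : {ae P, forall w, g w = E w}.
  by move: E0 E1; apply: filterS2 => w e0 e1; rewrite /g (max_idPl e0) (min_idPl e1).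
have g0 w : 0 <= g w by rewrite /g le_min ler01 andbT le_max lexx orbT.
have g1 w : g w <= 1 by rewrite /g ge_min lexx orbT.
exists g; split => //.
- by apply: (@bounded_integrable _ _ _ _ _ 1) => // w; rewrite ger0_norm.
- move=> B /dev /ub; move: gE; apply: filterS2 => w -> //.
- rewrite /beta_coef unlock; congr fine.
  apply: ae_eq_integral => //; first exact/measurable_EFinP.
    exact/measurable_EFinP.
  by move: gE; apply: filterS => w /= -> _.
Qed.

Lemma beta_coef_ge0 m : 0 <= beta_coef Y m.
Proof.
have [g [g0 _ _ <-]] := beta_coef_majorant m.
by rewrite fine_ge0// integral_ge0// => w _; rewrite lee_fin.
Qed.

Definition window N (tau : int) (w : T) : N.-tuple R :=
  [tuple Y (i%:Z + tau) w | i < N].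

Lemma measurable_window N tau : measurable_fun [set: T] (@window N tau).
Proof.
apply/measurable_fun_tnthP => i.
rewrite (_ : _ \o _ = Y (i%:Z + tau)); first exact: measurable_funP.
by apply/funext => w /=; rewrite tnth_mktuple.
Qed.

Hypothesis Y_stationary : strictly_stationaryZ Y.

Lemma window_same_law N tau : (0 < N)%N ->
  same_law P (@window N tau) P (@window N 0).
Proof.
move=> N0; have := Y_stationary [tuple i%:Z | i < N] tau N0.
set a := sample _ _; set b := sample _ _.
have -> : a = @window N tau.
  apply/funext => w; apply: eq_from_tnth => i.
  by rewrite !tnth_mktuple tnth_map tnth_mktuple.
suff -> : b = @window N 0 by [].
apply/funext => w; apply: eq_from_tnth => i.
by rewrite !tnth_mktuple addr0.
Qed.

(** By stationarity the window is shifted by [- a], which moves the two blocks into the past up to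
    time 0 and the future from time [m], where the coefficient is defined. *)
Lemma beta_cut N m a (h : N.-tuple R * N.-tuple R -> R) : (0 < N)%N ->
  measurable_fun setT h -> (forall z, `|h z| <= 1) ->
  depends_on (fun i : 'I_N => i <= a)%N (fun i => a + m <= i)%N h ->
  `|\int[P]_w h (@window N 0 w, @window N 0 w) -
    \int[P]_w \int[P]_w' h (@window N 0 w, @window N 0 w')| <= 2 * beta_coef Y m.
Proof.
move=> N0 mh h1 dep.
have [g [g0 gi gH <-]] := beta_coef_majorant m.
pose tau : int := - a%:Z.
(* Coordinates outside the block are set to 0, so that the whole tuple is measurable with respect to
   the past, or the future for [V2]; by [dep] the value of [h] is not affected. *)
pose V1 w : N.-tuple R := [tuple if (i <= a)%N then Y (i%:Z + tau) w else 0 | i < N].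
pose V2 w : N.-tuple R := [tuple if (a + m <= i)%N then Y (i%:Z + tau) w else 0 | i < N].
have sub_measurable (D : set int) (b : pred 'I_N) (V : T -> N.-tuple R) :
    (forall i w, tnth (V w) i = if b i then Y (i%:Z + tau) w else 0) ->
    (forall i, b i -> D (i%:Z + tau)) ->
    forall B, measurable B -> sigma_gen Y D (V @^-1` B).
  move=> VE bD B mB.
  pose sys := \bigcup_(s in D) preimage_set_system [set: T] (Y s) (@measurable _ R).
  pose V' : g_sigma_algebraType sys -> N.-tuple R := V.
  have mV' : measurable_fun [set: g_sigma_algebraType sys] V'.
    apply/measurable_fun_tnthP => i.
    rewrite (_ : _ \o _ = (fun w => if b i then Y (i%:Z + tau) w else 0)); last first.
      by apply/funext => w; exact: VE.
    case bi: (b i); last exact: measurable_cst.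
    move=> _ C mC; rewrite setTI; apply: sub_sigma_algebra.
    exists (i%:Z + tau); first exact: bD.
    by exists C => //; rewrite setTI.
  by have := mV' measurableT B mB; rewrite setTI.
have V1G : forall B, measurable B -> past (V1 @^-1` B).
  apply: (sub_measurable _ (fun i : 'I_N => (i <= a)%N)).
    by move=> i w; rewrite tnth_mktuple.
  by move=> i ia /=; rewrite /tau subr_le0 lez_nat.
have V2H : forall B, measurable B -> future m (V2 @^-1` B).
  apply: (sub_measurable _ (fun i : 'I_N => (a + m <= i)%N)).
    by move=> i w; rewrite tnth_mktuple.
  by move=> i ia /=; rewrite /tau lerBrDr -PoszD lez_nat addnC.
have mw := @measurable_window N.
have hV w w' : h (@window N tau w, @window N tau w') = h (V1 w, V2 w').
  by apply: dep => i ia; rewrite !tnth_mktuple ia.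
have mhl x : measurable_fun setT (fun y => h (x, y)).
  exact: measurableT_comp mh (pair1_measurable x).
have mhr y : measurable_fun setT (fun x => h (x, y)).
  exact: measurableT_comp mh (pair2_measurable y).
have -> : \int[P]_w h (@window N 0 w, @window N 0 w) = \int[P]_w h (V1 w, V2 w).
  rewrite -(same_law_Rintegral (mw tau) (mw 0) (window_same_law tau N0)
    (f := fun x => h (x, x)) (M := 1))//.
    by apply: eq_Rintegral => w _; rewrite hV.
  by apply: measurableT_comp mh _; apply: measurable_fun_pair.
have -> : \int[P]_w \int[P]_w' h (@window N 0 w, @window N 0 w') =
    \int[P]_w \int[P]_w' h (V1 w, V2 w').
  (* Under the product law the two copies are shifted separately: first the inner one, then the
     outer one after Fubini's theorem has brought it inside. *)
  transitivity (\int[P]_w \int[P]_w' h (@window N 0 w, @window N tau w')).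
    apply: eq_Rintegral => w _.
    by rewrite -(same_law_Rintegral (mw tau) (mw 0) (window_same_law tau N0)
      (f := fun y => h (@window N 0 w, y)) (M := 1)).
  transitivity (\int[P]_w' \int[P]_w h (@window N 0 w, @window N tau w')).
    apply: (Rfubini P P (f := fun z => h (@window N 0 z.1, @window N tau z.2)) (M := 1)) => //.
    apply: measurableT_comp mh _; apply: measurable_fun_pair.
      exact: measurableT_comp (mw 0) measurable_fst.
    exact: measurableT_comp (mw tau) measurable_snd.
  transitivity (\int[P]_w' \int[P]_w h (@window N tau w, @window N tau w')).
    apply: eq_Rintegral => w' _.
    by rewrite -(same_law_Rintegral (mw tau) (mw 0) (window_same_law tau N0)
      (f := fun x => h (x, @window N tau w')) (M := 1)).
  rewrite -(Rfubini P P (f := fun z => h (@window N tau z.1, @window N tau z.2)) (M := 1))//.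
    by apply: eq_Rintegral => w _; apply: eq_Rintegral => w' _; rewrite hV.
  apply: measurableT_comp mh _; apply: measurable_fun_pair.
    exact: measurableT_comp (mw tau) measurable_fst.
  exact: measurableT_comp (mw tau) measurable_snd.
exact: (decouple_fun past_sigma past_measurable (future_measurable (m := m)) g0 gi gH V1G V2H mh h1).
Qed.

Lemma beta_decorrelate N m p (T1 T2 : {set 'I_N})
    (G : N.-tuple R * N.-tuple R -> R) : (0 < N)%N -> (0 < m)%N ->
  (#|T1| + #|T2| <= p)%N ->
  (forall i j, i \in T1 -> j \in T2 -> (i + m <= j)%N \/ (j + m <= i)%N) ->
  measurable_fun setT G -> (forall z, `|G z| <= 1) ->
  depends_on (mem T1) (mem T2) G ->
  `|\int[P]_w G (@window N 0 w, @window N 0 w) -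
    \int[P]_w \int[P]_w' G (@window N 0 w, @window N 0 w')| <=
  p%:R * (4 * beta_coef Y m).
Proof.
move=> N0 m0; rewrite (_ : 4 * _ = 2 * (2 * beta_coef Y m)); last by ring.
apply: decorrelate => //.
- exact: measurable_window.
- by rewrite mulr_ge0// beta_coef_ge0.
- by move=> a h; exact: beta_cut.
Qed.

End beta_mixing.

(** * Neighbouring index tuples *)

Section neighbours.
Variables (r N m : nat).
Local Notation J := (r.-tuple 'I_N).

Definition near (j j' : J) : bool := [exists s, exists t,
  (tnth j s < tnth j' t + m)%N && (tnth j' t < tnth j s + m)%N].

Lemma near_refl : (0 < r)%N -> (0 < m)%N -> reflexive near.
Proof.
move=> r0 m0 j; apply/existsP; exists (Ordinal r0); apply/existsP; exists (Ordinal r0).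
by rewrite -[X in (X < _)%N]addn0 ltn_add2l m0.
Qed.

Lemma card_near_ord (i : 'I_N) :
  (#|[pred i' : 'I_N | (i' < i + m)%N && (i < i' + m)%N]| <= 2 * m)%N.
Proof.
rewrite -(size_iota (i.+1 - m) (2 * m)) cardE -(size_map val).
apply: uniq_leq_size; first by rewrite map_inj_uniq ?enum_uniq//; exact: val_inj.
move=> x /mapP[i']; rewrite mem_enum inE => /andP[h1 h2] ->.
by rewrite mem_iota /=; lia.
Qed.

Lemma card_tuple_coord (X : finType) k (c : 'I_k.+1) (Q : pred X) :
  (#|[pred j : k.+1.-tuple X | Q (tnth j c)]| <= #|Q| * #|X| ^ k)%N.
Proof.
rewrite -(card_tuple k X) -cardX.
pose g (j : k.+1.-tuple X) := (tnth j c, [tuple tnth j (lift c i) | i < k]).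
have gI : injective g.
  move=> j1 j2 gE; apply: eq_from_tnth => i.
  case: (unliftP c i) => [i' ->|->]; last exact: (congr1 fst gE).
  by have := congr1 (fun p => tnth p.2 i') gE; rewrite !tnth_mktuple.
rewrite -(card_imset _ gI); apply: subset_leq_card.
by apply/fintype.subsetP => p /imsetP[j jQ ->]; rewrite !inE /= andbT.
Qed.

(** There are [r * r] choices of the two close coordinates and at most [2 * m] values for the one in
    [j']; the other [r - 1] coordinates are free. *)
Lemma card_near (j : J) :
  (#|[pred j' | near j' j]| <= r * r * (2 * m * N ^ r.-1))%N.
Proof.
have sub : (#|[pred j' | near j' j]| <= \sum_(s < r) \sum_(t < r)
    #|[pred j' : J | (tnth j' s < tnth j t + m)%N && (tnth j t < tnth j' s + m)%N]|)%N.
  rewrite -sum1_card big_mkcond /=.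
  apply: (@leq_trans (\sum_(j' : J) \sum_(s < r) \sum_(t < r)
     ((tnth j' s < tnth j t + m) && (tnth j t < tnth j' s + m)))%N).
    apply: leq_sum => j' _; rewrite inE; case: ifP => // /existsP[s /existsP[t h]].
    by rewrite (bigD1 s)//= (bigD1 t)//= h.
  rewrite exchange_big /=; apply: leq_sum => s _.
  rewrite exchange_big /=; apply: leq_sum => t _.
  rewrite -sum1_card [leqRHS]big_mkcond /=; apply: leq_sum => j' _.
  by rewrite inE; case: (_ && _).
apply: leq_trans sub _.
apply: (@leq_trans (\sum_(s < r) \sum_(t < r) 2 * m * N ^ r.-1)%N); last first.
  by rewrite !sum_nat_const !card_ord mulnA.
apply: leq_sum => s _; apply: leq_sum => t _.
case: r j s t => [|r'] j s; first by case: s.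
move=> t; apply: leq_trans (card_tuple_coord s
  [pred i' : 'I_N | (i' < tnth j t + m)%N && (tnth j t < i' + m)%N]) _.
by rewrite card_ord leq_mul2r card_near_ord orbT.
Qed.

End neighbours.

Lemma norm_prod_le1 {R : realFieldType} (I : Type) (s : seq I) (a : I -> R) :
  (forall i, `|a i| <= 1) -> `|\prod_(i <- s) a i| <= 1.
Proof.
move=> a1; elim: s => [|i s IH]; first by rewrite big_nil normr1.
by rewrite big_cons normrM mulr_ile1.
Qed.

(** * Joint moments and cumulants of the kernels *)

Section joint_moments.
Context {R : realType} {d : measure_display} {T : measurableType d}.
Variables (P : probability T R) (Y : int -> {RV P >-> R}).
Hypothesis Y_stationary : strictly_stationaryZ Y.
Variables (r N m : nat) (a : r.-tuple 'I_N -> N.-tuple R -> R).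
Hypotheses (r_gt0 : (0 < r)%N) (N_gt0 : (0 < N)%N) (m_gt0 : (0 < m)%N).
Hypothesis ma : forall j, measurable_fun setT (a j).
Hypothesis a1 : forall j x, `|a j x| <= 1.
Hypothesis a_dep : forall (j : r.-tuple 'I_N) (x y : N.-tuple R),
  (forall i : 'I_N, i \in tval j -> tnth x i = tnth y i) -> a j x = a j y.

Local Notation J := (r.-tuple 'I_N).
Let V := window Y N 0.
Let mV : measurable_fun [set: T] V.
Proof. exact: measurable_window. Qed.

Definition joint_moment (u : seq J) : R := \int[P]_w \prod_(j <- u) a j (V w).

Let measurable_prod_a (u : seq J) d' (T' : measurableType d') (x : T' -> N.-tuple R) :
  measurable_fun [set: T'] x ->
  measurable_fun [set: T'] (fun t => \prod_(j <- u) a j (x t)).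
Proof.
move=> mx; elim: u => [|j u IH].
  by under eq_fun do rewrite big_nil; exact: measurable_cst.
under eq_fun do rewrite big_cons.
by apply: measurable_funM => //; exact: measurableT_comp.
Qed.

Let Pcst (k : R) : \int[P]_w k = k.
Proof.
by rewrite Rintegral_cst// (_ : fine _ = 1) ?mulr1//= (probability_setT P).
Qed.

Lemma joint_moment_nil : joint_moment [::] = 1.
Proof. by rewrite -[RHS]Pcst; apply: eq_Rintegral => w _; rewrite big_nil. Qed.

Lemma joint_moment_le1 u : `|joint_moment u| <= 1.
Proof.
apply: Rintegral_bounded => [|w]; first exact: measurable_prod_a.
exact: norm_prod_le1.
Qed.

Lemma sum_joint_moment k :
  sum_lists k joint_moment = \int[P]_w (\sum_j a j (V w)) ^+ k.
Proof.
have cards (M : R) (A : seq J -> T -> R) :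
    (forall u, measurable_fun [set: T] (A u)) -> (forall u w, `|A u w| <= M) ->
    P.-integrable [set: T] (EFin \o (fun w => sum_lists k (fun u => A u w))) /\
    sum_lists k (fun u => \int[P]_w A u w) = \int[P]_w sum_lists k (fun u => A u w).
  elim: k A => [|k IH] A mA AM /=; first by split => //; exact: bounded_integrable (AM _).
  have H j := IH (fun u => A (j :: u)) (fun u => mA _) (fun u => AM _).
  have [i2 e2] := @Rintegral_sum _ _ _ P _ (index_enum J)
    (fun j w => sum_lists k (fun u => A (j :: u) w)) (fun j _ => (H j).1).
  split; first exact: i2.
  rewrite [RHS]e2; apply: eq_bigr => j _; exact: (H j).2.
have [_ E] := cards 1 (fun u w => \prod_(j <- u) a j (V w))
  (fun u => measurable_prod_a u mV) (fun u w => norm_prod_le1 u (fun j => a1 j (V w))).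
rewrite [LHS]E; apply: eq_Rintegral => w _.
elim: {E cards} k => [|k IH] /=; first by rewrite big_nil.
rewrite exprS mulr_suml; apply: eq_bigr => j _; rewrite -IH -sum_listsZ.
by apply: eq_sum_lists => s _ /=; rewrite big_cons.
Qed.

(** Tuples that are not near use times at distance at least [m]. Together the two groups involve at
    most [r * size u] times, which is the count entering [beta_decorrelate], and the decoupled
    integral factors. *)
Lemma joint_moment_split (q : pred J) (u : seq J) :
  {in u &, forall i j, q i -> ~~ q j -> ~~ near m j i} ->
  `|joint_moment u - joint_moment (seq.filter q u) * joint_moment (seq.filter (predC q) u)|
    <= (r * size u)%:R * (4 * beta_coef Y m).
Proof.
move=> qN.
pose G (z : N.-tuple R * N.-tuple R) :=
  (\prod_(j <- seq.filter q u) a j z.1) * (\prod_(j <- seq.filter (predC q) u) a j z.2).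
pose coords (v : seq J) : {set 'I_N} := [set i in flatten (map val v)].
have card_coords v : (#|coords v| <= r * size v)%N.
  rewrite cardsE (leq_trans (card_size _))//.
  elim: v => [|j v IH] /=; first by rewrite muln0.
  by rewrite size_cat size_tuple mulnS leq_add2l.
have in_coords v i : i \in coords v -> exists2 j : J, j \in v & i \in tval j.
  by rewrite inE => /flattenP[s /mapP[j jv ->] is_]; exists j.
have coords_in v (j : J) i : j \in v -> i \in tval j -> i \in coords v.
  move=> jv ij; rewrite inE; apply/flattenP; exists (val j) => //.
  by apply/mapP; exists j.
have mG : measurable_fun setT G.
  by apply: measurable_funM; apply: measurable_prod_a; [exact: measurable_fst|exact: measurable_snd].
have G1 z : `|G z| <= 1.
  by rewrite normrM mulr_ile1// norm_prod_le1// => j; exact: a1.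
have prod_dep v x y : (forall i, i \in coords v -> tnth x i = tnth y i) ->
    \prod_(j <- v) a j x = \prod_(j <- v) a j y.
  move=> xy; rewrite big_seq [RHS]big_seq; apply: eq_bigr => j jv.
  by apply: a_dep => i ij; apply: xy; exact: coords_in ij.
have dep : depends_on (mem (coords (seq.filter q u))) (mem (coords (seq.filter (predC q) u))) G.
  move=> x x' y y' xx yy; rewrite /G /=; congr (_ * _); exact: prod_dep.
have sep i j : i \in coords (seq.filter q u) -> j \in coords (seq.filter (predC q) u) ->
    (i + m <= j)%N \/ (j + m <= i)%N.
  move=> /in_coords[j1 + i1] /in_coords[j2 + i2].
  rewrite !mem_filter => /andP[q1 u1] /andP[q2 u2].
  have := qN _ _ u1 u2 q1 q2; have /tnthP[s1 ->] := i1; have /tnthP[s2 ->] := i2.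
  move=> /existsPn/(_ s2)/existsPn/(_ s1).
  by rewrite negb_and -!leqNgt => /orP[]; [left|right].
have sz : (#|coords (seq.filter q u)| + #|coords (seq.filter (predC q) u)| <= r * size u)%N.
  rewrite (leq_trans (leq_add (card_coords _) (card_coords _)))//.
  by rewrite -mulnDr !size_filter count_predC.
have := beta_decorrelate Y_stationary N_gt0 m_gt0 sz sep mG G1 dep.
rewrite -/V.
have -> : \int[P]_w G (V w, V w) = joint_moment u.
  apply: eq_Rintegral => w _; rewrite /G /= -big_cat /=.
  by apply: perm_big; rewrite perm_catC perm_sym -(perm_filterC q) perm_catC.
suff -> : \int[P]_w \int[P]_w' G (V w, V w') =
   joint_moment (seq.filter q u) * joint_moment (seq.filter (predC q) u) by [].
have int1 v : P.-integrable setT (EFin \o (fun w => \prod_(j <- v) a j (V w))).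
  apply: (@bounded_integrable _ _ _ _ _ 1); first exact: measurable_prod_a.
  by move=> w; exact: norm_prod_le1.
rewrite /joint_moment -RintegralZr//; apply: eq_Rintegral => w _.
by rewrite -RintegralZl.
Qed.

Lemma scaled_cumulant_le k :
  `|\sum_x sum_lists k (cumulant joint_moment x)| <=
  cumulant_cst k * k`!%:R * (1 + k)%:R ^+ k *
    ((N ^ r)%:R * (r * r * (2 * m * N ^ r.-1))%:R ^+ k) +
  cumulant_split_cst k * (N ^ r)%:R ^+ k.+1 *
    ((r * k.+1)%:R * (4 * beta_coef Y m)).
Proof.
rewrite -[(N ^ r)%N](_ : #|{: J}| = _); last by rewrite card_tuple card_ord.
have b0 := beta_coef_ge0 Y m.
apply: (@sum_cumulant_le R J (near m)).
- exact: joint_moment_nil.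
- exact: joint_moment_le1.
- by rewrite mulr_ge0// mulr_ge0.
- exact: ler0n.
- exact: near_refl.
- by move=> t; rewrite ler_nat card_near.
- move=> q u su qN; rewrite (le_trans (joint_moment_split qN))//.
  by rewrite ler_wpM2r ?mulr_ge0// ler_nat leq_mul2l su orbT.
Qed.

End joint_moments.

(** * Entire series *)

Section entire_series.
Context {R : realType}.
Implicit Types (f g c : nat -> R) (t : R).

(* A Cauchy estimate at every radius: it says that [f] is the coefficient sequence
   of an entire function and is stable under products and derivatives. *)
Definition entire_coef f := forall rho : R, 0 < rho ->
  exists2 C : R, 0 <= C & forall k, `|f k| <= C * rho ^+ k.

Definition psum f t : R := limn (pseries f t).

Lemma entire_cvg f t : entire_coef f -> cvgn (pseries f t).
Proof.
move=> ef; have t1 : 0 < `|t| + 1 by rewrite ltr_wpDl.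
(* This radius turns the Cauchy estimate into a geometric series of ratio [1 / 2]. *)
have [|C C0 fC] := ef (2 * (`|t| + 1))^-1; first by rewrite invr_gt0 mulr_gt0.
apply: normed_cvg; apply: (series_le_cvg (v_ := geometric C 2^-1)) => //=.
- by move=> k; rewrite /geometric /= mulr_ge0// exprn_ge0.
- move=> k; rewrite /geometric /= normrM normrX.
  apply: (@le_trans _ _ (C * (2 * (`|t| + 1))^-1 ^+ k * (`|t| + 1) ^+ k)).
    by apply: ler_pM => //; rewrite lerXn2r ?nnegrE ?(ltW t1)// lerDl.
  by rewrite -mulrA -exprMn invfM -mulrA mulVf ?mulr1// gt_eqF.
- apply: is_cvg_geometric_series; rewrite ger0_norm//.
  by rewrite invf_lt1// ltr1n.
Qed.

Lemma entire_diffs f : entire_coef f -> entire_coef (pseries_diffs f).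
Proof.
(* Halving the radius absorbs the factor [k + 1], which is at most [2 ^ k]. *)
move=> ef rho rho0; have [|C C0 fC] := ef (rho / 2); first by rewrite divr_gt0.
exists (C * (rho / 2)); first by rewrite mulr_ge0// divr_ge0// ltW.
move=> k; rewrite /pseries_diffs normrM normr_nat.
apply: (@le_trans _ _ (2 ^+ k * (C * (rho / 2) ^+ k.+1))).
  by apply: ler_pM => //; rewrite -natrX ler_nat ltn_expl.
rewrite exprS mulrCA -!mulrA ler_wpM2l// mulrCA ler_wpM2l ?(ltW rho0)//.
by rewrite mulrCA ler_wpM2l// -exprMn mulrCA mulfV ?mulr1.
Qed.

Lemma is_derive_psum f t : entire_coef f ->
  is_derive t 1 (psum f) (psum (pseries_diffs f) t).
Proof.
move=> ef; have ed := entire_diffs ef; have edd := entire_diffs ed.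
apply: (@pseries_snd_diffs _ f (`|t| + 1)); try exact: entire_cvg.
by rewrite [ltRHS]ger0_norm ?ltrDl// addr_ge0.
Qed.

Lemma entireN f : entire_coef f -> entire_coef (fun k => - f k).
Proof.
move=> ef rho rho0; have [C C0 fC] := ef _ rho0.
by exists C => // k; rewrite normrN.
Qed.

Lemma psumD f g t : entire_coef f -> entire_coef g ->
  psum (fun k => f k + g k) t = psum f t + psum g t.
Proof.
move=> ef eg; rewrite /psum -limD; [|exact: entire_cvg|exact: entire_cvg].
congr (limn _); apply/funext => n; rewrite !fctE /pseries /series /= -big_split /=.
by apply: eq_bigr => i _; rewrite mulrDl.
Qed.

Lemma psumN f t : entire_coef f -> psum (fun k => - f k) t = - psum f t.
Proof.
move=> ef; rewrite /psum -limN; last exact: entire_cvg.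
congr (limn _); apply/funext => n; rewrite !fctE /pseries /series /= -sumrN.
by apply: eq_bigr => i _; rewrite mulNr.
Qed.

Lemma sum_ord_supp c (F : nat -> R) s k : (forall i, (s <= i)%N -> c i = 0) ->
  (s <= k)%N -> \sum_(i < k) c i * F i = \sum_(i < s) c i * F i.
Proof.
move=> cs /subnKC <-; rewrite big_split_ord /= [X in _ + X]big1 ?addr0//.
by move=> i _; rewrite cs ?mul0r// leq_addr.
Qed.

Lemma finite_entire c s : (forall i, (s <= i)%N -> c i = 0) -> entire_coef c.
Proof.
move=> cs rho rho0; exists (\sum_(i < s) `|c i| / rho ^+ i).
  by apply: sumr_ge0 => i _; rewrite divr_ge0// exprn_ge0// ltW.
move=> k; case: (ltnP k s) => ks; last first.
  rewrite cs// normr0 mulr_ge0 ?exprn_ge0 ?(ltW rho0)//.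
  by apply: sumr_ge0 => i _; rewrite divr_ge0// exprn_ge0// ltW.
rewrite mulr_suml (bigD1 (Ordinal ks))//= divfK ?expf_neq0 ?gt_eqF// lerDl.
by apply: sumr_ge0 => i _; rewrite mulr_ge0 ?divr_ge0// exprn_ge0// ltW.
Qed.

Lemma psum_finite c s t : (forall i, (s <= i)%N -> c i = 0) ->
  psum c t = \sum_(i < s) c i * t ^+ i.
Proof.
move=> cs; apply: cvg_lim => //.
apply: cvg_near_cst; exists s => // n /= sn; apply/eqP.
by rewrite /pseries /series /= big_mkord (sum_ord_supp (fun i => t ^+ i) cs sn).
Qed.

Definition cauchy_prod c f k : R := \sum_(i < k.+1) c i * f (k - i)%N.

Let delay i f k : R := if (i <= k)%N then f (k - i)%N else 0.

Let psum_delay i f t : entire_coef f ->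
  pseries (delay i f) t n @[n --> \oo] --> t ^+ i * psum f t.
Proof.
move=> ef; rewrite -(cvg_shiftn i).
rewrite (_ : (fun _ => _) = (fun n => t ^+ i * pseries f t n)).
  by apply: cvgMr => //; exact: entire_cvg.
apply/funext => n; rewrite /pseries /series /= mulr_sumr.
rewrite (@big_cat_nat _ _ _ i)//=; last exact: leq_addl.
rewrite big1_seq ?add0r; last first.
  move=> k; rewrite mem_index_iota /= => ki.
  by rewrite /delay leqNgt ki /= mul0r.
rewrite -{1}(add0n i) big_addn addnK; apply: eq_bigr => k _.
by rewrite /delay leq_addl addnK exprD; ring.
Qed.

(** As [c] has finite support, the product is a finite combination of shifted copies of the series
    of [f], and no double series has to be rearranged. *)
Lemma psum_cauchy_prod c f s t : (forall i, (s <= i)%N -> c i = 0) -> entire_coef f ->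
  psum (cauchy_prod c f) t = psum c t * psum f t.
Proof.
move=> cs ef; apply: cvg_lim => //.
rewrite (psum_finite t cs) mulr_suml.
have -> : pseries (cauchy_prod c f) t = (fun n => \sum_(i < s) c i * pseries (delay i f) t n).
  apply/funext => n; rewrite /pseries /series /=.
  under [RHS]eq_bigr do rewrite mulr_sumr.
  rewrite exchange_big /=; apply: eq_bigr => k _.
  under [RHS]eq_bigr do rewrite mulrA.
  rewrite -mulr_suml; congr (_ * _); rewrite /cauchy_prod.
  have E i : (i < k.+1)%N -> f (k - i)%N = delay i f k by rewrite /delay ltnS => ->.
  under eq_bigr => i _ do rewrite E//.
  case: (leqP s k.+1) => sk; first exact: (sum_ord_supp (fun i => delay i f k) cs sk).
  rewrite -(subnKC (ltnW sk)) big_split_ord /= [X in _ + X]big1 ?addr0//.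
  by move=> i _; rewrite /delay leqNgt leq_addr /= mulr0.
rewrite (_ : \sum_(i < s) c i * t ^+ i * psum f t =
    \sum_(i < s) c i * (t ^+ i * psum f t)); last first.
  by apply: eq_bigr => i _; rewrite mulrA.
elim: s {cs} => [|s IH].
  rewrite big_ord0 (_ : (fun _ => _) = cst 0); first exact: cvg_cst.
  by apply/funext => n; rewrite big_ord0.
rewrite big_ord_recr /= (_ : (fun _ => _) = (fun n =>
   \sum_(i < s) c i * pseries (delay i f) t n + c s * pseries (delay s f) t n)).
  by apply: cvgD => //; apply: cvgMr => //; exact: psum_delay.
by apply/funext => n; rewrite big_ord_recr.
Qed.

(** The recursion is the differential equation [a' = c a] for power series. At a given radius,
    strong induction propagates the Cauchy estimate once [k + 1] exceeds [Q]; the constant [C]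
    covers the finitely many earlier coefficients. *)
Lemma entire_recursion a c s : (forall i, (s <= i)%N -> c i = 0) ->
  (forall k, k.+1%:R * a k.+1 = cauchy_prod c a k) -> entire_coef a.
Proof.
move=> cs rec rho rho0.
pose Q := \sum_(i < s) `|c i| * rho ^- i.+1.
have rX n : 0 < rho ^+ n by rewrite exprn_gt0.
pose k0 := (Num.bound Q).
have Qk k : (k0 <= k)%N -> Q <= k.+1%:R.
  move=> kk; have Q0 : 0 <= Q.
    by apply: sumr_ge0 => i _; rewrite mulr_ge0// invr_ge0 ltW.
  by rewrite (le_trans (ltW (archi_boundP Q0)))// ler_nat (leq_trans kk).
pose C := \sum_(i < k0.+1) `|a i| / rho ^+ i.
have C0 : 0 <= C by apply: sumr_ge0 => i _; rewrite divr_ge0// ltW.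
exists C => // k; have [n] := ubnP k; elim: n k => // n IH k kn.
case: (ltnP k k0.+1) => kk0.
  rewrite /C mulr_suml (bigD1 (Ordinal kk0))//= divfK ?gt_eqF// lerDl.
  by apply: sumr_ge0 => i _; rewrite mulr_ge0 ?divr_ge0// ltW.
case: k kn kk0 => // k kn kk0.
have k1 : 0 < k.+1%:R :> R by rewrite ltr0n.
rewrite -(ler_pM2l k1) -[X in X * `|_|]normr_nat -normrM rec /cauchy_prod.
rewrite (le_trans (ler_norm_sum _ _ _))//.
apply: (@le_trans _ _ (\sum_(i < k.+1) `|c i| * (C * rho ^+ k.+1 * rho ^- i.+1))).
  apply: ler_sum => i _; rewrite normrM ler_wpM2l//.
  rewrite (le_trans (IH _ _))//; first by rewrite (leq_ltn_trans (leq_subr _ _)).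
  have ik : (i.+1 <= k.+1)%N by exact: ltn_ord.
  have -> : rho ^+ k.+1 = rho ^+ (k - i) * rho ^+ i.+1.
    by rewrite -exprD addnS subnK// -ltnS.
  by rewrite mulrA mulfK// gt_eqF.
apply: (@le_trans _ _ (Q * (C * rho ^+ k.+1))).
  set W := C * _; have W0 : 0 <= W by rewrite mulr_ge0// ltW.
  have -> : \sum_(i < k.+1) `|c i| * (W * rho ^- i.+1) =
      (\sum_(i < k.+1) `|c i| * rho ^- i.+1) * W.
    by rewrite [RHS]mulr_suml; apply: eq_bigr => i _; rewrite mulrCA mulrC.
  rewrite ler_wpM2r//.
  have ns i : (s <= i)%N -> `|c i| = 0 by move=> /cs ->; rewrite normr0.
  case: (leqP s k.+1) => sk.
    by rewrite (sum_ord_supp (fun i => rho ^- i.+1) ns sk).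
  rewrite /Q -[leRHS](big_mkord xpredT (fun i => `|c i| * rho ^- i.+1)).
  rewrite (@big_cat_nat _ _ _ k.+1)//=; last exact: ltnW.
  rewrite big_mkord lerDl; apply: sumr_ge0 => i _.
  by rewrite divr_ge0// ltW.
by rewrite ler_wpM2r ?Qk// mulr_ge0// ltW.
Qed.

End entire_series.

(** * The theorem of Marcinkiewicz *)

Section marcinkiewicz.
Context {R : realType}.

(** The real part of [(exp(i th) + exp(- i th)) ^ k * exp(i ps)], expanded by the binomial
    theorem. *)
Lemma sum_bin_cos (k : nat) (th ps : R) :
  \sum_(i < k.+1) 'C(k, i)%:R * cos ((i%:R - (k - i)%:R) * th + ps) =
  (2 * cos th) ^+ k * cos ps.
Proof.
elim: k ps => [|k IH] ps.
  by rewrite big_ord1 bin0 subrr mul0r add0r expr0.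
rewrite -(sum_bin_pascal (fun i j => cos ((i%:R - j%:R) * th + ps))).
have -> : \sum_(i < k.+1) 'C(k, i)%:R * cos ((i.+1%:R - (k - i)%:R) * th + ps) =
    (2 * cos th) ^+ k * cos (ps + th).
  rewrite -IH; apply: eq_bigr => i _; congr (_ * cos _).
  by rewrite -natr1; ring.
have -> : \sum_(i < k.+1) 'C(k, i)%:R * cos ((i%:R - (k.+1 - i)%:R) * th + ps) =
    (2 * cos th) ^+ k * cos (ps - th).
  rewrite -IH; apply: eq_bigr => i _; congr (_ * cos _).
  rewrite subSn; last by rewrite -ltnS.
  by rewrite -natr1; ring.
by rewrite cosD cosB exprS; ring.
Qed.

Definition triangle (F : nat -> nat -> R) n :=
  \sum_(k < n) \sum_(i < k.+1) F i (k - i)%N.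

Lemma triangleE (F : nat -> nat -> R) n N : (n <= N)%N ->
  triangle F n = \sum_(i < N) \sum_(j < N) (i + j < n)%N%:R * F i j.
Proof.
elim: n => [|n IH] nN; rewrite /triangle.
  by rewrite big_ord0 big1// => i _; rewrite big1// => j _; rewrite mul0r.
rewrite big_ord_recr /= -/(triangle F n) IH; last exact: ltnW.
have -> : \sum_(i < n.+1) F i (n - i)%N =
    \sum_(i < N) \sum_(j < N) (i + j == n)%N%:R * F i j.
  rewrite (big_ord_widen N (fun i => F i (n - i)%N))// big_mkcond /=.
  apply: eq_bigr => i _; rewrite ltnS; case: leqP => ni; last first.
    rewrite big1// => j _; rewrite gtn_eqF ?mul0r//.
    by rewrite (leq_trans ni)// leq_addr.
  have jN : (n - i < N)%N by rewrite (leq_ltn_trans (leq_subr _ _)).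
  rewrite (bigD1 (Ordinal jN))//= subnKC// eqxx mul1r big1 ?addr0// => j.
  move=> /eqP jn; rewrite (_ : (_ == _) = false) ?mul0r//; apply/eqP => ijn.
  by apply: jn; apply/val_inj; rewrite /= -ijn addKn.
rewrite -big_split; apply: eq_bigr => i _; rewrite -big_split.
apply: eq_bigr => j _ /=; rewrite -mulrDl -natrD; congr (_%:R * _).
by case: (ltngtP (i + j) n) => h; lia.
Qed.

(** The square and the triangle differ by terms with [K <= i + j < 2 K], all of which occur in the
    difference of the triangles of sizes [2 K] and [K]. *)
Lemma square_triangle (F : nat -> nat -> R) K :
  `|\sum_(i < K) \sum_(j < K) F i j - triangle F K| <=
  triangle (fun i j => `|F i j|) (K + K) - triangle (fun i j => `|F i j|) K.
Proof.
rewrite (triangleE F (leqnn K)) (triangleE _ (leqnn (K + K))).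
rewrite (triangleE (fun i j => `|F i j|) (leq_addr K K)).
rewrite -!sumrB; under eq_bigr do rewrite -sumrB.
under [leRHS]eq_bigr do rewrite -sumrB.
pose G i j : R := (K <= i + j < K + K)%N%:R * `|F i j|.
have G0 i j : 0 <= G i j by rewrite mulr_ge0.
have -> : \sum_(i < K + K) \sum_(j < K + K)
    ((i + j < K + K)%N%:R * `|F i j| - (i + j < K)%N%:R * `|F i j|) =
    \sum_(i < K + K) \sum_(j < K + K) G i j.
  apply: eq_bigr => i _; apply: eq_bigr => j _.
  rewrite -mulrBl; congr (_ * _); case: (ltnP (i + j) K) => h1 /=.
    by rewrite ltn_addl//= subrr.
  by rewrite subr0.
apply: (@le_trans _ _ (\sum_(i < K) \sum_(j < K) G i j)).
  rewrite (le_trans (ler_norm_sum _ _ _))//; apply: ler_sum => i _.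
  rewrite (le_trans (ler_norm_sum _ _ _))//; apply: ler_sum => j _.
  rewrite /G -{1}(mul1r (F i j)) -mulrBl normrM.
  have -> : (i + j < K + K)%N by have := ltn_ord i; have := ltn_ord j; lia.
  by case: ltnP => h /=; rewrite ?subrr ?subr0 ?normr0 ?normr1.
rewrite [leRHS]big_split_ord /= -[leLHS]addr0 lerD//; last first.
  by apply: sumr_ge0 => i _; apply: sumr_ge0.
apply: ler_sum => i _; rewrite [leRHS]big_split_ord /= -[leLHS]addr0 lerD//.
by apply: sumr_ge0.
Qed.

(* [kap i] is the cumulant of order [i + 1]. *)
Variables (mo kap : nat -> R) (s : nat).
Hypothesis hankel : forall K (h : nat -> R),
  0 <= \sum_(i < K) \sum_(j < K) h i * h j * mo (i + j)%N.
Hypothesis mo_rec : forall k,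
  mo k.+1 = \sum_(i < k.+1) 'C(k, i)%:R * kap i * mo (k - i)%N.
Hypothesis kap_supp : forall i, (s <= i)%N -> kap i = 0.
Hypothesis mo0 : mo 0%N = 1.

(** Taylor coefficients of the moment generating function [M]; those of the derivative of
    [K = log M] are the [c i] below, since [kap i] has order [i + 1]. The recursion [a_rec] says
    [M' = K' M]. *)
Let a k : R := mo k / k`!%:R.
Let c i : R := kap i / i`!%:R.

Let c_supp i : (s <= i)%N -> c i = 0.
Proof. by move=> si; rewrite /c kap_supp// mul0r. Qed.

Let fact0 k : k`!%:R != 0 :> R.
Proof. by rewrite pnatr_eq0 -lt0n fact_gt0. Qed.

Let bin_fact_div k (i : 'I_k.+1) :
  'C(k, i)%:R / k`!%:R = (i`!%:R)^-1 * ((k - i)`!%:R)^-1 :> R.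
Proof.
have ik : (i <= k)%N by rewrite -ltnS.
have C0 : 'C(k, i)%:R != 0 :> R by rewrite pnatr_eq0 -lt0n bin_gt0.
rewrite -(bin_fact ik) [X in _ / X](natrM _ _ _) (natrM _ i`! _) !invfM.
by rewrite mulVKf.
Qed.

Let a_rec k : k.+1%:R * a k.+1 = cauchy_prod c a k.
Proof.
rewrite /a factS natrM invfM mulrCA mulVKf ?pnatr_eq0//.
rewrite mo_rec mulr_suml /cauchy_prod; apply: eq_bigr => i _.
rewrite (_ : _ / _ = kap i * mo (k - i)%N * ('C(k, i)%:R / k`!%:R)); last by ring.
by rewrite bin_fact_div /c /a; ring.
Qed.

Let entire_a : entire_coef a.
Proof. exact: entire_recursion c_supp a_rec. Qed.

(** Series in [t] along the ray of angle [th]: [A] and [B] are the real and imaginary parts of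
    [M(t exp(i th))], and [p] and [q] those of the derivative in [t] of [K(t exp(i th))]. *)
Let A th k := a k * cos (k%:R * th).
Let B th k := a k * sin (k%:R * th).
Let p th i := c i * cos (i.+1%:R * th).
Let q th i := c i * sin (i.+1%:R * th).

Let entire_mul (f : nat -> R) : (forall k, `|f k| <= 1) -> entire_coef (fun k => a k * f k).
Proof.
move=> f1 rho rho0; have [C C0 aC] := entire_a rho0; exists C => // k.
by rewrite normrM -[leRHS]mulr1 ler_pM.
Qed.

Let entire_A th : entire_coef (A th).
Proof. by apply: entire_mul => k; exact: cos_max. Qed.

Let entire_B th : entire_coef (B th).
Proof. by apply: entire_mul => k; exact: sin_max. Qed.

Let p_supp th i : (s <= i)%N -> p th i = 0.
Proof. by move=> si; rewrite /p c_supp// mul0r. Qed.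

Let q_supp th i : (s <= i)%N -> q th i = 0.
Proof. by move=> si; rewrite /q c_supp// mul0r. Qed.

Let diffsA th k : pseries_diffs (A th) k = cauchy_prod (p th) (A th) k - cauchy_prod (q th) (B th) k.
Proof.
rewrite /pseries_diffs /A mulrA a_rec /cauchy_prod mulr_suml -sumrB.
apply: eq_bigr => i _; rewrite /p /q /B.
have -> : k.+1%:R * th = i.+1%:R * th + (k - i)%N%:R * th.
  by rewrite -mulrDl -natrD addSn subnKC// -ltnS.
by rewrite cosD; ring.
Qed.

Let diffsB th k : pseries_diffs (B th) k = cauchy_prod (p th) (B th) k + cauchy_prod (q th) (A th) k.
Proof.
rewrite /pseries_diffs /B mulrA a_rec /cauchy_prod mulr_suml -big_split.
apply: eq_bigr => i _; rewrite /p /q /A /=.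
have -> : k.+1%:R * th = i.+1%:R * th + (k - i)%N%:R * th.
  by rewrite -mulrDl -natrD addSn subnKC// -ltnS.
by rewrite sinD; ring.
Qed.

Let entire_cauchy_prod (c' f : nat -> R) : (forall i, (s <= i)%N -> c' i = 0) -> entire_coef f ->
  entire_coef (cauchy_prod c' f).
Proof.
move=> cs ef rho rho0; have [C C0 fC] := ef _ rho0.
exists (\sum_(i < s) `|c' i| * (rho ^- i * C)).
  by apply: sumr_ge0 => i _; rewrite mulr_ge0// mulr_ge0// invr_ge0 exprn_ge0// ltW.
move=> k; rewrite /cauchy_prod (le_trans (ler_norm_sum _ _ _))//.
apply: (@le_trans _ _ (\sum_(i < k.+1) `|c' i| * (rho ^- i * C * rho ^+ k))).
  apply: ler_sum => i _; rewrite normrM ler_wpM2l//.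
  rewrite (le_trans (fC _))// -mulrA mulrCA ler_wpM2l//.
  have -> : rho ^+ k = rho ^+ i * rho ^+ (k - i) by rewrite -exprD subnKC// -ltnS.
  by rewrite mulKf// expf_neq0// gt_eqF.
rewrite mulr_suml; under [leRHS]eq_bigr do rewrite -mulrA.
have ns i : (s <= i)%N -> `|c' i| = 0 by move=> /cs ->; rewrite normr0.
case: (leqP s k.+1) => sk.
  by rewrite (sum_ord_supp (fun i => rho ^- i * C * rho ^+ k) ns sk).
rewrite -[leRHS](big_mkord xpredT (fun i => `|c' i| * (rho ^- i * C * rho ^+ k))).
rewrite (@big_cat_nat _ _ _ k.+1)//=; last exact: ltnW.
rewrite big_mkord lerDl; apply: sumr_ge0 => i _.
by rewrite !mulr_ge0 ?invr_ge0 ?exprn_ge0 ?(ltW rho0).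
Qed.

(** The real part of [K(t exp(i th))], that is, the logarithm of the modulus of [M(t exp(i th))];
    its constant term is 0. *)
Let ex th k : R := if k is i.+1 then p th i / i.+1%:R else 0.

Let ex_supp th i : (s.+1 <= i)%N -> ex th i = 0.
Proof. by case: i => // i si; rewrite /ex p_supp// mul0r. Qed.

Let derive_A (th t : R) : is_derive t (1 : R) (psum (A th))
  (psum (p th) t * psum (A th) t - psum (q th) t * psum (B th) t).
Proof.
have e1 := entire_cauchy_prod (p_supp th) (entire_A th).
have e2 := entire_cauchy_prod (q_supp th) (entire_B th).
apply: (is_derive_eq (is_derive_psum t (entire_A th))).
rewrite -(psum_cauchy_prod t (p_supp th) (entire_A th)).
rewrite -(psum_cauchy_prod t (q_supp th) (entire_B th)).
rewrite -psumN// -psumD//; last exact: entireN.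
by congr (psum _ _); apply/funext => k; exact: diffsA.
Qed.

Let derive_B (th t : R) : is_derive t (1 : R) (psum (B th))
  (psum (p th) t * psum (B th) t + psum (q th) t * psum (A th) t).
Proof.
have e1 := entire_cauchy_prod (p_supp th) (entire_B th).
have e2 := entire_cauchy_prod (q_supp th) (entire_A th).
apply: (is_derive_eq (is_derive_psum t (entire_B th))).
rewrite -(psum_cauchy_prod t (p_supp th) (entire_B th)).
rewrite -(psum_cauchy_prod t (q_supp th) (entire_A th)).
rewrite -psumD//; congr (psum _ _); apply/funext => k; exact: diffsB.
Qed.

Let derive_ex (th t : R) : is_derive t (1 : R) (psum (ex th)) (psum (p th) t).
Proof.
have := is_derive_psum t (finite_entire (ex_supp th)).
rewrite (_ : pseries_diffs _ = p th)//.
by apply/funext => k; rewrite /pseries_diffs /ex mulrC divfK// pnatr_eq0.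
Qed.

Let psum_at0 (f : nat -> R) : psum f 0 = f 0%N.
Proof.
apply: cvg_lim => //; apply: cvg_near_cst; exists 1%N => // n /= n0; apply/eqP.
case: n n0 => // n _; rewrite /pseries /series /= big_nat_recl// expr0 mulr1.
by rewrite big1 ?addr0// => i _; rewrite expr0n mulr0.
Qed.

(** Since [M' = K' M] along the ray, the derivative of [A ^ 2 + B ^ 2] is [2 p (A ^ 2 + B ^ 2)]. Its
    quotient by the exponential thus has zero derivative and equals 1 at 0. *)
Lemma sqr_modulus_exp th t :
  psum (A th) t ^+ 2 + psum (B th) t ^+ 2 = expR (2 * psum (ex th) t).
Proof.
pose H u := (psum (A th) u * psum (A th) u + psum (B th) u * psum (B th) u) *
  expR (- (2 * psum (ex th) u)).
have dH u : is_derive u (1 : R) H 0.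
  have dA := derive_A th u; have dB := derive_B th u; have dE := derive_ex th u.
  have d2 : is_derive u (1 : R) (fun u => - (2 * psum (ex th) u)) (- (2 * psum (p th) u)).
    by apply: is_deriveN; exact: (is_deriveZ 2).
  have dexp : is_derive u (1 : R) (expR \o (fun u => - (2 * psum (ex th) u)))
      (expR (- (2 * psum (ex th) u)) * - (2 * psum (p th) u)).
    exact: is_derive1_comp.
  have dsq := is_deriveD (is_deriveM dA dA) (is_deriveM dB dB).
  apply: (is_derive_eq (is_deriveM dsq dexp)).
  rewrite /= !fctE /GRing.scale /=; ring.
have := is_derive_0_is_cst t 0 dH; rewrite /H !psum_at0.
have -> : A th 0%N = 1 by rewrite /A /a mo0 mul0r cos0 divr1 mulr1.
have -> : B th 0%N = 0 by rewrite /B mul0r sin0 mulr0.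
rewrite /= !mulr0 oppr0 expR0 !mulr1 addr0 expRN.
move=> /(congr1 (fun x => x * expR (2 * psum (ex th) t))).
by rewrite divfK ?gt_eqF ?expR_gt0// mul1r !expr2.
Qed.

(** The product of the two sines becomes a difference of cosines: those of the difference of the
    angles are summed by [sum_bin_cos] to [(2 cos th) ^ k], and the sum of the angles does not
    depend on [i]. *)
Let triangle_term (t th ph : R) k :
  2 * \sum_(i < k.+1) ((t / 2) ^+ i * sin (i%:R * th - ph / 2) / i`!%:R) *
    ((t / 2) ^+ (k - i) * sin ((k - i)%N%:R * th - ph / 2) / (k - i)`!%:R) *
    mo (i + (k - i))%N =
  a k * (t * cos th) ^+ k - a k * cos (k%:R * th - ph) * t ^+ k.
Proof.
have sin2 x y : 2 * (sin x * sin y) = cos (x - y) - cos (x + y) :> R.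
  by rewrite cosB cosD; ring.
transitivity (a k * (t / 2) ^+ k * \sum_(i < k.+1) ('C(k, i)%:R *
    cos ((i%:R - (k - i)%N%:R) * th + 0) - cos (k%:R * th - ph) * 'C(k, i)%:R)).
  rewrite !mulr_sumr; apply: eq_bigr => i _.
  have ik : (i <= k)%N by rewrite -ltnS.
  rewrite subnKC// (_ : (t / 2) ^+ k = (t / 2) ^+ i * (t / 2) ^+ (k - i)); last first.
    by rewrite -exprD subnKC.
  set u := (t / 2) ^+ i; set v := (t / 2) ^+ (k - i).
  rewrite (_ : 2 * _ = u * v * mo k * ((i`!%:R)^-1 * ((k - i)`!%:R)^-1) *
     (2 * (sin (i%:R * th - ph / 2) * sin ((k - i)%N%:R * th - ph / 2)))); last by ring.
  rewrite sin2 -bin_fact_div /a.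
  have -> : i%:R * th - ph / 2 - ((k - i)%N%:R * th - ph / 2) =
      (i%:R - (k - i)%N%:R) * th + 0 by ring.
  have -> : i%:R * th - ph / 2 + ((k - i)%N%:R * th - ph / 2) = k%:R * th - ph.
    have -> : k%:R = i%:R + (k - i)%N%:R :> R by rewrite -natrD subnKC.
    by field.
  by ring.
rewrite sumrB -mulr_sumr sum_bin_cos cos0.
have -> : \sum_(i < k.+1) 'C(k, i)%:R = 2 ^+ k :> R.
  have := sum_bin_cos k 0 0; rewrite !cos0 !mulr1 => <-.
  by apply: eq_bigr => i _; rewrite mulr0 addr0 cos0 mulr1.
rewrite !exprMn mulrBr mulr1.
rewrite (_ : a k * _ * _ - _ = a k * (t ^+ k * cos th ^+ k) * (2^-1 ^+ k * 2 ^+ k) -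
  a k * cos (k%:R * th - ph) * t ^+ k * (2^-1 ^+ k * 2 ^+ k)); last by ring.
have -> : 2^-1 ^+ k * 2 ^+ k = 1 :> R by rewrite -exprMn mulVf// expr1n.
by rewrite !mulr1.
Qed.

Let triangle_norm_term (t th ph : R) k :
  \sum_(i < k.+1) `|((t / 2) ^+ i * sin (i%:R * th - ph / 2) / i`!%:R) *
    ((t / 2) ^+ (k - i) * sin ((k - i)%N%:R * th - ph / 2) / (k - i)`!%:R) *
    mo (i + (k - i))%N| <= `|a k| * `|t| ^+ k.
Proof.
apply: (@le_trans _ _ (\sum_(i < k.+1) `|a k| * (`|t| / 2) ^+ k * 'C(k, i)%:R)).
  apply: ler_sum => i _.
  have ik : (i <= k)%N by rewrite -ltnS.
  rewrite subnKC// (_ : (`|t| / 2) ^+ k = (`|t| / 2) ^+ i * (`|t| / 2) ^+ (k - i)); last first.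
    by rewrite -exprD subnKC.
  have tn n : `|(t / 2) ^+ n| = (`|t| / 2) ^+ n.
    by rewrite normrX normrM (ger0_norm (x := 2^-1)).
  rewrite !normrM !tn !normfV !normr_nat.
  set u := (`|t| / 2) ^+ i; set v := (`|t| / 2) ^+ (k - i).
  rewrite (_ : _ * `|mo k| = u * v * `|mo k| * ((i`!%:R)^-1 * ((k - i)`!%:R)^-1) *
     (`|sin (i%:R * th - ph / 2)| * `|sin ((k - i)%N%:R * th - ph / 2)|)); last by ring.
  rewrite -bin_fact_div -[leRHS]mulr1.
  rewrite (_ : _ * (u * v) * _ = u * v * `|mo k| * ('C(k, i)%:R / k`!%:R)); last first.
    by ring.
  rewrite ler_wpM2l// ?mulr_ile1 ?sin_max// !mulr_ge0 ?exprn_ge0 ?divr_ge0 ?invr_ge0//.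
rewrite -mulr_sumr.
have -> : \sum_(i < k.+1) 'C(k, i)%:R = 2 ^+ k :> R.
  have := sum_bin_cos k 0 0; rewrite !cos0 !mulr1 => <-.
  by apply: eq_bigr => i _; rewrite mulr0 addr0 cos0 mulr1.
by rewrite -mulrA -exprMn divfK.
Qed.

(* This is [Re (exp(- i ph) M(t exp(i th))) <= M(t cos th)] for the moment generating
   function [M]: the difference of the two sides is [2 E[(sum_i h i W^i)^2]] with
   [sum_i h i w^i = exp(w t cos(th) / 2) sin((w t sin(th) - ph) / 2)]. *)
Lemma directional_positivity (t th ph : R) :
  psum (A th) t * cos ph + psum (B th) t * sin ph <= psum a (t * cos th).
Proof.
pose h i : R := (t / 2) ^+ i * sin (i%:R * th - ph / 2) / i`!%:R.
pose F i j : R := h i * h j * mo (i + j)%N.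
pose Sq K := \sum_(i < K) \sum_(j < K) F i j.
have cA := entire_cvg (t := t) (entire_A th); have cB := entire_cvg (t := t) (entire_B th).
have ca := entire_cvg (t := t * cos th) entire_a.
pose L := psum a (t * cos th) - (psum (A th) t * cos ph + psum (B th) t * sin ph).
have triE K : 2 * triangle F K = pseries a (t * cos th) K -
    (pseries (A th) t K * cos ph + pseries (B th) t K * sin ph).
  rewrite /triangle mulr_sumr.
  rewrite (eq_bigr (fun k : 'I_K => a k * (t * cos th) ^+ k -
    (A th k * t ^+ k * cos ph + B th k * t ^+ k * sin ph))); last first.
    move=> k _; rewrite [LHS]triangle_term cosB /A /B; ring.
  by rewrite sumrB big_split /= !mulr_suml /pseries /series /= !big_mkord.
have cvg_tri : 2 * triangle F K @[K --> \oo] --> L.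
  rewrite (_ : (fun K => 2 * triangle F K) = (fun K => pseries a (t * cos th) K -
    (pseries (A th) t K * cos ph + pseries (B th) t K * sin ph))); last exact/funext.
  by apply: cvgB => //; apply: cvgD; apply: cvgMl.
pose g k := `|a k|.
have eg : entire_coef g.
  by move=> rho rho0; have [C C0 aC] := entire_a rho0; exists C => // k; rewrite normr_id.
have cg := entire_cvg (t := `|t|) eg.
have cg0 : pseries g `|t| (K + K)%N - pseries g `|t| K @[K --> \oo] --> (0 : R).
  rewrite -(subrr (psum g `|t|)); apply: cvgB => //.
  have h1 : (fun K => (K + K)%N) @ \oo --> \oo.
    by move=> /= U [N _ NU]; exists N => // K /= NK; apply: NU => /=; rewrite (leq_trans NK)// leq_addr.
  exact: cvg_comp h1 cg.
(* Hankel positivity concerns square partial sums, while it is the doubled triangular ones that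
   converge to [L]. The two differ by at most a tail of the absolutely convergent series of [M]. *)
have diff0 : Sq K - triangle F K @[K --> \oo] --> (0 : R).
  apply: (@squeeze_cvgr _ _ _ _ (fun K => - (pseries g `|t| (K + K)%N - pseries g `|t| K))
    (fun K => pseries g `|t| (K + K)%N - pseries g `|t| K)) => //; last first.
    by rewrite -[X in _ --> X]oppr0; exact: cvgN.
  apply: nearW => K; rewrite -ler_norml (le_trans (square_triangle F K))//.
  have -> : triangle (fun i j => `|F i j|) (K + K) - triangle (fun i j => `|F i j|) K =
      \sum_(K <= k < K + K) \sum_(i < k.+1) `|F i (k - i)%N|.
    rewrite /triangle -(big_mkord xpredT (fun k => \sum_(i < k.+1) `|F i (k - i)%N|)).
    rewrite -[X in _ - X](big_mkord xpredT (fun k => \sum_(i < k.+1) `|F i (k - i)%N|)).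
    by rewrite (@big_cat_nat _ _ _ K)//= ?leq_addr// addrAC subrr add0r.
  have -> : pseries g `|t| (K + K)%N - pseries g `|t| K =
      \sum_(K <= k < K + K) g k * `|t| ^+ k.
    by rewrite /pseries /series /= (@big_cat_nat _ _ _ K)//= ?leq_addr// addrAC subrr add0r.
  by apply: ler_sum => k _; exact: triangle_norm_term.
have cvg_sq : 2 * Sq K @[K --> \oo] --> L.
  rewrite (_ : (fun K => 2 * Sq K) = (fun K => 2 * (Sq K - triangle F K) + 2 * triangle F K)).
    rewrite -[L]add0r -[X in X + L](mulr0 2); apply: cvgD => //.
    exact: cvgMr.
  by apply/funext => K; ring.
rewrite -subr_ge0 -/L -(cvg_lim _ cvg_sq)//; apply: limr_ge.
  by apply/cvg_ex; exists L.
apply: nearW => K; rewrite mulr_ge0//; exact: hankel.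
Qed.

(** With [ph] the argument of [M(t exp(i th))], [directional_positivity] bounds the modulus of this
    number by [M(t cos th)]. By [sqr_modulus_exp] both squares are exponentials, so the exponents
    compare. *)
Lemma cumulant_direction_le (t th : R) :
  psum (ex th) t <= psum (ex 0) (t * cos th).
Proof.
have E1 := sqr_modulus_exp th t; have E2 := sqr_modulus_exp 0 (t * cos th).
have A0 : psum (A 0) (t * cos th) = psum a (t * cos th).
  by congr (psum _ _); apply/funext => k; rewrite /A mulr0 cos0 mulr1.
have B0 : psum (B 0) (t * cos th) = 0.
  rewrite (_ : B 0 = fun=> 0); last by apply/funext => k; rewrite /B mulr0 sin0 mulr0.
  by rewrite (@psum_finite _ _ 0%N)// big_ord0.
rewrite A0 B0 expr0n /= addr0 in E2.
set x := psum (A th) t in E1; set y := psum (B th) t in E1.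
set z := psum a (t * cos th) in E2.
have pos ph : x * cos ph + y * sin ph <= z by exact: directional_positivity.
have N0 : 0 < x ^+ 2 + y ^+ 2 by rewrite E1 expR_gt0.
pose N := Num.sqrt (x ^+ 2 + y ^+ 2).
have Np : 0 < N by rewrite sqrtr_gt0.
have N2 : N ^+ 2 = x ^+ 2 + y ^+ 2 by rewrite sqr_sqrtr// ltW.
have [ph [cph sph]] : exists ph, cos ph = x / N /\ sin ph = y / N.
  have xN : - 1 <= x / N <= 1.
    rewrite -ler_norml normrM normfV (gtr0_norm Np) ler_pdivrMr// mul1r.
    rewrite -[leRHS](gtr0_norm Np) -ler_sqr ?nnegrE// !real_normK ?num_real//.
    by rewrite N2 lerDl sqr_ge0.
  have cac := acosK (x := x / N) xN.
  have sn : sin (acos (x / N)) = `|y / N|.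
    rewrite sin_acos// -sqrtr_sqr; congr Num.sqrt.
    by rewrite !expr_div_n N2; field; rewrite gt_eqF.
  case: (leP 0 (y / N)) => yN.
    by exists (acos (x / N)); rewrite cac sn ger0_norm.
  by exists (- acos (x / N)); rewrite cosN sinN cac sn ltr0_norm// opprK.
have zN : N <= z.
  have := pos ph; rewrite cph sph.
  rewrite (_ : _ + _ = (x ^+ 2 + y ^+ 2) / N); last by ring.
  by rewrite -N2 expr2 mulfK// gt_eqF.
have z0 : 0 <= z by rewrite (le_trans (ltW Np)).
have : N ^+ 2 <= z ^+ 2 by rewrite ler_sqr ?nnegrE// ltW.
by rewrite N2 E1 E2 ler_expR ler_pM2l.
Qed.

Lemma leading_coef_ge0 (e : nat -> R) n :
  (forall t, 0 <= t -> 0 <= \sum_(i < n.+1) e i * t ^+ i) -> 0 <= e n.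
Proof.
move=> pos; rewrite leNgt; apply/negP => en.
pose S := \sum_(i < n) `|e i|.
have S0 : 0 <= S by apply: sumr_ge0.
(* At this point [e n * t] equals [e n - S], so that the leading term outweighs all the others. *)
pose t := 1 + S / - e n.
have en' : 0 < - e n by rewrite oppr_gt0.
have t1 : 1 <= t by rewrite lerDl divr_ge0// ltW.
have t0 : 0 <= t by exact: le_trans t1.
have := pos t t0; rewrite big_ord_recr /=; apply/negP; rewrite -ltNge.
case: n @S pos en S0 @t en' t1 t0 => [|n] S pos en S0 t en' t1 t0.
  by rewrite big_ord0 add0r expr0 mulr1.
have : \sum_(i < n.+1) e i * t ^+ i <= S * t ^+ n.
  rewrite /S mulr_suml; apply: ler_sum => i _.
  rewrite (le_trans (ler_norm _))// normrM ler_wpM2l// normrX (ger0_norm t0).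
  by apply: ler_weXn2l => //; rewrite -ltnS.
have tn : 0 < t ^+ n by rewrite exprn_gt0// (lt_le_trans _ t1).
have -> : e n.+1 * t ^+ n.+1 = (e n.+1 - S) * t ^+ n.
  rewrite exprS mulrA; congr (_ * _); rewrite /t; field.
  by rewrite lt_eqF.
by move=> h; rewrite (le_lt_trans (lerD h (lexx _)))// -mulrDl addrCA subrr addr0 nmulr_rlt0.
Qed.

(* Comparing the leading terms in [cumulant_direction_le], a top coefficient [c] of
   degree [d >= 3] satisfies [c cos (d th) <= c cos(th)^d] for all [th]; the angles
   [2 pi / d] and [pi / d] exclude both signs. *)
Lemma marcinkiewicz i : (2 <= i)%N -> kap i = 0.
Proof.
move=> i2; apply/eqP; apply: contraT => ki.
have [n [n2 kn nmax]] : exists n, [/\ (2 <= n)%N, kap n != 0 &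
    forall j, (n < j)%N -> kap j = 0].
  have ex0 : exists j, (2 <= j)%N && (kap j != 0) by exists i; rewrite i2.
  have bd j : (2 <= j)%N && (kap j != 0) -> (j <= s)%N.
    case/andP => _ kj; rewrite leqNgt; apply/negP => sj.
    by rewrite kap_supp ?eqxx// ltnW in kj.
  case: (ex_maxnP ex0 bd) => n /andP[n2 kn] nmax; exists n; split => // j nj.
  apply/eqP; apply: contraT => kj.
  by have := nmax j; rewrite kj (leq_trans n2 (ltnW nj)) leqNgt nj => /(_ isT).
(* The degree of the cumulant generating function, one more than the index of the last nonzero
   [kap]. *)
pose d := n.+1.
have exn th j : (n.+2 <= j)%N -> ex th j = 0.
  by case: j => // j jn; rewrite /ex /p /c nmax// !mul0r.
pose e th j : R := ex 0 j * cos th ^+ j - ex th j.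
have lead th : 0 <= e th d.
  apply: (@leading_coef_ge0 (e th)) => t _.
  have := cumulant_direction_le t th.
  rewrite (psum_finite _ (exn th)) (psum_finite _ (exn 0)) -subr_ge0 -sumrB.
  rewrite (eq_bigr (fun j : 'I_n.+2 => e th j * t ^+ j))//.
  by move=> j _; rewrite exprMn /e; ring.
have d0 : d%:R != 0 :> R by rewrite pnatr_eq0.
have eE th : e th d = c n / d%:R * (cos th ^+ d - cos (d%:R * th)).
  rewrite /e -[ex 0 d]/(c n * cos (d%:R * 0) / d%:R).
  by rewrite -[ex th d]/(c n * cos (d%:R * th) / d%:R) mulr0 cos0; ring.
have cn0 : c n / d%:R != 0 by rewrite !mulf_neq0 ?invr_eq0.
have pid : 0 < pi / d%:R :> R by rewrite divr_gt0 ?pi_gt0// ltr0n.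
have d3 : 3 <= d%:R :> R by rewrite ler_nat.
have pi0 : 0 < pi :> R := pi_gt0 R.
have h1 := lead (pi / d%:R); have h2 := lead (2 * pi / d%:R).
rewrite eE mulrCA mulfV// mulr1 cospi in h1.
have d2pi : d%:R * (2 * pi / d%:R) = pi *+ 2 :> R by rewrite mulrCA mulfV// mulr1 mulr_natl.
rewrite eE d2pi cos2pi in h2.
have g1 : 0 < cos (pi / d%:R) ^+ d - - 1 :> R.
  rewrite opprK addr_gt0// exprn_gt0// cos_gt0_pihalf//.
  rewrite (lt_trans _ pid) ?oppr_lt0 ?divr_gt0//= ltr_pM2l//.
  by rewrite ltf_pV2 ?posrE ?ltr0n// (lt_le_trans _ d3)// ltr_nat.
have g2 : cos (2 * pi / d%:R) ^+ d - 1 < 0 :> R.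
  rewrite subr_lt0 (le_lt_trans (ler_norm _))// normrX exprn_ilt1//.
  have x0 : 0 < 2 * pi / d%:R :> R by rewrite divr_gt0 ?mulr_gt0 ?ltr0n.
  have x1 : 2 * pi / d%:R < pi :> R.
    rewrite ltr_pdivrMr ?ltr0n// mulrC ltr_pM2l// (lt_le_trans _ d3)// ltr_nat//.
  rewrite ltr_norml; apply/andP; split.
    by rewrite -cospi ltr_cos// ?in_itv/= ?(ltW pi0) ?(ltW x0) ?(ltW x1) ?lexx.
  by rewrite -[ltRHS]cos0 ltr_cos// ?in_itv/= ?(ltW pi0) ?(ltW x0) ?(ltW x1) ?lexx.
rewrite pmulr_lge0// in h1; rewrite nmulr_lge0// in h2.
by move: cn0; rewrite eq_le h1 h2.
Qed.

End marcinkiewicz.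

(** * Janson's theorem *)

(** Compactness gives a cluster point of the image, and an ultrafilter converges to its cluster
    points. *)
Lemma ultrafilter_cvg_bounded {R : realType} (U : set_system nat) (u : nat -> R) (B : R) :
  UltraFilter U -> U [set n | `|u n| <= B] ->
  exists l : R, u n @[n --> U] --> l.
Proof.
move=> UU UB; have FU : ProperFilter (u @ U) by exact: fmap_proper_filter.
have /(_ (u @ U) FU) := @segment_compact R (- B) B.
have : (u @ U) `[- B, B]%classic.
  change (U [set n | `[- B, B]%classic (u n)]).
  by apply: filterS UB => n un; rewrite /= in_itv /= -ler_norml.
move=> /[swap] /[apply] -[l [_ cl]]; exists l => A Al.
have [//|UnA] := in_ultra_setVsetC (u @^-1` A) UU.
have [x [nAx Ax]] := cl (~` A) A UnA Al.
by [].
Qed.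

(** If a neighbourhood of [l] were missed infinitely often, restricting the tail filter to the
    indices that miss it would give a proper filter, and an ultrafilter refining it contradicts the
    assumption. *)
Lemma cvg_ultrafilters {T : topologicalType} (u : nat -> T) (l : T) :
  (forall U, UltraFilter U -> \oo `<=` U -> u n @[n --> U] --> l) ->
  u n @[n --> \oo] --> l.
Proof.
move=> H A Al; apply: contrapT => nA.
have PF : ProperFilter (within (~` (u @^-1` A)) \oo).
  apply: Build_ProperFilter_ex => B wB; apply: contrapT => nB; apply: nA.
  move: wB; rewrite /within /=; apply: filterS => n nAB.
  apply: contrapT => nAn; apply: nB; exists n; exact: nAB.
have [U [UU sU]] := ultraFilterLemma PF.
have PU : ProperFilter U by exact: ultra_proper.
have UA : U (u @^-1` A).
  apply: H => // B FB; apply: sU; apply: cvg_within FB.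
have UnA : U (~` (u @^-1` A)) by apply: sU; exact: withinT.
have U0 : U set0 by rewrite -(setICr (u @^-1` A)); exact: filterI.
exact: (@filter_not_empty _ U _ U0).
Qed.

Fixpoint gauss_moment {R : pzSemiRingType} (k : nat) : R :=
  match k with
  | 0 => 1
  | 1 => 0
  | (k'.+1 as k'').+1 => k''%:R * gauss_moment k'
  end.

Section janson.
Context {R : realType}.
(* [kap n i] is the cumulant of order [i + 1]. *)
Variables (mo kap : nat -> nat -> R) (s : nat).
Hypothesis hankel : forall n K (h : nat -> R),
  0 <= \sum_(i < K) \sum_(j < K) h i * h j * mo n (i + j)%N.
Hypothesis interp : forall n k p (th : R), 0 < th -> ~~ odd p -> (k <= p)%N ->
  `|mo n k.+2| <= th ^+ k * (mo n 2 + mo n p.+2 / th ^+ p).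
Hypothesis rec : forall n k,
  mo n k.+1 = \sum_(i < k.+1) 'C(k, i)%:R * kap n i * mo n (k - i)%N.
Hypotheses (mo0 : forall n, mo n 0%N = 1) (mo1 : forall n, mo n 1%N = 0)
  (mo2 : forall n, mo n 2 = 1).
Hypothesis kap_cvg0 : forall i, (s <= i)%N -> kap n i @[n --> \oo] --> (0 : R).

Let kap0 n : kap n 0%N = 0.
Proof. by have := rec n 0; rewrite mo1 big_ord1 bin0 mul1r mo0 mulr1. Qed.

Let kapE n k : kap n k = mo n k.+1 - \sum_(i < k) 'C(k, i)%:R * kap n i * mo n (k - i)%N.
Proof. by rewrite rec big_ord_recr /= binn subnn mo0 mul1r mulr1 addrC addrK. Qed.

(** A moment of order [k + 2] counts as [th ^ k], the second moment being 1. *)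
Let scaled n p (th : R) := 1 <= th /\ forall k, (k <= p)%N -> `|mo n k.+2| <= 2 * th ^+ k.

(** A cumulant of order [l + 1] has weight [l - 1] and a moment of order [j] has weight [j - 2];
    powers of [th] on the left avoid negative exponents. The product has weight [l + j - 3], two
    less than a moment of order [l + j + 1]. For [j = 1] the moment vanishes. *)
Let term_le n p th (K : R) l j : scaled n p th -> (j <= p.+2)%N -> 0 <= K ->
  `|kap n l| * th <= K * th ^+ l -> (0 < j)%N ->
  `|kap n l * mo n j| * th ^+ 2 <= 2 * K * th ^+ (l + j).-1.
Proof.
move=> [th1 sc] jp K0 kl; have th0 : 0 <= th by exact: le_trans th1.
case: j jp => // -[|j] jp _.
  by rewrite mo1 mulr0 normr0 mul0r !mulr_ge0// exprn_ge0.
have jp' : (j <= p)%N by rewrite -2!ltnS.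
rewrite normrM !addnS /=.
rewrite (_ : _ * th ^+ 2 = (`|kap n l| * th) * (`|mo n j.+2| * th)); last by ring.
rewrite (_ : 2 * K * _ = K * th ^+ l * (2 * th ^+ j * th)); last by rewrite exprS exprD; ring.
apply: ler_pM => //; first by rewrite mulr_ge0.
  by rewrite mulr_ge0.
by rewrite ler_wpM2r// sc.
Qed.

(** When the recursion is solved for its top cumulant, each correction loses two powers of
    [th >= 1], so cumulants inherit the weights of the moments. The constants are chosen before [n],
    [p] and [th], which lets [th] vary with [n]. *)
Let kap_bound N : exists2 K : nat -> R, forall i, 0 <= K i &
  forall n p th i, (i < N)%N -> (i <= p.+1)%N -> scaled n p th ->
    `|kap n i| * th <= K i * th ^+ i.
Proof.
elim: N => [|N [K K0 IH]]; first by exists (fun=> 0).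
pose KN := 2 + \sum_(l < N) 'C(N, l)%:R * (2 * K l).
have KN0 : 0 <= KN.
  by rewrite addr_ge0// sumr_ge0// => l _; rewrite !mulr_ge0.
exists (fun i => if (i < N)%N then K i else KN) => [i|]; first by case: ifP.
move=> n p th i; rewrite ltnS leq_eqVlt => /predU1P[->{i}|iN] ip sc; last first.
  by rewrite iN; exact: (IH n p).
have [th1 scm] := sc; have th0 : 0 <= th by exact: le_trans th1.
rewrite ltnn; case: N IH @KN KN0 ip => [|N] IH KN KN0 ip.
  by rewrite kap0 normr0 mul0r mulr_ge0.
have Np : (N <= p)%N by [].
rewrite kapE.
have h1 : `|mo n N.+2| * th <= 2 * th ^+ N.+1.
  by rewrite exprS (mulrC th) mulrA ler_wpM2r// scm.
have h2 (l : 'I_N.+1) : `|'C(N.+1, l)%:R * kap n l * mo n (N.+1 - l)%N| * th <=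
    'C(N.+1, l)%:R * (2 * K l) * th ^+ N.+1.
  rewrite -mulrA normrM normr_nat -!mulrA ler_wpM2l//.
  have lN := ltn_ord l.
  have := @term_le n p th (K l) l (N.+1 - l)%N sc; rewrite subnKC ?(ltnW lN)//=.
  move=> /(_ (leq_trans (leq_subr _ _) (leqW ip)) (K0 l) (IH n p th l lN (leq_trans (ltnW lN) ip) sc)).
  rewrite subn_gt0 => /(_ lN) h.
  apply: (@le_trans _ _ (`|kap n l * mo n (N.+1 - l)%N| * th ^+ 2)).
    by rewrite ler_wpM2l// expr2 ler_peMr.
  apply: (le_trans h); rewrite mulrA ler_wpM2l ?mulr_ge0//.
  by rewrite exprS ler_peMl// exprn_ge0.
apply: (@le_trans _ _ ((`|mo n N.+2| + \sum_(l < N.+1)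
    `|'C(N.+1, l)%:R * kap n l * mo n (N.+1 - l)%N|) * th)).
  by rewrite ler_wpM2r// (le_trans (ler_normB _ _))// lerD2l ler_norm_sum.
rewrite mulrDl /KN mulrDl lerD// mulr_suml [leRHS]mulr_suml; exact: ler_sum.
Qed.

(** Let [th ^ p] be the moment of order [p + 2]. Interpolation makes the lower moments [scaled], so
    the products in the recursion for this moment are of order [th ^ (p - 2)]; the one term left is
    the cumulant of order [p + 2], which tends to 0. Hence [th ^ 2 <= 1 + M]. *)
Let mo_bounded k : exists B : R, \forall n \near \oo, `|mo n k| <= B.
Proof.
case: k => [|[|k]].
- by exists 1; apply: nearW => n; rewrite mo0 normr1.
- by exists 0; apply: nearW => n; rewrite mo1 normr0.
(* Even, for the interpolation inequality; at least [k]; and so large that [kap n p.+1] is one of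
   the vanishing cumulants. *)
pose p := (k + s + 1).*2.
have p2 : (2 <= p)%N by rewrite /p; lia.
have sp : (s <= p.+1)%N by rewrite /p; lia.
have kp : (k <= p)%N by rewrite /p; lia.
have op : ~~ odd p by rewrite odd_double.
have [K K0 KB] := kap_bound p.+1.
pose M := \sum_(l < p.+1) 'C(p.+1, l)%:R * (2 * K l).
have M0 : 0 <= M by rewrite sumr_ge0// => l _; rewrite !mulr_ge0.
exists (2 * (1 + M) ^+ k).
have near1 : \forall n \near \oo, `|kap n p.+1| <= 1.
  have /cvgrPdist_le /(_ 1 ltr01) := kap_cvg0 sp.
  by apply: filterS => n; rewrite sub0r normrN.
apply: filterS near1 => n kn.
have [mle1|mgt1] := leP (mo n p.+2) 1.
  have := @interp n k p 1 ltr01 op kp; rewrite !expr1n mo2 divr1 mul1r => h.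
  rewrite (le_trans h)// (@le_trans _ _ 2)//; first by lra.
  by rewrite ler_peMr// exprn_ege1// lerDl.
have m0 : 0 < mo n p.+2 by exact: lt_trans mgt1.
pose th := mo n p.+2 `^ p%:R^-1.
have thp : th ^+ p = mo n p.+2.
  rewrite -powR_mulrn ?powR_ge0// -powRrM mulVf ?powRr1 ?(ltW m0)//.
  by rewrite pnatr_eq0 -lt0n (leq_trans _ p2).
have th0 : 0 <= th by exact: powR_ge0.
have th1 : 1 <= th.
  rewrite leNgt; apply/negP => t1.
  have : th ^+ p < 1 by rewrite exprn_ilt1// -lt0n (leq_trans _ p2).
  by rewrite thp ltNge (ltW mgt1).
have thgt0 : 0 < th by exact: lt_le_trans th1.
have sc : scaled n p th.
  split=> // j jp; rewrite (le_trans (interp n thgt0 op jp))//.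
  by rewrite mo2 -thp divff ?expf_neq0 ?gt_eqF// mulrC.
have mle : mo n p.+2 * th ^+ 2 <= (1 + M) * th ^+ p.
  rewrite rec big_ord_recr /= binn subnn mo0 mul1r mulr1 mulrDl mulrDl addrC lerD//.
    rewrite mul1r (@le_trans _ _ (th ^+ 2))//; last by rewrite ler_weXn2l.
    by rewrite ler_piMl ?exprn_ge0// (le_trans (ler_norm _)).
  rewrite mulr_suml /M mulr_suml; apply: ler_sum => l _.
  rewrite -!mulrA ler_wpM2l// mulrA.
  have lp := ltn_ord l.
  have := @term_le n p th (K l) l (p.+1 - l)%N sc; rewrite subnKC ?(ltnW lp)//=.
  move=> /(_ (leq_trans (leq_subr _ _) (leqnSn _)) (K0 l) (KB n p th l lp (ltnW lp) sc)).
  rewrite subn_gt0 mulrA => /(_ lp); apply: le_trans.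
  by rewrite ler_wpM2r ?exprn_ge0// ler_norm.
have th2 : th ^+ 2 <= 1 + M.
  by move: mle; rewrite -thp mulrC ler_pM2r// exprn_gt0.
have thM : th <= 1 + M.
  by apply: le_trans th2; rewrite expr2 ler_peMr.
by rewrite (le_trans (sc.2 k kp))// ler_wpM2l// lerXn2r// nnegrE addr_ge0.
Qed.

(** Along an ultrafilter all moments converge at once and, by solving the recursion, all cumulants
    too. [marcinkiewicz] leaves those of orders one and two, equal to 0 and 1 by normalization, and
    the recursion becomes that of [gauss_moment]. As this limit is the same for every ultrafilter,
    the sequence itself converges. *)
Lemma janson k : mo n k @[n --> \oo] --> (gauss_moment k : R).
Proof.
move: k.
suff H U : UltraFilter U -> \oo `<=` U -> forall k,
    mo n k @[n --> U] --> (gauss_moment k : R).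
  by move=> k; apply: cvg_ultrafilters => U UU sU; exact: H.
move=> UU sU.
have PU : ProperFilter U by exact: ultra_proper.
have moU k : exists l : R, mo n k @[n --> U] --> l.
  have [B nB] := mo_bounded k.
  exact: (ultrafilter_cvg_bounded UU (sU _ nB)).
have [m mP] := choice moU.
have sum_cvg N (F : nat -> nat -> R) (L : nat -> R) :
    (forall i, (i < N)%N -> F i n @[n --> U] --> L i) ->
    \sum_(i < N) F i n @[n --> U] --> \sum_(i < N) L i.
  elim: N => [|N IH] FL.
    rewrite big_ord0 (_ : (fun _ => _) = cst 0); first exact: cvg_cst.
    by apply/funext => n; rewrite big_ord0.
  rewrite big_ord_recr /= (_ : (fun _ => _) = (fun n => \sum_(i < N) F i n + F N n)).
    by apply: cvgD; [apply: IH => i iN; apply: FL; exact: ltnW|exact: FL].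
  by apply/funext => n; rewrite big_ord_recr.
have kapU k : exists l : R, kap n k @[n --> U] --> l.
  have [N] := ubnP k; elim: N k => // N IH k kN.
  have /choice[L LP] : forall i, exists l : R, (i < k)%N -> kap n i @[n --> U] --> l.
    move=> i; case: (ltnP i k) => ik; last by exists 0.
    by have [l lP] := IH i (leq_trans ik kN); exists l.
  exists (m k.+1 - \sum_(i < k) 'C(k, i)%:R * L i * m (k - i)%N).
  rewrite (_ : (fun n => kap n k) = (fun n => mo n k.+1 -
     \sum_(i < k) 'C(k, i)%:R * kap n i * mo n (k - i)%N)); last first.
    by apply/funext => n; rewrite kapE.
  apply: cvgB => //.
  apply: (sum_cvg k (fun i n => 'C(k, i)%:R * kap n i * mo n (k - i)%N)
     (fun i => 'C(k, i)%:R * L i * m (k - i)%N)) => i ik.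
  by apply: cvgM => //; apply: cvgMr; exact: LP.
have [ka kaP] := choice kapU.
have recU k : m k.+1 = \sum_(i < k.+1) 'C(k, i)%:R * ka i * m (k - i)%N.
  apply: (cvg_unique _ (mP k.+1)) => //.
  rewrite (_ : (fun n => mo n k.+1) = (fun n =>
     \sum_(i < k.+1) 'C(k, i)%:R * kap n i * mo n (k - i)%N)); last by apply/funext.
  apply: (sum_cvg k.+1 (fun i n => 'C(k, i)%:R * kap n i * mo n (k - i)%N)
     (fun i => 'C(k, i)%:R * ka i * m (k - i)%N)) => i ik.
  by apply: cvgM => //; exact: cvgMr.
have cstU (u : nat -> R) (l c : R) : u n @[n --> U] --> l -> (forall n, u n = c) -> l = c.
  move=> ul uc; apply: (cvg_unique _ ul) => //.
  by rewrite (_ : (fun n => u n) = cst c); [exact: cvg_cst|exact/funext].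
have m0 : m 0%N = 1 by apply: cstU (mP 0%N) _.
have m1 : m 1%N = 0 by apply: cstU (mP 1%N) _.
have m2 : m 2 = 1 by apply: cstU (mP 2) _.
have ka_supp i : (s <= i)%N -> ka i = 0.
  move=> si; apply: (cvg_unique _ (kaP i)) => //.
  by apply: cvg_trans (kap_cvg0 si); exact: cvg_app.
have hankelU K (h : nat -> R) : 0 <= \sum_(i < K) \sum_(j < K) h i * h j * m (i + j)%N.
  have C : \sum_(i < K) \sum_(j < K) h i * h j * mo n (i + j)%N @[n --> U] -->
      \sum_(i < K) \sum_(j < K) h i * h j * m (i + j)%N.
    apply: (sum_cvg K (fun i n => \sum_(j < K) h i * h j * mo n (i + j)%N)
      (fun i => \sum_(j < K) h i * h j * m (i + j)%N)) => i _.
    apply: (sum_cvg K (fun j n => h i * h j * mo n (i + j)%N)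
      (fun j => h i * h j * m (i + j)%N)) => j _.
    exact: cvgMr.
  rewrite -(cvg_lim _ C)//; apply: limr_ge; first by apply/cvg_ex; eexists; exact: C.
  by apply: nearW => n; exact: hankel.
have ka2 i : (2 <= i)%N -> ka i = 0 by exact: (marcinkiewicz hankelU recU ka_supp m0).
have ka0 : ka 0%N = 0.
  by have := recU 0%N; rewrite m1 big_ord1 bin0 mul1r m0 mulr1.
have ka1 : ka 1%N = 1.
  have := recU 1%N; rewrite m2 big_ord_recr big_ord1 /= ka0 mulr0 mul0r add0r.
  by rewrite binn mul1r m0 mulr1.
have mE k : m k.+2 = k.+1%:R * m k.
  rewrite recU 2!big_ord_recl /= ka0 mulr0 mul0r add0r big1 ?addr0; last first.
    by move=> i _; rewrite ka2 ?mulr0 ?mul0r.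
  by rewrite /bump /= addn0 bin1 ka1 mulr1 subSS subn0.
have gE k : m k = gauss_moment k /\ m k.+1 = gauss_moment k.+1.
  by elim: k => [//|k [IH1 IH2]]; split=> //; rewrite mE IH1.
by move=> k; have [<- _] := gE k; exact: mP.
Qed.

End janson.

(** * Moments of the normal law *)

Section normal_moments.
Context {R : realType}.
Local Notation mu := (@lebesgue_measure R).
Local Notation gamma := (normal_prob (0 : R) 1).
Local Notation phi := (@normal_pdf R 0 1).

Let phiE (x : R) : phi x = normal_peak 1 * expR (- (x ^+ 2 / 2)).
Proof. by rewrite normal_pdfE ?oner_eq0// /normal_fun subr0 expr1n mulNr. Qed.

Let phi_ge0 x : 0 <= phi x.
Proof. exact: normal_pdf_ge0. Qed.

Let mphi : measurable_fun [set: R] phi.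
Proof. exact: measurable_normal_pdf. Qed.

(** The change of variables involves an abstract Radon-Nikodym derivative, which agrees almost
    everywhere with the explicit density because both have the same integrals over measurable
    sets. *)
Lemma ge0_integral_normal (f : R -> \bar R) : measurable_fun [set: R] f ->
  (forall x, 0 <= f x)%E ->
  (\int[gamma]_x f x = \int[mu]_x (f x * (phi x)%:E))%E.
Proof.
move=> mf f0; have dom := @normal_prob_dominates R 0 1.
rewrite -(Radon_Nikodym_SigmaFinite.change_of_variables dom f0 measurableT mf).
have RNi := Radon_Nikodym_SigmaFinite.f_integrable dom.
have mEphi : measurable_fun [set: R] (EFin \o phi) by exact/measurable_EFinP.
apply: ae_eq_integral => //.
- by apply: emeasurable_funM => //; exact: measurable_int RNi.
- exact: emeasurable_funM.
have RNphi : ae_eq mu setT (Radon_Nikodym_SigmaFinite.f gamma mu) (EFin \o phi).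
  apply: integral_ae_eq => // E _ mE.
  by rewrite -Radon_Nikodym_SigmaFinite.f_integral.
by move: RNphi; apply: filterS => x h _; rewrite h.
Qed.

(** For [|x| > 1] the power is at most [(x ^ 2) ^ k], and the inequality [u <= expR u] at
    [u = x ^ 2 / (4 k)] is raised to the power [k]. For [|x| <= 1] the summand 1 suffices. *)
Lemma exprn_le_expR (x : R) k : `|x| ^+ k <= (1 + (4 * k%:R) ^+ k) * expR (x ^+ 2 / 4).
Proof.
have e1 : 1 <= expR (x ^+ 2 / 4) by rewrite -expR0 ler_expR divr_ge0// sqr_ge0.
have c0 : 0 <= (4 * k%:R) ^+ k :> R by rewrite exprn_ge0.
have [x1|x1] := leP `|x| 1.
  rewrite (@le_trans _ _ 1)// ?exprn_ile1//.
  by rewrite -[leLHS]mulr1 ler_pM// lerDl.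
apply: (@le_trans _ _ ((4 * k%:R) ^+ k * expR (x ^+ 2 / 4))); last first.
  by rewrite ler_wpM2r ?expR_ge0// lerDr.
case: k {c0} => [|k]; first by rewrite !expr0 mul1r.
have k0 : 0 < k.+1%:R :> R by rewrite ltr0n.
have h : x ^+ 2 / 4 / k.+1%:R <= expR (x ^+ 2 / 4 / k.+1%:R).
  by rewrite (le_trans _ (expR_ge1Dx _))// lerDr.
apply: (@le_trans _ _ ((x ^+ 2) ^+ k.+1)).
  by rewrite lerXn2r ?nnegrE ?sqr_ge0// -real_normK ?num_real// expr2 ler_peMr// ltW.
have -> : x ^+ 2 = (4 * k.+1%:R) * (x ^+ 2 / 4 / k.+1%:R) by field; rewrite gt_eqF.
rewrite exprMn; have -> : 4 * k.+1%:R * (x ^+ 2 / 4 / k.+1%:R) / 4 = x ^+ 2 / 4 by field; rewrite gt_eqF.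
rewrite ler_wpM2l ?exprn_ge0 ?mulr_ge0//.
have -> : expR (x ^+ 2 / 4) = expR (x ^+ 2 / 4 / k.+1%:R) ^+ k.+1.
  by rewrite -expRM_natl; congr expR; field; rewrite gt_eqF.
by rewrite lerXn2r ?nnegrE ?expR_ge0// !divr_ge0// sqr_ge0.
Qed.

Let phi_decay k : exists2 C : R, 0 <= C &
  forall x, `|x| ^+ k * phi x <= C * expR (- (x ^+ 2 / 4)).
Proof.
exists ((1 + (4 * k%:R) ^+ k) * normal_peak 1).
  by rewrite mulr_ge0 ?normal_peak_ge0// addr_ge0// exprn_ge0.
move=> x; rewrite phiE.
have -> : expR (- (x ^+ 2 / 2)) = expR (- (x ^+ 2 / 4)) * expR (- (x ^+ 2 / 4)).
  by rewrite -expRD; congr expR; field.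
rewrite (_ : _ * _ = `|x| ^+ k * expR (- (x ^+ 2 / 4)) * (normal_peak 1 * expR (- (x ^+ 2 / 4)))); last by ring.
rewrite -[leRHS]mulrA ler_wpM2r ?mulr_ge0 ?normal_peak_ge0 ?expR_ge0//.
by rewrite expRN ler_pdivrMr ?expR_gt0// exprn_le_expR.
Qed.

Lemma integrable_exprn_pdf k : mu.-integrable [set: R] (EFin \o (fun x => x ^+ k * phi x)).
Proof.
have [C C0 bd] := phi_decay k.
(* Half of the Gaussian exponent has absorbed the power; the other half, [x ^ 2 / 4], is that of the
   normal density with variance 2. *)
have s0 : Num.sqrt 2 != 0 :> R by rewrite gt_eqF// sqrtr_gt0.
have i2 : mu.-integrable [set: R] (fun x => ((C / normal_peak (Num.sqrt 2)) * normal_pdf 0 (Num.sqrt 2) x)%:E).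
  under eq_fun do rewrite EFinM; apply: integrableZl => //.
  exact: integrable_normal_pdf.
apply: le_integrable i2 => //.
  by apply/measurable_EFinP; apply: measurable_funM => //; exact: measurable_funX.
move=> x _ /=; rewrite lee_fin normrM normrX (ger0_norm (phi_ge0 x)).
have p0 : 0 < normal_peak (Num.sqrt 2) :> R by exact: normal_peak_gt0.
rewrite (le_trans (bd x))// normal_pdfE// /normal_fun subr0 sqr_sqrtr//.
rewrite ger0_norm; last first.
  by rewrite !mulr_ge0 ?invr_ge0 ?(ltW p0) ?expR_ge0.
rewrite mulrA divfK ?gt_eqF// mulNr ler_wpM2l// ler_expR lerN2.
by rewrite le_eqVlt; apply/orP; left; apply/eqP; field.
Qed.

Let funepos_exprn k (x : R) : (funepos (EFin \o (fun x : R => (x ^+ k)%R)) x * (phi x)%:E =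
  (Num.max (x ^+ k * phi x)%R 0%R)%:E)%E.
Proof.
rewrite funepos.unlock /= -EFin_max -EFinM; congr EFin.
by rewrite maxr_pMl// mul0r.
Qed.

Let funeneg_exprn k (x : R) : (funeneg (EFin \o (fun x : R => (x ^+ k)%R)) x * (phi x)%:E =
  (Num.max (- (x ^+ k * phi x))%R 0%R)%:E)%E.
Proof.
rewrite funeneg.unlock /= -EFin_max -EFinM; congr EFin.
by rewrite maxr_pMl// mul0r mulNr.
Qed.

Lemma integral_normal_exprn k :
  (\int[gamma]_x (x ^+ k)%:E = \int[mu]_x (x ^+ k * phi x)%:E)%E.
Proof.
have mX : measurable_fun [set: R] (EFin \o (fun x : R => x ^+ k)).
  by apply/measurable_EFinP; exact: measurable_funX.
rewrite [LHS]integralE [RHS]integralE; congr (_ - _)%E.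
  rewrite ge0_integral_normal//; last exact: measurable_funepos.
  by apply: eq_integral => x _; rewrite funepos_exprn funepos.unlock -EFin_max.
rewrite ge0_integral_normal//; last exact: measurable_funeneg.
by apply: eq_integral => x _; rewrite funeneg_exprn funeneg.unlock -EFin_max.
Qed.

Lemma integrable_normal_exprn k : gamma.-integrable [set: R] (EFin \o (fun x => x ^+ k)).
Proof.
have mX : measurable_fun [set: R] (EFin \o (fun x : R => x ^+ k)).
  by apply/measurable_EFinP; exact: measurable_funX.
apply/integrableP; split => //.
rewrite ge0_integral_normal//; last exact: measurableT_comp.
have /integrableP[_] := integrable_exprn_pdf k.
by under eq_integral do rewrite /= normrM (ger0_norm (phi_ge0 _)) EFinM.
Qed.

Let is_derive_phi (x : R) : is_derive x (1 : R) phi (- x * phi x).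
Proof.
rewrite (_ : phi = (fun x => normal_peak 1 * expR (- (x ^+ 2 / 2)))); last by apply/funext.
have d1 : is_derive x (1 : R) (fun x : R => - (x ^+ 2 / 2)) (- x).
  by apply: is_derive_eq; rewrite /GRing.scale /=; field.
have d2 : is_derive x (1 : R) (expR \o (fun x : R => - (x ^+ 2 / 2)))
    (expR (- (x ^+ 2 / 2)) * - x) by exact: is_derive1_comp.
apply: (is_derive_eq (is_deriveZ (normal_peak 1) d2)).
by rewrite /GRing.scale /=; ring.
Qed.

Let is_derive_antideriv k (x : R) : is_derive x (1 : R) (fun x => - (x ^+ k.+1 * phi x))
  (x ^+ k.+2 * phi x - k.+1%:R * (x ^+ k * phi x)).
Proof.
have dX : is_derive x (1 : R) (fun x : R => x ^+ k.+1) (k.+1%:R * x ^+ k).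
  rewrite (_ : (fun x : R => _) = id ^+ k.+1); last by apply/funext => y; rewrite fctE.
  apply: (is_derive_eq (@is_deriveX _ _ id k.+1 x 1 1 (is_derive_id x 1))).
  by rewrite /GRing.scale /= mulr1.
apply: (is_derive_eq (is_deriveN (is_deriveM dX (is_derive_phi x)))).
by rewrite /GRing.scale /= !exprS; ring.
Qed.

Let antideriv_decay k : exists C : R,
  forall x : R, 1 <= `|x| -> `|- (x ^+ k * phi x)| <= C / `|x|.
Proof.
have [C C0 bd] := phi_decay k; exists (4 * C) => x x1.
have x0 : 0 < `|x| by exact: lt_le_trans x1.
rewrite normrN normrM normrX (ger0_norm (phi_ge0 x)) (le_trans (bd x))//.
rewrite [leRHS](_ : _ = C * (`|x| / 4)^-1); last by field; rewrite gt_eqF.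
rewrite ler_wpM2l// expRN lef_pV2 ?posrE ?expR_gt0 ?divr_gt0// (le_trans _ (expR_ge1Dx _))//.
rewrite -real_normK ?num_real// expr2.
have h : `|x| <= `|x| * `|x| by rewrite ler_peMl// ltW.
lra.
Qed.

(** The fundamental theorem of calculus on growing symmetric intervals: the decay of [g] removes the
    boundary terms, and dominated convergence gives the integral over the line. *)
Lemma integral_derive_eq0 (f g : R -> R) (C : R) : continuous f ->
  (forall x, is_derive x (1 : R) g (f x)) -> mu.-integrable setT (EFin \o f) ->
  (forall x, 1 <= `|x| -> `|g x| <= C / `|x|) -> \int[mu]_x f x = 0.
Proof.
move=> cf isd fi gb.
have intE n : (\int[mu]_(x in `[(- n.+1%:R)%R, n.+1%:R%R]) (f x)%:E = (g n.+1%:R - g (- n.+1%:R))%R%:E)%E.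
  have n0 : - n.+1%:R < n.+1%:R :> R by rewrite gtrN.
  have dg x : derivable g x 1 by have := isd x.
  rewrite (@continuous_FTC2 _ f g)//.
  - exact: continuous_subspaceT.
  - split=> //.
    + by apply: cvg_at_right_filter; apply: differentiable_continuous; exact/derivable1_diffP.
    + by apply: cvg_at_left_filter; apply: differentiable_continuous; exact/derivable1_diffP.
  - by move=> x _; rewrite derive1E; have dd := isd x; rewrite derive_val.
have mf : measurable_fun [set: R] (EFin \o f) by exact: measurable_int fi.
have lim1 : (\int[mu]_(x in `[(- n.+1%:R)%R, n.+1%:R%R]) (f x)%:E @[n --> \oo] --> \int[mu]_x (f x)%:E)%E.
  under eq_fun do rewrite integral_mkcond.
  have [|||||_ _] := @dominated_convergence _ _ _ mu setT measurableT
    (fun n => (EFin \o f) \_ `[- n.+1%:R, n.+1%:R]) (EFin \o f) (fun x => `|(f x)%:E|%E).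
  - move=> n; apply/(measurable_restrictT _ _).1 => //; last exact: measurable_funTS.
  - exact: mf.
  - apply: aeW => x _; apply: cvg_near_cst.
    exists (Num.bound x) => // n /= nx; rewrite patchE mem_set//=.
    have xn : `|x| <= n.+1%:R.
      rewrite (le_trans (ltW (archi_boundP (normr_ge0 x))))//.
      by rewrite ler_nat (leq_trans _ (leqnSn _))// (leq_trans _ nx)// /Num.bound/= normr_id.
    by rewrite in_itv /= -ler_norml.
  - exact: integrable_abse.
  - apply: aeW => x n _; rewrite patchE; case: ifP => //= _.
    by rewrite normr0 lee_fin.
  - exact.
have lim2 : ((g n.+1%:R - g (- n.+1%:R))%R%:E @[n --> \oo] --> (0 : R)%:E)%E.
  apply: cvg_EFin; first by apply: nearW.
  have h : forall n, `|g n.+1%:R - g (- n.+1%:R)| <= 2 * C * harmonic n.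
    move=> n; have n1 : 1 <= `|n.+1%:R| :> R by rewrite normr_nat ler1n.
    rewrite (le_trans (ler_normB _ _))//.
    have := gb _ n1; have := gb (- n.+1%:R); rewrite normrN => /(_ n1).
    rewrite normr_nat /harmonic /= => h1 h2.
    by rewrite -mulrA mulr_natl mulr2n lerD.
  apply/cvgr0Pnorm_le => e e0.
  have hc : 2 * C * harmonic n @[n --> \oo] --> (0 : R).
    by rewrite -(mulr0 (2 * C)); apply: cvgMr; exact: cvg_harmonic.
  have /cvgr0Pnorm_le /(_ e e0) := hc; apply: filterS => n hn.
  by rewrite (le_trans (h n))// (le_trans _ hn)// ler_norm.
have intf : (\int[mu]_x (f x)%:E = 0)%E.
  rewrite (funext intE) in lim1.
  by apply: (cvg_unique _ lim1 lim2); exact: ereal_hausdorff.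
by rewrite /Rintegral intf.
Qed.

(** Integration by parts: the difference of the two integrands has the decaying primitive
    [- x ^ (k + 1) * phi x]. *)
Lemma normal_moment_rec k :
  \int[mu]_x (x ^+ k.+2 * phi x) = k.+1%:R * \int[mu]_x (x ^+ k * phi x).
Proof.
pose f x : R := x ^+ k.+2 * phi x - k.+1%:R * (x ^+ k * phi x).
have i1 := integrable_exprn_pdf k.+2; have i2 := integrable_exprn_pdf k.
have i2' := integrable_EFinZ k.+1%:R i2.
have fi : mu.-integrable setT (EFin \o f).
  rewrite (_ : _ \o f = (fun x => (x ^+ k.+2 * phi x)%:E - (k.+1%:R * (x ^+ k * phi x))%:E)%E).
    exact: integrableB.
  by apply/funext => x; rewrite /= EFinB.
apply/eqP; rewrite -subr_eq0 -RintegralZl// -RintegralB//; apply/eqP.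
have [C bd] := antideriv_decay k.+1.
apply: (@integral_derive_eq0 _ (fun x => - (x ^+ k.+1 * phi x)) C) => //.
by move=> x; apply: cvgB; [|apply: cvgMr]; apply: cvgM; (exact: exprn_continuous || exact: continuous_normal_pdf).
Qed.

Lemma normal_moment k : (\int[gamma]_x (x ^+ k)%:E = (gauss_moment k)%:E)%E.
Proof.
have fin j : (\int[mu]_x (x ^+ j * phi x)%:E)%E \is a fin_num.
  by apply: integrable_fin_num => //; exact: integrable_exprn_pdf.
rewrite integral_normal_exprn -[LHS]fineK//; congr EFin.
rewrite -[LHS]/(\int[mu]_x (x ^+ k * phi x)).
have h0 : \int[mu]_x (x ^+ 0 * phi x) = 1.
  rewrite /Rintegral; under eq_integral do rewrite expr0 mul1r.
  by rewrite integral_normal_pdf.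
have h1 : \int[mu]_x (x ^+ 1 * phi x) = 0.
  have [C bd] := antideriv_decay 0.
  apply: (@integral_derive_eq0 _ (fun x => - (x ^+ 0 * phi x)) C) => //.
  - by move=> x; apply: cvgM; (exact: exprn_continuous || exact: continuous_normal_pdf).
  - move=> x; under eq_fun do rewrite expr0 mul1r.
    apply: (is_derive_eq (is_deriveN (is_derive_phi x))).
    by rewrite expr1 mulNr opprK.
  - exact: integrable_exprn_pdf.
suff [//] : \int[mu]_x (x ^+ k * phi x) = gauss_moment k /\
    \int[mu]_x (x ^+ k.+1 * phi x) = gauss_moment k.+1.
elim: k => [//|k [IH1 IH2]]; split => //.
by rewrite normal_moment_rec IH1.
Qed.

End normal_moments.

(** * From moments to distribution functions *)

Section taylor.
Context {R : realType}.

Lemma derive_lower (f df : R -> R) (y : R) : 0 <= y ->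
  (forall x, is_derive x (1 : R) f (df x)) -> (forall x, 0 <= x -> 0 <= df x) ->
  f 0 <= f y.
Proof.
rewrite le_eqVlt => /predU1P[<-//|y0] fd df0.
have cf : {within `[0, y], continuous f}.
  apply: continuous_subspaceT => x; apply: differentiable_continuous.
  by apply/derivable1_diffP; have := fd x.
have [c /[!in_itv]/= /andP[c0 _] E] := MVT y0 (fun x _ => fd x) cf.
by rewrite -subr_ge0 E mulr_ge0 ?subr0 ?df0// ltW.
Qed.

Let tpoly (a : nat -> R) k (y : R) := \sum_(i < k) a i * y ^+ i / i`!%:R.

Let is_derive_mono (c : R) i (x : R) :
  is_derive x (1 : R) (fun y => c * y ^+ i.+1 / (i.+1)`!%:R) (c * x ^+ i / i`!%:R).
Proof.
rewrite (_ : (fun y => _) = (c / (i.+1)`!%:R) \*: (id ^+ i.+1)); last first.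
  by apply/funext => y; rewrite /= !fctE /GRing.scale /= mulrAC.
apply: (is_derive_eq (is_deriveZ _ (@is_deriveX _ _ id i.+1 x 1 1 (is_derive_id x 1)))).
rewrite /GRing.scale /= mulr1 factS natrM.
have i0 : i`!%:R != 0 :> R by rewrite pnatr_eq0 -lt0n fact_gt0.
by field; rewrite i0 addrC natr1 pnatr_eq0.
Qed.

Let is_derive_tpoly a k (x : R) :
  is_derive x (1 : R) (tpoly a k.+1) (tpoly (a \o S) k x).
Proof.
have E : tpoly a k.+1 = (fun y => a 0%N + (\sum_(i < k) (fun y => a i.+1 * y ^+ i.+1 / (i.+1)`!%:R)) y).
  apply/funext => y; rewrite /tpoly big_ord_recl expr0 mulr1 fact0 divr1.
  by rewrite fct_sumE.
rewrite E; apply: (is_derive_eq (is_deriveD (is_derive_cst (a 0%N) x 1)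
  (is_derive_sum (fun i : 'I_k => is_derive_mono (a i.+1) i x)))).
by rewrite add0r.
Qed.

Let tpoly0 a k : tpoly a k.+1 0 = a 0%N.
Proof.
rewrite /tpoly big_ord_recl expr0 mulr1 fact0 divr1 big1 ?addr0// => i _.
by rewrite expr0n mulr0 mul0r.
Qed.

(** Induction over all sequences of successive derivatives. The derivative of the remainder is the
    remainder of the shifted sequence, so the bound plus or minus the remainder vanishes at 0 and is
    nondecreasing on the positive half-line. *)
Let taylor_nneg k : forall D : nat -> R -> R,
  (forall i x, is_derive x (1 : R) (D i) (D i.+1 x)) ->
  (forall i x, `|D i x| <= 1) -> forall y, 0 <= y ->
  `|D 0%N y - tpoly (D^~ 0) k y| <= y ^+ k / k`!%:R.
Proof.
elim: k => [|k IH] D dD bD y y0.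
  by rewrite /tpoly big_ord0 subr0 expr0 fact0 divr1.
have IH' x : 0 <= x -> `|D 1%N x - tpoly (fun i => D i.+1 0) k x| <= x ^+ k / k`!%:R.
  by move=> x0; exact: (IH (fun i => D i.+1)).
have dr x : is_derive x (1 : R) (fun y => D 0%N y - tpoly (D^~ 0) k.+1 y)
    (D 1%N x - tpoly (fun i => D i.+1 0) k x).
  by apply: is_deriveB; exact: is_derive_tpoly.
have dm x : is_derive x (1 : R) (fun y => y ^+ k.+1 / (k.+1)`!%:R) (x ^+ k / k`!%:R).
  have := is_derive_mono 1 k x; rewrite mul1r.
  by under eq_fun do rewrite mul1r.
have z0 : D 0%N 0 - tpoly (D^~ 0) k.+1 0 = 0 by rewrite tpoly0 subrr.
rewrite ler_norml -subr_ge0 opprK -[X in _ && X]subr_ge0; apply/andP; split.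
- have h := derive_lower y0 (fun x => is_deriveD (dr x) (dm x)).
  rewrite (le_trans _ (h _))//=; first by rewrite !fctE z0 expr0n mul0r addr0.
  by move=> x x0; have := IH' x x0; rewrite ler_norml => /andP[+ _]; rewrite -subr_ge0 opprK.
- have h := derive_lower y0 (fun x => is_deriveB (dm x) (dr x)).
  rewrite (le_trans _ (h _))//=; first by rewrite !fctE z0 expr0n mul0r subr0.
  by move=> x x0; have := IH' x x0; rewrite ler_norml => /andP[_ +]; rewrite -subr_ge0.
Qed.

Lemma taylor_bounded_derivatives (D : nat -> R -> R) k y :
  (forall i x, is_derive x (1 : R) (D i) (D i.+1 x)) ->
  (forall i x, `|D i x| <= 1) ->
  `|D 0%N y - \sum_(i < k) D i 0 * y ^+ i / i`!%:R| <= `|y| ^+ k / k`!%:R.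
Proof.
move=> dD bD; have [y0|y0] := leP 0 y.
  by rewrite (ger0_norm y0); exact: taylor_nneg.
have Ny : 0 <= - y by rewrite oppr_ge0 ltW.
(* Negative arguments are reduced to positive ones by reflection, which multiplies the [i]-th
   derivative by [(-1) ^ i]. *)
have := @taylor_nneg k (fun i x => (-1) ^+ i * D i (- x)) _ _ _ Ny.
rewrite /= expr0 mul1r opprK (ltr0_norm y0) => H.
rewrite /tpoly in H.
under eq_bigr => i _.
  rewrite (_ : _ / _ = (-1) ^+ i * D i (- 0) * (- y) ^+ i / i`!%:R); last first.
    rewrite oppr0 [(- y) ^+ i]exprNn mulrACA -[_ ^+ i * _ ^+ i]exprMn mulrNN mulr1 expr1n mul1r//.
  over.
apply: H => [i x|i x]; last by rewrite normrM normrX normrN normr1 expr1n mul1r.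
have dN : is_derive x (1 : R) (D i \o -%R) (D i.+1 (- x) * -1) by exact: is_derive1_comp.
apply: (is_derive_eq (is_deriveZ ((-1) ^+ i) dN)).
by rewrite /GRing.scale /= exprS; ring.
Qed.

Lemma taylor_cos (th y : R) k : `|cos (y + th) -
    \sum_(i < k) cos (th + i%:R * (pi / 2)) * y ^+ i / i`!%:R| <= `|y| ^+ k / k`!%:R.
Proof.
(* Differentiating a cosine advances its phase by [pi / 2]. *)
pose D i x : R := cos (x + (th + i%:R * (pi / 2))).
have := @taylor_bounded_derivatives D k y.
have -> : D 0%N y = cos (y + th) by rewrite /D mul0r addr0.
move=> H.
under eq_bigr do rewrite -[th + _]add0r.
apply: H => [i x|i x]; last by rewrite ler_norml cos_geN1 cos_le1.
have d1 : is_derive x (1 : R) (fun x => x + (th + i%:R * (pi / 2))) 1.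
  by apply: is_derive_eq; rewrite addr0.
have d2 : is_derive x (1 : R) (cos \o (fun x => x + (th + i%:R * (pi / 2))))
  (- sin (x + (th + i%:R * (pi / 2))) * 1) by exact: is_derive1_comp.
apply: (is_derive_eq d2); rewrite mulr1 /D -cosDpihalf -natr1; congr cos; ring.
Qed.

End taylor.

(** * Trigonometric approximation of a half-line *)

Section step_polynomial.
Context {R : realType}.

Lemma bernoulli (x : R) n : -1 <= x -> 1 + n%:R * x <= (1 + x) ^+ n.
Proof.
move=> x1; have x0 : 0 <= 1 + x by rewrite -lerBlDl add0r.
elim: n => [|n IH]; first by rewrite mul0r addr0.
rewrite exprS (le_trans _ (ler_wpM2l x0 IH))// -natr1.
rewrite -subr_ge0 (_ : _ - _ = n%:R * x ^+ 2); last by ring.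
by rewrite mulr_ge0// sqr_ge0.
Qed.

(* Bernoulli's inequality makes these polynomials converge on the unit interval
   to the indicator of [v < 1/2]. *)
Definition step_poly n (v : R) : R := (1 - v ^+ n) ^+ (2 ^ n).

Lemma step_poly_itv n (v : R) : 0 <= v <= 1 -> 0 <= step_poly n v <= 1.
Proof.
move=> /andP[v0 v1]; have vn : v ^+ n <= 1 by rewrite exprn_ile1.
by rewrite exprn_ge0 ?subr_ge0// exprn_ile1 ?subr_ge0// gerBl exprn_ge0.
Qed.

Lemma step_poly_ge n (v s : R) : 0 <= v <= s -> v <= 1 ->
  1 - (2 * s) ^+ n <= step_poly n v.
Proof.
move=> /andP[v0 vs] v1.
have vn : v ^+ n <= 1 by rewrite exprn_ile1.
have h := @bernoulli (- v ^+ n) (2 ^ n) _.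
rewrite (le_trans _ (h _)) ?lerN2// natrX mulrN -exprMn lerD2l lerN2.
by rewrite lerXn2r ?nnegrE ?mulr_ge0 ?(le_trans v0 vs)// ler_wpM2l.
Qed.

(** The product of [1 - v ^ n] and [1 + v ^ n] is at most 1, also after raising to the power
    [2 ^ n], and Bernoulli's inequality bounds that power of the second factor below by
    [2 ^ n * v ^ n]. *)
Lemma step_poly_le n (v s : R) : 0 < s -> s <= v <= 1 ->
  step_poly n v <= ((2 * s) ^+ n)^-1.
Proof.
move=> s0 /andP[sv v1]; have v0 : 0 < v by exact: lt_le_trans sv.
have vn : v ^+ n <= 1 by rewrite exprn_ile1// ltW.
have vn0 : 0 < v ^+ n by rewrite exprn_gt0.
have h := @bernoulli (v ^+ n) (2 ^ n) _.
have q0 : 0 <= step_poly n v by rewrite exprn_ge0// subr_ge0.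
rewrite -[_^-1]mul1r ler_pdivlMr ?exprn_gt0 ?mulr_gt0//.
apply: (@le_trans _ _ (step_poly n v * (1 + v ^+ n) ^+ (2 ^ n))).
  rewrite ler_wpM2l// (le_trans _ (h _)) ?(le_trans _ (ltW vn0)) ?oppr_le0//.
  rewrite natrX -exprMn (@le_trans _ _ ((2 * v) ^+ n)) ?lerDr//.
  by rewrite lerXn2r ?nnegrE ?mulr_ge0 ?(ltW s0) ?(ltW v0)// ler_wpM2l.
rewrite -exprMn exprn_ile1//.
  by rewrite mulr_ge0 ?subr_ge0// addr_ge0// ltW.
by rewrite -subr_sqr expr1n gerBl sqr_ge0.
Qed.

Lemma sin_sandwich (s A : R) : 0 < s -> s <= 1 -> A ^+ 2 <= 1 ->
  (A <= - s -> sin A <= - sin s) /\ (s <= A -> sin s <= sin A).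
Proof.
move=> s0 s1 A1.
have p2 : 1 <= (pi / 2 : R) by have := @pi_ge2 R; lra.
have {A1} : `|A| <= 1 by rewrite -(@expr_le1 _ 2)// real_normK ?num_real.
rewrite ler_norml => /andP[A1 A2].
have mono := @ltr_sin R.
split=> h.
  rewrite -sinN leNgt mono -?leNgt// in_itv /=; lra.
rewrite leNgt mono -?leNgt// in_itv /=; lra.
Qed.

(** For [c > 0] it equals [1 / 2] at [y = a] and increases as long as [c * (y - a)] stays within 1
    of 0. The cosine form is the one that [mean_cvg_cos] covers. *)
Definition wave (c a y : R) : R := (1 + cos (c * y + - (c * a + pi / 2))) / 2.

Lemma waveE c a y : wave c a y = (1 + sin (c * (y - a))) / 2.
Proof. by rewrite /wave opprD addrA cosBpihalf mulrBr. Qed.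

Lemma wave_itv c a y : 0 <= wave c a y <= 1.
Proof. by rewrite waveE; have := sin_geN1 (c * (y - a)); have := sin_le1 (c * (y - a)); lra. Qed.

(** Where [c |y - a| <= 1] and [|y - a| >= e], the wave is on the correct side of [1 / 2] by a
    margin [sin (c * e) / 2]. Far from [a] periodicity spoils the comparison, but there the
    quadratic term exceeds 1 and both inequalities are trivial. *)
Lemma step_sandwich (c e dl a y : R) n : 0 < c -> 0 < e -> c * e <= 1 -> 0 <= dl ->
  (1 - sin (c * e)) ^+ n <= dl -> ((1 + sin (c * e)) ^+ n)^-1 <= dl ->
  (y <= a - e)%R%:R - dl - c ^+ 2 * (y - a) ^+ 2 <= step_poly n (wave c a y) /\
  step_poly n (wave c a y) <= (y <= a + e)%R%:R + dl + c ^+ 2 * (y - a) ^+ 2.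
Proof.
move=> c0 e0 ce dl0 H1 H2.
have ce0 : 0 < c * e by rewrite mulr_gt0.
have wi := wave_itv c a y.
have /andP[q0 q1] := step_poly_itv n wi.
have sq0 : 0 <= c ^+ 2 * (y - a) ^+ 2 by rewrite mulr_ge0// sqr_ge0.
have b1 (b : bool) : 0 <= (b%:R : R) <= 1 by case: b; rewrite !(lexx, ler01).
have [A1|A1] := leP ((c * (y - a)) ^+ 2) 1; last first.
  rewrite exprMn in A1; have /andP[? ?] := b1 (y <= a - e); have /andP[? ?] := b1 (y <= a + e).
  by split; lra.
have [S1 S2] := sin_sandwich ce0 ce A1.
have s0 : 0 < sin (c * e) by apply: sin_gt0_pi; rewrite ce0 (le_lt_trans ce)// (lt_le_trans _ (pi_ge2 _))// ltr1n.
split.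
  have [ya|ya] := leP y (a - e); last by rewrite /=; lra.
  have h : c * (y - a) <= - (c * e) by rewrite -mulrN ler_pM2l//; lra.
  have /S1 {}h := h.
  have := @step_poly_ge n (wave c a y) ((1 - sin (c * e)) / 2) _ _.
  rewrite (mulrC 2) divfK ?pnatr_eq0// => hh.
  have {}hh : 1 - (1 - sin (c * e)) ^+ n <= step_poly n (wave c a y).
    apply: hh; last by case/andP: wi.
    by case/andP: wi => -> _ /=; rewrite waveE; lra.
  by rewrite /=; lra.
have [ya|ya] := leP y (a + e); first by rewrite /=; lra.
have h : c * e <= c * (y - a) by rewrite ler_pM2l//; lra.
have /S2 {}h := h.
have := @step_poly_le n (wave c a y) ((1 + sin (c * e)) / 2) _ _.
rewrite (mulrC 2) divfK ?pnatr_eq0// => hh.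
have {}hh : step_poly n (wave c a y) <= ((1 + sin (c * e)) ^+ n)^-1.
  apply: hh; first lra.
  by case/andP: wi => _ ->; rewrite andbT waveE; lra.
by rewrite /=; lra.
Qed.

(** The frequency [c] is chosen first, small enough for the quadratic error, and then [n], large
    enough for the geometric errors, whose ratios are below 1 because [sin (c * e)] is positive. *)
Lemma step_parameters (e dl : R) : 0 < e -> 0 < dl -> exists c n,
  [/\ 0 < c, c * e <= 1, c ^+ 2 <= dl, (1 - sin (c * e)) ^+ n <= dl &
      ((1 + sin (c * e)) ^+ n)^-1 <= dl].
Proof.
move=> e0 dl0; pose c := Num.min e^-1 (Num.min 1 dl).
have c0 : 0 < c by rewrite !lt_min invr_gt0 e0 ltr01 dl0.
have ce : c * e <= 1 by rewrite -ler_pdivlMr// mul1r ge_min lexx.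
have c1 : c <= 1 by rewrite !ge_min lexx orbT.
have cd : c <= dl by rewrite !ge_min lexx !orbT.
have ce0 : 0 < c * e by rewrite mulr_gt0.
have s0 : 0 < sin (c * e) by apply: sin_gt0_pi; rewrite ce0 (le_lt_trans ce)// (lt_le_trans _ (pi_ge2 _))// ltr1n.
have s1 := sin_le1 (c * e).
pose q := Num.max (1 - sin (c * e)) (1 + sin (c * e))^-1.
have q0 : 0 <= q by rewrite le_max subr_ge0 s1.
have q1 : `|q| < 1.
  by rewrite ger0_norm// gt_max invf_lt1; [apply/andP; split; lra|lra].
have /cvgr0Pnorm_le /(_ dl dl0) [n _ /(_ n (leqnn n))] := cvg_expr q1.
rewrite /= normrX ger0_norm// => qn.
exists c, n; split=> //.
- by rewrite expr2 (le_trans _ cd)// ler_piMr// ltW.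
- by rewrite (le_trans _ qn)// lerXn2r ?nnegrE ?subr_ge0// le_max lexx.
- rewrite -exprVn (le_trans _ qn)// lerXn2r ?nnegrE ?invr_ge0 ?le_max ?lexx ?orbT//; lra.
Qed.

End step_polynomial.

Lemma gauss_moment_even {R : comPzRingType} K :
  gauss_moment K.*2 * 2 ^+ K * K`!%:R = (K.*2)`!%:R :> R.
Proof.
elim: K => [|K IH]; first by rewrite expr0 fact0 !mulr1.
rewrite doubleS !factS -[gauss_moment _]/(K.*2.+1%:R * gauss_moment K.*2).
rewrite !natrM -IH exprS (_ : K.*2.+2 = 2 * K.+1)%N ?natrM; last lia.
ring.
Qed.

Lemma le_set_itv {R : realType} (c : R) : [set y | y <= c] = [set` `]-oo, c]].
Proof. by apply/seteqP; split => y /=; rewrite in_itv. Qed.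

(** * Convergence of means and of distribution functions *)

Section gaussian_limit.
Context {R : realType}.
Variables (d : nat -> measure_display) (T : forall n, measurableType (d n)).
Variables (P : forall n, probability (T n) R) (W : forall n, T n -> R).
Arguments W : clear implicits.
Hypothesis mW : forall n, measurable_fun [set: T n] (W n).
Hypothesis W_bounded : forall n, exists M : R, forall w, `|W n w| <= M.
Hypothesis moments : forall k,
  \int[P n]_w (W n w ^+ k) @[n --> \oo] --> (gauss_moment k : R).
Local Notation gamma := (normal_prob (0 : R) 1).

(** Integrability is carried along with convergence so that the class is closed under linear
    combinations. *)
Definition mean_cvg (h : R -> R) :=
  [/\ measurable_fun [set: R] h,
      forall n, (P n).-integrable [set: T n] (EFin \o (h \o W n)),
      gamma.-integrable [set: R] (EFin \o h) &
      \int[P n]_w h (W n w) @[n --> \oo] --> \int[gamma]_x h x].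

Lemma mean_cvgD g h : mean_cvg g -> mean_cvg h -> mean_cvg (fun x => g x + h x).
Proof.
move=> [mg gn gi gc] [mh hn hi hc]; split.
- exact: measurable_funD.
- by move=> n; exact: integrable_EFinD (gn n) (hn n).
- exact: integrable_EFinD gi hi.
rewrite RintegralD//.
under eq_fun do rewrite (RintegralD measurableT (gn _) (hn _)).
exact: cvgD gc hc.
Qed.

Lemma mean_cvgZ c h : mean_cvg h -> mean_cvg (fun x => c * h x).
Proof.
move=> [mh hn hi hc]; split.
- exact: measurable_funM.
- by move=> n; exact: integrable_EFinZ (hn n).
- exact: integrable_EFinZ hi.
rewrite RintegralZl//.
under eq_fun do rewrite (RintegralZl _ measurableT (hn _)).
exact: cvgMr hc.
Qed.

Lemma mean_cvgX k : mean_cvg (fun x => x ^+ k).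
Proof.
split.
- exact: measurable_funX.
- move=> n; have [M bM] := W_bounded n.
  apply: (@bounded_integrable _ _ _ _ _ (M ^+ k)).
    exact: measurable_funX.
  move=> w; rewrite /= normrX lerXn2r ?nnegrE// (le_trans _ (bM w))//.
- exact: integrable_normal_exprn.
by rewrite [X in _ --> X](_ : _ = gauss_moment k) // /Rintegral normal_moment.
Qed.

Lemma mean_cvg_cst c : mean_cvg (fun=> c).
Proof.
have := mean_cvgZ c (mean_cvgX 0).
by under eq_fun do rewrite expr0 mulr1.
Qed.

Lemma mean_cvg_sum k (h : nat -> R -> R) : (forall i, mean_cvg (h i)) ->
  mean_cvg (fun x => \sum_(i < k) h i x).
Proof.
move=> hc; elim: k => [|k IH].
  by under eq_fun do rewrite big_ord0; exact: mean_cvg_cst.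
by under eq_fun do rewrite big_ord_recr; exact: mean_cvgD.
Qed.

(** The error [u] belongs to the class as well: its mean is small under the normal law, hence
    eventually under [P n], and it controls the replacement of [h] by [s] under each of these
    laws. *)
Lemma mean_cvg_approx (h : R -> R) (M : R) : measurable_fun [set: R] h ->
  (forall x, `|h x| <= M) ->
  (forall e : R, 0 < e -> exists s u, [/\ mean_cvg s, mean_cvg u,
    forall x, `|h x - s x| <= u x & \int[gamma]_x u x <= e]) ->
  mean_cvg h.
Proof.
move=> mh hM app.
have hn n : (P n).-integrable [set: T n] (EFin \o (h \o W n)).
  by apply: (@bounded_integrable _ _ _ _ _ M) => [|x]; [exact: measurableT_comp mh (@mW n)|exact: hM].
have hi : gamma.-integrable [set: R] (EFin \o h).
  exact (@bounded_integrable R _ _ gamma h M mh hM).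
split=> //.
have close (d1 : measure_display) (T1 : measurableType d1) (Q : probability T1 R) (V : T1 -> R) s u :
    Q.-integrable [set: T1] (EFin \o (h \o V)) -> Q.-integrable [set: T1] (EFin \o (s \o V)) ->
    Q.-integrable [set: T1] (EFin \o (u \o V)) -> (forall x, `|h x - s x| <= u x) ->
    `|\int[Q]_w h (V w) - \int[Q]_w s (V w)| <= \int[Q]_w u (V w).
  move=> ih is' iu hsu; rewrite -RintegralB// (le_trans (le_normr_Rintegral _ _))//.
    exact: (integrableB measurableT ih is').
  apply: le_Rintegral => //.
  by apply: (integrable_norm (f := fun w => h (V w) - s (V w))); exact: (integrableB measurableT ih is').
apply/cvgrPdist_le => e e0.
have e5 : 0 < e / 5 by rewrite divr_gt0.
have [s [u [[ms sn si sc] [mu un ui uc] hsu ue]]] := app _ e5.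
have c0 := close _ _ gamma id s u hi si ui hsu.
have /cvgrPdist_le /(_ _ e5) sc' := sc.
have /cvgrPdist_le /(_ _ e5) uc' := uc.
near=> n.
have cn := close _ _ (P n) (W n) s u (hn n) (sn n) (un n) hsu.
have s1 : `|\int[gamma]_x s x - \int[P n]_w s (W n w)| <= e / 5 by near: n.
have u1 : `|\int[gamma]_x u x - \int[P n]_w u (W n w)| <= e / 5 by near: n.
move: s1 u1 cn c0 ue; rewrite !ler_norml /=; lra.
Unshelve. all: by end_near.
Qed.

(** Taylor polynomials have converging means. At the even order [2 K] the remainder bound is a
    multiple of [y ^ (2 K)], and its normal mean is [(t ^ 2 / 2) ^ K / K!], which tends to 0. *)
Lemma mean_cvg_cos t th : mean_cvg (fun y => cos (t * y + th)).
Proof.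
apply: (@mean_cvg_approx _ 1).
- apply: (measurableT_comp (continuous_measurable_fun (@continuous_cos R))).
  by apply: measurable_funD => //; exact: measurable_funM.
- by move=> x; rewrite ler_norml cos_geN1 cos_le1.
move=> e e0.
have /cvgr0Pnorm_le /(_ _ e0) [K _ /(_ K (leqnn K))] := cvg_exp_coeff (t ^+ 2 / 2).
move=> /(le_trans (ler_norm _)) Ke.
exists (fun y => \sum_(i < K.*2) cos (th + i%:R * (pi / 2)) * t ^+ i / i`!%:R * y ^+ i).
exists (fun y => t ^+ K.*2 / (K.*2)`!%:R * y ^+ K.*2); split.
- apply: (@mean_cvg_sum _ (fun i y => cos (th + i%:R * (pi / 2)) * t ^+ i / i`!%:R * y ^+ i)) => i.
  by apply: mean_cvgZ; exact: mean_cvgX.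
- by apply: mean_cvgZ; exact: mean_cvgX.
- move=> y; have := taylor_cos th (t * y) K.*2.
  rewrite [`|t * y| ^+ _](_ : _ = t ^+ K.*2 * y ^+ K.*2); last first.
    by rewrite -normrX -exprMn ger0_norm// exprn_even_ge0// odd_double.
  rewrite mulrAC; congr (`| _ - _| <= _); apply: eq_bigr => i _.
  by rewrite exprMn; ring.
- have [_ _ Xi _] := mean_cvgX K.*2.
  rewrite RintegralZl// /Rintegral normal_moment /=.
  rewrite (le_trans _ Ke)// le_eqVlt; apply/orP; left; apply/eqP.
  rewrite exp_coeffE /= -gauss_moment_even -muln2 mulnC exprM expr_div_n.
  have g0 : gauss_moment (2 * K) != 0 :> R.
    have := @gauss_moment_even R K; rewrite -mul2n => E.
    have : (2 * K)`!%:R != 0 :> R by rewrite pnatr_eq0 -lt0n fact_gt0.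
    by rewrite -E; apply: contraNneq => ->; rewrite !mul0r.
  have k0 : K`!%:R != 0 :> R by rewrite pnatr_eq0 -lt0n fact_gt0.
  have t0 : 2 ^+ K != 0 :> R by rewrite expf_neq0.
  by field; rewrite g0 k0 t0.
Qed.

(** The extra cosine factor carries the induction: its product with the cosine in one more wave is a
    combination of cosines of frequencies [t + c] and [t - c]. *)
Lemma mean_cvg_wave c a i t th : mean_cvg (fun y => wave c a y ^+ i * cos (t * y + th)).
Proof.
elim: i t th => [|i IH] t th.
  by under eq_fun do rewrite expr0 mul1r; exact: mean_cvg_cos.
pose ph : R := - (c * a + pi / 2).
have := mean_cvgD (mean_cvgZ 2^-1 (IH t th))
  (mean_cvgD (mean_cvgZ 4^-1 (IH (t + c) (th + ph))) (mean_cvgZ 4^-1 (IH (t - c) (th - ph)))).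
congr mean_cvg; apply/funext => y.
rewrite exprS [in X in _ = X * _ * _]/wave -/ph.
rewrite (_ : (t + c) * y + (th + ph) = (t * y + th) + (c * y + ph)); last by ring.
rewrite (_ : (t - c) * y + (th - ph) = (t * y + th) - (c * y + ph)); last by ring.
by move: (t * y + th) (c * y + ph) => A B; rewrite cosD cosB; field.
Qed.

Lemma mean_cvg_step n c a : mean_cvg (fun y => step_poly n (wave c a y)).
Proof.
pose p : {poly R} := (1 - 'X^n) ^+ (2 ^ n).
have := mean_cvg_sum (size p) (fun i => mean_cvgZ p`_i (mean_cvg_wave c a i 0 0)).
congr mean_cvg; apply/funext => y.
rewrite /step_poly (_ : _ ^+ _ = p.[wave c a y]); last by rewrite /p !hornerE.
by rewrite horner_coef; apply: eq_bigr => i _; rewrite mul0r addr0 cos0 mulr1.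
Qed.

Let step_bounds (e dl a : R) : 0 < e -> 0 < dl -> exists q, mean_cvg q /\
  forall y, (y <= a - e)%R%:R - q y <= dl * (1 + (y - a) ^+ 2) /\
            q y - (y <= a + e)%R%:R <= dl * (1 + (y - a) ^+ 2).
Proof.
move=> e0 dl0; have [c [n [c0 ce c2 H1 H2]]] := step_parameters e0 dl0.
exists (fun y => step_poly n (wave c a y)); split; first exact: mean_cvg_step.
move=> y; have [h1 h2] := step_sandwich a y c0 e0 ce (ltW dl0) H1 H2.
have : c ^+ 2 * (y - a) ^+ 2 <= dl * (y - a) ^+ 2 by rewrite ler_wpM2r ?sqr_ge0.
rewrite mulrDr mulr1; move: (_ * _) (_ * _) h1 h2 => A B; lra.
Qed.

Let mean_cvg_sqr a : mean_cvg (fun y => 1 + (y - a) ^+ 2).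
Proof.
have := mean_cvgD (mean_cvg_cst (1 + a ^+ 2))
  (mean_cvgD (mean_cvgX 2) (mean_cvgZ (- 2 * a) (mean_cvgX 1))).
by congr mean_cvg; apply/funext => y; ring.
Qed.

Lemma normal_prob_itv_le (a b : R) : a <= b ->
  fine (gamma [set x | x <= b]) <= fine (gamma [set x | x <= a]) + normal_peak 1 * (b - a).
Proof.
move=> ab.
have mle c : measurable [set y : R | y <= c] by rewrite le_set_itv.
have mab : measurable [set` `]a, b]] by [].
have E : [set x | x <= b] = [set x | x <= a] `|` [set` `]a, b]].
  apply/seteqP; split=> x /=; rewrite in_itv/=.
    by move=> xb; have [xa|xa] := leP x a; [left|right].
  by case=> [xa|/andP[]//]; exact: le_trans ab.
have fg (A : set R) : measurable A -> gamma A \is a fin_num by move=> mA; rewrite fin_num_measure.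
have E2 : (gamma [set x | (x <= b)%R] = gamma [set x | (x <= a)%R] + gamma [set` `]a, b]])%E.
  rewrite E; apply: measureU => //; first exact: mle.
  apply/seteqP; split=> x //= [xa]; rewrite in_itv/= => /andP[ax _].
  by move: (lt_le_trans ax xa); rewrite ltxx.
rewrite E2 fineD ?fg//.
rewrite lerD2l -lee_fin fineK ?fg//.
rewrite [leRHS](_ : _ = \int[lebesgue_measure]_(x in `]a, b]) (normal_peak (1 : R))%:E)%E; last first.
  rewrite (_ : (fun=> (normal_peak 1)%:E) = cst (normal_peak 1)%:E)// integral_cst//.
  rewrite EFinM; congr (_ * _)%E.
  transitivity (lebesgue_measure [set` `]a, b]]) => //.
  rewrite lebesgue_measure_itv/= lte_fin; move: ab; rewrite le_eqVlt => /predU1P[->|->//].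
  by rewrite ltxx subrr.
rewrite /gamma; apply: ge0_le_integral => //.
- by move=> x _; rewrite lee_fin normal_pdf_ge0.
- by apply/measurable_EFinP; apply: measurable_funTS; exact: measurable_normal_pdf.
- by move=> x _; rewrite lee_fin normal_pdf_ub// oner_eq0.
Qed.

Let sandwich_arith (e i1 j1 i2 j2 p g g1 g2 m1 m2 k : R) :
  `|i1 - j1| <= e / 8 -> `|i2 - j2| <= e / 8 -> i1 <= g1 + 2 * m1 ->
  g2 - 2 * m2 <= i2 -> p <= j1 -> j2 <= p -> g1 <= g + 2 * k -> g <= g2 + 2 * k ->
  m1 <= e / 8 -> m2 <= e / 8 -> k <= e / 8 -> `|g - p| <= e.
Proof.
rewrite !ler_norml => /andP[? ?] /andP[? ?] *; apply/andP; split; lra.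
Qed.

(** Up to small multiples of [1 + (y - a) ^ 2], the indicator at [x] lies between step functions
    centred at [a = x - eta] and [a = x + eta], and these lie between the indicators at [x - 2 eta]
    and [x + 2 eta]. The density being bounded, the normal mass of the gap is small; the quadratic
    errors have converging means. *)
Lemma distribution_cvg (x : R) :
  fine (P n [set w | W n w <= x]) @[n --> \oo] --> fine (gamma [set y | y <= x]).
Proof.
have mle c : measurable [set y : R | y <= c] by rewrite le_set_itv.
have mind c : measurable_fun [set: R] (fun y : R => (y <= c)%R%:R : R).
  by rewrite -indic_bool; apply: measurable_indic.
have mWle n c : measurable [set w | W n w <= c].
  have := @mW n measurableT _ (mle c); by rewrite setTI.
have b1 (b : bool) : `|b%:R| <= 1 :> R by rewrite normr_nat lern1 leq_b1.
have PE n c : fine (P n [set w | W n w <= c]) = \int[P n]_w (W n w <= c)%R%:R.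
  by rewrite Rintegral_bool.
have gE c : fine (gamma [set y | y <= c]) = \int[gamma]_y (y <= c)%R%:R.
  by rewrite Rintegral_bool//; exact: mle.
have Pi n c : (P n).-integrable [set: T n] (EFin \o (fun w => (W n w <= c)%R%:R)).
  exact (@bounded_integrable R _ _ (P n) _ 1 (measurableT_comp (mind c) (@mW n)) (fun w => b1 _)).
have gi c : gamma.-integrable [set: R] (EFin \o (fun y => (y <= c)%R%:R)).
  exact (@bounded_integrable R _ _ gamma _ 1 (mind c) (fun y => b1 _)).
apply/cvgrPdist_le => e e0.
pose C : R := 1 + normal_peak 1.
have C0 : 0 < C by rewrite addr_gt0// normal_peak_gt0.
have pk : 0 <= normal_peak 1 :> R by exact: normal_peak_ge0.
(* The constant [C] exceeds the peak of the density, so that a strip of width [eta] has normal mass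
   at most [e / 8]. *)
pose eta := e / (8 * C).
have eta0 : 0 < eta by rewrite divr_gt0// mulr_gt0.
have etaE : normal_peak 1 * eta <= e / 8.
  rewrite /eta mulrA ler_pdivrMr ?mulr_gt0//.
  rewrite (_ : e / 8 * (8 * C) = e * C); last by field.
  by rewrite mulrC ler_wpM2l ?(ltW e0)// lerDr.
pose M a := \int[gamma]_y (1 + (y - a) ^+ 2).
have M0 a : 0 <= M a by apply: Rintegral_ge0 => y _; rewrite addr_ge0// sqr_ge0.
have dlP a : exists2 dl, 0 < dl & dl * M a <= e / 8.
  exists (e / (8 * (1 + M a))); first by rewrite divr_gt0// mulr_gt0// ltr_pwDl.
  rewrite mulrAC ler_pdivrMr ?mulr_gt0// ?ltr_pwDl//.
  rewrite (_ : e / 8 * (8 * (1 + M a)) = e * (1 + M a)); last by field.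
  by rewrite ler_wpM2l ?(ltW e0)// lerDr.
have [dl1 dl10 dl1M] := dlP (x + eta).
have [dl2 dl20 dl2M] := dlP (x - eta).
have [q1 [q1c q1b]] := step_bounds (x + eta) eta0 dl10.
have [q2 [q2c q2b]] := step_bounds (x - eta) eta0 dl20.
have u1 := mean_cvgD q1c (mean_cvgZ dl1 (mean_cvg_sqr (x + eta))).
have u2 := mean_cvgD q2c (mean_cvgZ (- dl2) (mean_cvg_sqr (x - eta))).
have e8 : 0 < e / 8 by rewrite divr_gt0.
have G1 := @normal_prob_itv_le x (x + eta + eta) _.
have G2 := @normal_prob_itv_le (x - eta - eta) x _.
have [mq1 nq1 iq1 _] := q1c; have [mq2 nq2 iq2 _] := q2c.
have [_ _ is1 _] := mean_cvg_sqr (x + eta); have [_ _ is2 _] := mean_cvg_sqr (x - eta).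
have [_ nu1 iu1 /cvgrPdist_le /(_ _ e8) cu1] := u1.
have [_ nu2 iu2 /cvgrPdist_le /(_ _ e8) cu2] := u2.
have gu1 : \int[gamma]_y (q1 y + dl1 * (1 + (y - (x + eta)) ^+ 2)) <=
    fine (gamma [set y | y <= x + eta + eta]) + 2 * (dl1 * M (x + eta)).
  apply: (@le_trans _ _ (\int[gamma]_y ((y <= x + eta + eta)%R%:R + (2 * dl1) * (1 + (y - (x + eta)) ^+ 2)))).
    apply: le_Rintegral => //; first exact: integrable_EFinD (gi _) (integrable_EFinZ _ is1).
    by move=> y _; have [_] := q1b y; lra.
  rewrite RintegralD ?RintegralZl//; last exact: integrable_EFinZ.
  by rewrite -gE mulrA.
have gu2 : fine (gamma [set y | y <= x - eta - eta]) - 2 * (dl2 * M (x - eta)) <=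
    \int[gamma]_y (q2 y + - dl2 * (1 + (y - (x - eta)) ^+ 2)).
  apply: (@le_trans _ _ (\int[gamma]_y ((y <= x - eta - eta)%R%:R + - (2 * dl2) * (1 + (y - (x - eta)) ^+ 2)))).
    rewrite RintegralD ?RintegralZl//; last exact: integrable_EFinZ.
    by rewrite -gE mulNr mulrA.
  apply: le_Rintegral => //; first exact: integrable_EFinD (gi _) (integrable_EFinZ _ is2).
  by move=> y _; have [+ _] := q2b y; lra.
near=> n.
have s1 : fine (P n [set w | W n w <= x]) <=
    \int[P n]_w (q1 (W n w) + dl1 * (1 + (W n w - (x + eta)) ^+ 2)).
  rewrite PE; apply: le_Rintegral => // w _.
  by have [+ _] := q1b (W n w); rewrite addrK; lra.
have s2 : \int[P n]_w (q2 (W n w) + - dl2 * (1 + (W n w - (x - eta)) ^+ 2)) <=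
    fine (P n [set w | W n w <= x]).
  rewrite PE; apply: le_Rintegral => // w _.
  by have [_] := q2b (W n w); rewrite subrK; lra.
have c1 : `|\int[gamma]_y (q1 y + dl1 * (1 + (y - (x + eta)) ^+ 2)) -
    \int[P n]_w (q1 (W n w) + dl1 * (1 + (W n w - (x + eta)) ^+ 2))| <= e / 8 by near: n.
have c2 : `|\int[gamma]_y (q2 y + - dl2 * (1 + (y - (x - eta)) ^+ 2)) -
    \int[P n]_w (q2 (W n w) + - dl2 * (1 + (W n w - (x - eta)) ^+ 2))| <= e / 8 by near: n.
have {}G1 : fine (gamma [set y | y <= x + eta + eta]) <= fine (gamma [set y | y <= x]) + 2 * (normal_peak 1 * eta).
  by apply: (le_trans (G1 _)); lra.
have {}G2 : fine (gamma [set y | y <= x]) <= fine (gamma [set y | y <= x - eta - eta]) + 2 * (normal_peak 1 * eta).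
  by apply: (le_trans (G2 _)); lra.
exact: (sandwich_arith c1 c2 gu1 gu2 s1 s2 G1 G2 dl1M dl2M etaE).
Unshelve. all: by end_near.
Qed.

End gaussian_limit.

(** * Standardized U-statistics *)

Section bounded_random_variable.
Context {R : realType} {d : measure_display} {T : measurableType d}.
Variables (P : probability T R) (W : T -> R) (M : R).
Hypotheses (mW : measurable_fun [set: T] W) (WM : forall w, `|W w| <= M).

Lemma bounded_integrableX k : P.-integrable [set: T] (EFin \o (fun w => W w ^+ k)).
Proof.
apply: (@bounded_integrable _ _ _ _ _ (M ^+ k)); first exact: measurable_funX.
by move=> w; rewrite normrX lerXn2r ?nnegrE// (le_trans _ (WM w)).
Qed.

Lemma moment_hankel K (h : nat -> R) :
  0 <= \sum_(i < K) \sum_(j < K) h i * h j * \int[P]_w (W w ^+ (i + j)).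
Proof.
have int2 i : P.-integrable [set: T]
    (EFin \o (fun w => \sum_(j <- index_enum 'I_K) h i * h j * W w ^+ (i + j))).
  by apply: (Rintegral_sum _).1 => j _; apply: integrable_EFinZ; exact: bounded_integrableX.
have -> : \sum_(i < K) \sum_(j < K) h i * h j * \int[P]_w (W w ^+ (i + j)) =
    \int[P]_w (\sum_(i < K) \sum_(j < K) h i * h j * W w ^+ (i + j)).
  rewrite (Rintegral_sum _).2//; apply: eq_bigr => i _.
  rewrite (Rintegral_sum _).2; last first.
    by move=> j _; apply: integrable_EFinZ; exact: bounded_integrableX.
  by apply: eq_bigr => j _; rewrite RintegralZl//; exact: bounded_integrableX.
apply: Rintegral_ge0 => w _.
rewrite (_ : \sum_(i < K) _ = (\sum_(i < K) h i * W w ^+ i) ^+ 2) ?sqr_ge0//.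
rewrite expr2 big_distrl/=; apply: eq_bigr => i _; rewrite big_distrr/=.
by apply: eq_bigr => j _; rewrite exprD mulrACA.
Qed.

(** Pointwise, [|x| ^ k] is at most [th ^ k] if [|x| <= th] and at most [th ^ k * (|x| / th) ^ p]
    otherwise; this is multiplied by [x ^ 2] and integrated. Evenness of [p] removes the absolute
    value. *)
Lemma moment_interpolation k p (th : R) : 0 < th -> ~~ odd p -> (k <= p)%N ->
  `|\int[P]_w (W w ^+ k.+2)| <=
  th ^+ k * (\int[P]_w (W w ^+ 2) + \int[P]_w (W w ^+ p.+2) / th ^+ p).
Proof.
move=> th0 op kp.
have i2 := bounded_integrableX 2; have ip := bounded_integrableX p.+2.
rewrite (le_trans (le_normr_Rintegral _ _))//; first exact: bounded_integrableX.
rewrite (mulrC (\int[P]_w _)) -RintegralZl// -RintegralD//; last exact: integrable_EFinZ.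
rewrite -RintegralZl//; last by apply: integrable_EFinD => //; exact: integrable_EFinZ.
apply: le_Rintegral => //.
- by apply: (integrable_norm (f := fun w => W w ^+ k.+2)); exact: bounded_integrableX.
- by apply: integrable_EFinZ; apply: integrable_EFinD => //; exact: integrable_EFinZ.
move=> w _; set x := W w.
rewrite -addn2 exprD normrM -[p.+2]addn2 exprD (ger0_norm (sqr_ge0 x)).
rewrite (_ : _ * (_ + _) = th ^+ k * (1 + x ^+ p / th ^+ p) * x ^+ 2); last by ring.
rewrite ler_wpM2r ?sqr_ge0// normrX.
rewrite [x ^+ p](_ : _ = `|x| ^+ p); last by rewrite -normrX ger0_norm// exprn_even_ge0.
have [xt|tx] := leP `|x| th.
  rewrite -[leLHS]mulr1 ler_pM// ?exprn_ge0//.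
    by rewrite lerXn2r ?nnegrE// ltW.
  by rewrite lerDl divr_ge0 ?exprn_ge0// ltW.
have x1 : 1 <= `|x| / th by rewrite ler_pdivlMr// mul1r ltW.
rewrite -ler_pdivrMl ?exprn_gt0// mulrC -!expr_div_n.
rewrite (le_trans (ler_weXn2l x1 kp))// lerDr//.
Qed.

Lemma fine_expectation : fine 'E_P[W] = \int[P]_w W w.
Proof. by rewrite unlock. Qed.

Lemma fine_variance :
  fine 'V_P[W] = \int[P]_w ((W w - fine 'E_P[W]) ^+ 2).
Proof. by rewrite /variance covariance.unlock expectation.unlock. Qed.

Lemma measurable_standardized : measurable_fun [set: T] (standardized P W).
Proof. by apply: measurable_funM => //; exact: measurable_funB. Qed.

Lemma standardized_bounded w :
  `|standardized P W w| <= (M + `|fine 'E_P[W]|) / Num.sqrt (fine 'V_P[W]).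
Proof.
rewrite normrM normfV (ger0_norm (sqrtr_ge0 _)) ler_wpM2r ?invr_ge0 ?sqrtr_ge0//.
by rewrite (le_trans (ler_normB _ _))// lerD2r.
Qed.

Lemma standardized_mean : \int[P]_w standardized P W w = 0.
Proof.
rewrite /standardized; under eq_Rintegral do rewrite mulrC.
have iW : P.-integrable [set: T] (EFin \o W) by exact: bounded_integrable WM.
have ic : P.-integrable [set: T] (EFin \o cst (fine 'E_P[W])).
  exact: finite_measure_integrable_cst.
rewrite RintegralZl//; last exact: (integrableB measurableT iW ic).
rewrite RintegralB// fine_expectation (Rintegral_cst P measurableT).
by rewrite [fine (P _)](_ : _ = 1) ?mulr1 ?subrr ?mulr0//= (probability_setT P).
Qed.

Let integrable_dev : P.-integrable [set: T] (EFin \o (fun w => (W w - fine 'E_P[W]) ^+ 2)).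
Proof.
have mf : measurable_fun [set: T] (fun w => W w - fine 'E_P[W]) by exact: measurable_funB.
apply: (@bounded_integrable _ _ _ _ _ ((M + `|fine 'E_P[W]|) ^+ 2)).
  exact: measurable_funX.
move=> w; rewrite normrX lerXn2r ?nnegrE ?(le_trans (normr_ge0 _) (ler_normB _ _))//.
  by rewrite addr_ge0// (le_trans _ (WM w)).
by rewrite (le_trans (ler_normB _ _))// lerD2r.
Qed.

Lemma fine_variance_gt0 : (0 < 'V_P[W])%E -> 0 < fine 'V_P[W].
Proof.
have vf : 'V_P[W] \is a fin_num.
  move: integrable_dev; rewrite /variance covariance.unlock expectation.unlock => iW.
  exact: (integrable_fin_num measurableT iW).
by rewrite -lte_fin fineK.
Qed.

Lemma standardized_variance : (0 < 'V_P[W])%E ->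
  \int[P]_w (standardized P W w ^+ 2) = 1.
Proof.
move=> /fine_variance_gt0 v0; have iW := integrable_dev.
under eq_Rintegral do rewrite /standardized exprMn mulrC exprVn sqr_sqrtr ?(ltW v0)//.
by rewrite RintegralZl// -fine_variance mulVf// gt_eqF.
Qed.

Lemma standard_deviation_le : (0 < 'V_P[W])%E -> Num.sqrt (fine 'V_P[W]) <= 2 * M.
Proof.
move=> V0; have M0 : 0 <= M.
  have : `|\int[P]_w W w| <= M by exact: Rintegral_bounded.
  exact: le_trans.
rewrite -(ger0_norm (mulr_ge0 _ M0))// -sqrtr_sqr ler_wsqrtr// fine_variance.
rewrite (le_trans (ler_norm _))//; apply: Rintegral_bounded.
  by apply: measurable_funX; exact: measurable_funB.
have EM : `|fine 'E_P[W]| <= M by rewrite fine_expectation; exact: Rintegral_bounded.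
move=> w; rewrite normrX lerXn2r ?nnegrE ?mulr_ge0//.
by rewrite (le_trans (ler_normB _ _))// mulr_natl mulr2n lerD.
Qed.

End bounded_random_variable.

Lemma increasing_index_gt0 r n (j : r.-tuple 'I_n.+1) i :
  increasing_index j -> (0 < tnth j i)%N.
Proof.
move=> /(order_path_min ltn_trans)/allP; apply.
by apply: map_f; exact: mem_tnth.
Qed.

Section standardized_cumulants.
Context {R : realType}.
Context {d : measure_display} {T : measurableType d} (P : probability T R).
Context {d' : measure_display} {T' : measurableType d'} (P' : probability T' R).
Variables (X : nat -> {RV P >-> R}) (Y : int -> {RV P' >-> R}).
Variables (r n m : nat) (f : r.-tuple 'I_n.+1 -> r.-tuple R -> R) (F : R).
Hypotheses (r_gt0 : (0 < r)%N) (n_gt0 : (0 < n)%N) (m_gt0 : (0 < m)%N).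
Hypothesis Y_extends_X : two_sided_extension X Y.
Hypothesis mf : forall j, increasing_index j -> measurable_fun [set: r.-tuple R] (f j).
Hypothesis f_bounded : forall j x, increasing_index j -> `|f j x| <= F.
Hypothesis variance_gt0 : (0 < 'V_P[U_stat f X])%E.

Local Notation J := (r.-tuple 'I_n.+1).
Local Notation U := (U_stat f X).
Local Notation mean := (fine 'E_P[U]).
Local Notation sigma := (Num.sqrt (fine 'V_P[U])).
Let M : R := (n.+1 ^ r)%:R * F.

Lemma measurable_sample {I : Type} {d1} {T1 : measurableType d1} (Q : probability T1 R)
    (Z : I -> {RV Q >-> R}) k (t : k.-tuple I) : measurable_fun [set: T1] (sample Z t).
Proof.
apply/measurable_fun_tnthP => i.
rewrite (_ : _ \o _ = Z (tnth t i)); first exact: measurable_funP.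
by apply/funext => w /=; rewrite tnth_mktuple.
Qed.

Lemma kernel_bound_gt0 : 0 < F.
Proof.
rewrite ltNge; apply/negP => F0; move: variance_gt0.
have U0 w : U w = 0.
  apply: big1 => j ij; apply/eqP; rewrite -normr_le0.
  exact: le_trans (f_bounded _ ij) F0.
rewrite (_ : U = cst 0); last exact/funext.
by rewrite variance_cst ltxx.
Qed.

Let F0 := kernel_bound_gt0.

Let pick_sum_bounded (g : J -> R) : (forall j, increasing_index j -> `|g j| <= F) ->
  `|\sum_(j | increasing_index j) g j| <= M.
Proof.
move=> gF; rewrite (le_trans (ler_norm_sum _ _ _))//.
rewrite (le_trans (ler_sum _ gF))// sumr_const -mulr_natl ler_wpM2r ?(ltW F0)//.
by rewrite ler_nat (leq_trans (max_card _))// card_tuple card_ord.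
Qed.

Lemma U_stat_bounded w : `|U w| <= M.
Proof. by apply: pick_sum_bounded => j ij; exact: f_bounded. Qed.

Let pick (x : n.+1.-tuple R) (j : J) : r.-tuple R := [tuple tnth x (tnth j i) | i < r].

Let measurable_pick j : measurable_fun [set: n.+1.-tuple R] (pick^~ j).
Proof.
apply/measurable_fun_tnthP => i.
rewrite (_ : _ \o _ = (@tnth _ R)^~ (tnth j i)); first exact: measurable_tnth.
by apply/funext => w /=; rewrite tnth_mktuple.
Qed.

Let u (x : n.+1.-tuple R) := \sum_(j | increasing_index j) f j (pick x j).

Let measurable_sum_inc {d1} {T1 : measurableType d1} (g : J -> T1 -> R) :
  (forall j, increasing_index j -> measurable_fun [set: T1] (g j)) ->
  measurable_fun [set: T1] (fun x => \sum_(j | increasing_index j) g j x).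
Proof.
move=> mg; under eq_fun do rewrite big_mkcond.
apply: (@measurable_sum _ _ _ _ _ _ (fun j x => if increasing_index j then g j x else 0)) => j.
by case: (boolP (increasing_index j)) => [/mg|_]; [exact|exact: measurable_cst].
Qed.

Let measurable_u : measurable_fun [set: n.+1.-tuple R] u.
Proof.
apply: measurable_sum_inc => j ij.
apply: (measurableT_comp (mf ij)); exact: measurable_pick.
Qed.

(** The two sequences are compared at the times 1 to [n] only, while indices live in ['I_n.+1].
    Coordinate 0 is filled with 0 by [pad], and increasing index tuples never read it. *)
Let times : n.-tuple nat := [tuple of iota 1 n].

Let pad (z : n.-tuple R) : n.+1.-tuple R := cons_tuple 0 z.

Let measurable_pad : measurable_fun [set: n.-tuple R] pad.
Proof.
apply/measurable_fun_tnthP => i; case: (unliftP ord0 i) => [i' ->|->].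
  rewrite (_ : _ \o _ = (@tnth _ R)^~ i'); first exact: measurable_tnth.
  by apply/funext => z /=; rewrite tnthS.
by rewrite (_ : _ \o _ = cst 0)//; apply/funext => z /=; rewrite tnth0.
Qed.

Let tnth_times i : tnth times i = i.+1.
Proof. by rewrite (tnth_nth 0%N) /= nth_iota. Qed.

Let U_pad w : U w = u (pad (sample X times w)).
Proof.
apply: eq_bigr => j ij; congr f; apply: eq_from_tnth => i.
rewrite !tnth_mktuple; have := increasing_index_gt0 i ij.
rewrite tnth_map; case: (unliftP ord0 (tnth j i)) => [i' ->|->//] _.
by rewrite tnthS tnth_mktuple tnth_times.
Qed.

Let window_pad w :
  u (window Y n.+1 0 w) = u (pad (sample Y [tuple of map Posz times] w)).
Proof.
apply: eq_bigr => j ij; congr f; apply: eq_from_tnth => i.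
rewrite !tnth_mktuple; have := increasing_index_gt0 i ij.
case: (unliftP ord0 (tnth j i)) => [i' ->|->//] _.
by rewrite tnthS tnth_mktuple tnth_map tnth_times addr0.
Qed.

(** Moves every computation to the two-sided extension, which has the same law at the times used and
    to which the coefficients of absolute regularity refer. *)
Let transfer (g : R -> R) (B : R) : measurable_fun [set: R] g ->
  (forall x, `|x| <= M -> `|g x| <= B) ->
  \int[P]_w g (U w) = \int[P']_w g (u (window Y n.+1 0 w)).
Proof.
move=> mg gB; have [_ law] := Y_extends_X.
have {}law := law _ times n_gt0 _.
transitivity (\int[P]_w (g \o u \o pad) (sample X times w)).
  by apply: eq_Rintegral => w _; rewrite U_pad.
transitivity (\int[P']_w (g \o u \o pad) (sample Y [tuple of map Posz times] w)); last first.
  by apply: eq_Rintegral => w _; rewrite window_pad.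
apply: (@same_law_Rintegral _ _ _ _ _ _ _ _ _ _ _ _ B).
- exact: measurable_sample.
- exact: measurable_sample.
- by apply: law; apply/allP => k; rewrite mem_iota => /andP[].
- by apply: measurableT_comp measurable_pad; exact: measurableT_comp measurable_u.
- by move=> z; apply: gB; apply: pick_sum_bounded => j ij; exact: f_bounded.
Qed.

Lemma measurable_U_stat : measurable_fun [set: T] U.
Proof.
rewrite (_ : U = u \o pad \o sample X times); last by apply/funext => w; exact: U_pad.
apply: measurableT_comp (measurable_sample _ _).
exact: measurableT_comp measurable_u measurable_pad.
Qed.

Let e (j : J) : R := \int[P']_w f j (pick (window Y n.+1 0 w) j).

(** Centred kernels divided by [2 * F], hence bounded by 1; the value 0 off the increasing tuples
    lets sums run over all of [J]. *)
Let a (j : J) (x : n.+1.-tuple R) : R :=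
  if increasing_index j then (f j (pick x j) - e j) / (2 * F) else 0.

Let measurable_kernel j : increasing_index j ->
  measurable_fun [set: T'] (fun w => f j (pick (window Y n.+1 0 w) j)).
Proof.
move=> ij; apply: (measurableT_comp (mf ij)).
exact: (measurableT_comp (measurable_pick j) (@measurable_window _ _ _ _ Y n.+1 0)).
Qed.

Let meanE : mean = \sum_(j | increasing_index j) e j.
Proof.
have iU : P.-integrable [set: T] (EFin \o U) by exact: (bounded_integrable P measurable_U_stat U_stat_bounded).
rewrite fine_expectation (transfer (g := id) (B := M))//.
under eq_Rintegral do rewrite /u -big_filter.
rewrite (Rintegral_sum _).2 ?big_filter// => j; rewrite mem_filter => /andP[ij _].
by apply: bounded_integrable (measurable_kernel ij) _ => w; exact: f_bounded.
Qed.

Let e_bounded j : increasing_index j -> `|e j| <= F.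
Proof.
move=> ij; apply: Rintegral_bounded (measurable_kernel ij) _ => w.
exact: f_bounded.
Qed.

Let a_bounded j x : `|a j x| <= 1.
Proof.
rewrite /a; case: ifPn => [ij|_]; last by rewrite normr0.
have F2 : 0 < 2 * F by rewrite mulr_gt0.
rewrite normrM normfV (gtr0_norm F2) ler_pdivrMr// mul1r.
rewrite (le_trans (ler_normB _ _))// mulr_natl mulr2n lerD ?e_bounded//.
exact: f_bounded.
Qed.

Let measurable_a j : measurable_fun [set: n.+1.-tuple R] (a j).
Proof.
rewrite /a; case: (boolP (increasing_index j)) => [ij|_]; last exact: measurable_cst.
apply: measurable_funM => //; apply: measurable_funB => //.
by apply: (measurableT_comp (mf ij)); exact: measurable_pick.
Qed.

Let a_dep (j : J) (x y : n.+1.-tuple R) :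
  (forall i : 'I_n.+1, i \in tval j -> tnth x i = tnth y i) -> a j x = a j y.
Proof.
move=> xy; rewrite /a; case: ifPn => // ij; congr ((f j _ - _) / _).
by apply: eq_from_tnth => i; rewrite !tnth_mktuple xy// mem_tnth.
Qed.

Let sigma_gt0 : 0 < sigma.
Proof.
by rewrite sqrtr_gt0; exact: (fine_variance_gt0 measurable_U_stat U_stat_bounded variance_gt0).
Qed.

(** Up to constants the [L] of the overview, with [n + 1] for [n]: the factor [2 F / sigma] that
    undoes the normalization of one kernel, times the number of tuples in [J]. *)
Definition scale : R := 2 * F * (n.+1 ^ r)%:R / sigma.

Lemma scale_ge1 : 1 <= scale.
Proof.
rewrite /scale ler_pdivlMr// mul1r -mulrA (mulrC F).
exact: (standard_deviation_le measurable_U_stat U_stat_bounded variance_gt0).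
Qed.

Let A : R := 2 * F / sigma.

Let momentE k : \int[P]_w (standardized P U w ^+ k) = A ^+ k * sum_lists k (joint_moment Y a).
Proof.
have mg : measurable_fun [set: R] (fun x : R => ((x - mean) / sigma) ^+ k).
  by apply: measurable_funX; apply: measurable_funM => //; exact: measurable_funB.
rewrite /standardized (transfer (B := ((M + `|mean|) / sigma) ^+ k) mg); last first.
  move=> x xM; rewrite normrX lerXn2r ?nnegrE// ?divr_ge0 ?addr_ge0 ?(le_trans _ xM) ?(ltW sigma_gt0)//.
  rewrite normrM normfV (gtr0_norm sigma_gt0) ler_wpM2r ?invr_ge0 ?(ltW sigma_gt0)//.
  by rewrite (le_trans (ler_normB _ _))// lerD2r.
rewrite sum_joint_moment//.
have F2 : F != 0 by rewrite gt_eqF.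
have s0 : sigma != 0 by rewrite gt_eqF.
under eq_Rintegral => w _.
  rewrite (_ : _ ^+ k = A ^+ k * (\sum_j a j (window Y n.+1 0 w)) ^+ k); last first.
    rewrite -exprMn; congr (_ ^+ k).
    rewrite (_ : \sum_j a j _ = (u (window Y n.+1 0 w) - mean) / (2 * F)).
      by rewrite /A; field; rewrite F2 s0.
    by rewrite meanE -sumrB mulr_suml -big_mkcond.
  over.
rewrite RintegralZl//; apply: (@bounded_integrableX _ _ _ _ _ #|{: J}|%:R).
  apply: measurable_sum => j; apply: measurableT_comp (measurable_a j) _.
  exact: (@measurable_window _ _ _ _ Y n.+1 0).
move=> w; rewrite (le_trans (ler_norm_sum _ _ _))//.
rewrite (le_trans (ler_sum _ (fun j _ => a_bounded j _)))//.
by rewrite sumr_const cardE.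
Qed.

Lemma standardized_cumulants : exists kap : nat -> R,
  (forall k, \int[P]_w (standardized P U w ^+ k.+1) =
    \sum_(i < k.+1) 'C(k, i)%:R * kap i * \int[P]_w (standardized P U w ^+ (k - i))) /\
  (forall k, `|kap k| <= scale ^+ k.+1 *
    (cumulant_cst k * k`!%:R * (1 + k)%:R ^+ k * ((2 * r * r)%:R * (m%:R / n.+1%:R)) ^+ k +
     cumulant_split_cst k * (4 * (r * k.+1))%:R * beta_coef Y m)).
Proof.
exists (fun k => A ^+ k.+1 * \sum_x sum_lists k (cumulant (joint_moment Y a) x)); split=> k.
  rewrite momentE sum_lists_recursion ?joint_moment_nil// mulr_sumr.
  apply: eq_bigr => i _; rewrite momentE.
  have -> : A ^+ k.+1 = A ^+ i.+1 * A ^+ (k - i).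
    by rewrite -exprD addSn subnKC// -ltnS.
  ring.
have A0 : 0 <= A by rewrite divr_ge0 ?mulr_ge0// ltW.
rewrite normrM normrX (ger0_norm A0).
have [Y_stationary _] := Y_extends_X.
have N0 : n.+1%:R != 0 :> R by rewrite pnatr_eq0.
(* The bound on the number of neighbours becomes the number of all tuples times a multiple of
   [m / (n + 1)], so that each of the [k + 1] factors [A] is paired with one [(n + 1) ^ r]. *)
have rE : (n.+1 ^ r.-1)%:R = (n.+1 ^ r)%:R / n.+1%:R :> R.
  by rewrite -[in RHS](prednK r_gt0) expnS natrM mulrAC mulfV ?mul1r.
have := scaled_cumulant_le Y_stationary r_gt0 (ltn0Sn n) m_gt0 measurable_a a_bounded a_dep k.
move=> /(ler_wpM2l (exprn_ge0 k.+1 A0)) /le_trans; apply.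
rewrite le_eqVlt; apply/orP; left; apply/eqP.
rewrite /scale -/M (_ : 2 * F * _ / sigma = A * (n.+1 ^ r)%:R); last by rewrite /A mulrAC.
rewrite !natrM rE; move: A (n.+1 ^ r)%:R => B C.
by rewrite exprMn !exprS !exprMn; ring.
Qed.

End standardized_cumulants.

(** * Consequences of the growth condition *)

Section growth.
Context {R : realType}.
Variables (L dl be : nat -> R) (b0 : R).
Hypotheses (L_ge1 : forall n, 1 <= L n) (dl_ge0 : forall n, 0 <= dl n)
  (be_ge0 : forall n, 0 <= be n) (b0_gt0 : 0 < b0) (b0_lt2 : b0 < 2).
Hypothesis dl_cvg : L n ^+ 2 * dl n `^ (2 - b0) @[n --> \oo] --> (0 : R).
Hypothesis be_cvg : forall b, 0 < b -> b <= b0 ->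
  be n `^ b * L n ^+ 2 @[n --> \oo] --> (0 : R).

Lemma powR_le1_inv (x a : R) : 0 <= x -> 0 < a -> x `^ a <= 1 -> x <= 1.
Proof.
move=> x0 a0; apply: contraTT; rewrite -!ltNge => x1.
have := gt0_ltr_powR a0 (_ : 1 \in Num.nneg) (_ : x \in Num.nneg) x1.
by rewrite powR1; apply; rewrite nnegrE.
Qed.

Lemma ler_powR_le1 (x a b : R) : 0 <= x <= 1 -> 0 < a -> a <= b -> x `^ b <= x `^ a.
Proof.
move=> /andP[]; rewrite le_eqVlt => /predU1P[<- _ a0 ab|x0 x1 _]; last first.
  by apply: ger_powR; rewrite x0.
by rewrite !powR0 ?gt_eqF// (lt_le_trans a0).
Qed.

Lemma cvg0_sqr_le (y z : nat -> R) : (\forall n \near \oo, y n ^+ 2 <= z n) ->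
  z n @[n --> \oo] --> (0 : R) -> y n @[n --> \oo] --> (0 : R).
Proof.
move=> yz zc; apply/cvgr0Pnorm_le => e e0.
have e2 : 0 < e ^+ 2 by rewrite exprn_gt0.
move/cvgr0Pnorm_le : zc => /(_ _ e2).
apply: filterS2 yz => n yzn zn.
rewrite -(@ler_pXn2r _ 2) ?nnegrE ?(ltW e0)// real_normK ?num_real//.
by rewrite (le_trans yzn)// (le_trans (ler_norm _)).
Qed.

Let eventually_le1 (x : nat -> R) (a : R) : (forall n, 0 <= x n) -> 0 < a ->
  L n ^+ 2 * x n `^ a @[n --> \oo] --> (0 : R) -> \forall n \near \oo, x n <= 1.
Proof.
move=> x0 a0 /cvgr0Pnorm_le /(_ _ ltr01); apply: filterS => n h.
apply: (powR_le1_inv (x0 n) a0); apply: le_trans h.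
rewrite (le_trans _ (ler_norm _))// ler_peMl ?powR_ge0//.
by rewrite exprn_ege1.
Qed.

Let cvg0_exprn (z : nat -> R) k : z n @[n --> \oo] --> (0 : R) ->
  z n ^+ k.+1 @[n --> \oo] --> (0 : R).
Proof.
move=> zc; elim: k => [|k IH]; first by under eq_fun do rewrite expr1.
by under eq_fun do rewrite exprS; rewrite -[X in nbhs X](mulr0 0); exact: cvgM.
Qed.

(* For [L >= 1] the hypothesis forces [dl <= 1] eventually, and the square of the
   left-hand side is [(L^2 dl^(2 - b0))^(k + 1)] times a nonnegative power of [dl]. *)
Lemma growth_range_cvg0 k : 2 <= k.+1%:R * b0 ->
  L n ^+ k.+1 * dl n ^+ k @[n --> \oo] --> (0 : R).
Proof.
move=> kb.
have b2 : 0 < 2 - b0 by rewrite subr_gt0.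
apply: cvg0_sqr_le (cvg0_exprn k dl_cvg).
have := eventually_le1 dl_ge0 b2 dl_cvg; apply: filterS => n d1.
rewrite exprMn -!exprM [(_ * 2)%N]mulnC exprM [leRHS]exprMn.
rewrite ler_wpM2l ?exprn_ge0 ?(le_trans ler01)//.
rewrite -[leRHS]powR_mulrn ?powR_ge0// -powRrM -[leLHS]powR_mulrn//.
apply: ler_powR_le1; rewrite ?dl_ge0 ?mulr_gt0//.
by rewrite natrM; move: kb; rewrite -natr1; lra.
Qed.

(** For [b <= 2 / (k + 1)] and [be <= 1], which holds eventually, the square of the left-hand side
    is at most [(L ^ 2 * be ^ b) ^ (k + 1)]; the minimum with [b0] keeps [b] admissible. *)
Lemma growth_beta_cvg0 k : L n ^+ k.+1 * be n @[n --> \oo] --> (0 : R).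
Proof.
pose b := Num.min b0 (2 / k.+1%:R).
have b_gt0 : 0 < b by rewrite lt_min b0_gt0 divr_gt0.
have bb0 : b <= b0 by rewrite ge_min lexx.
have bk : k.+1%:R * b <= 2 by rewrite mulrC -ler_pdivlMr// ge_min lexx orbT.
have bc : L n ^+ 2 * be n `^ b @[n --> \oo] --> (0 : R).
  by under eq_fun do rewrite mulrC; exact: be_cvg.
apply: cvg0_sqr_le (cvg0_exprn k bc).
have := eventually_le1 be_ge0 b_gt0 bc; apply: filterS => n d1.
rewrite exprMn -!exprM [(_ * 2)%N]mulnC exprM [leRHS]exprMn -!exprM.
rewrite ler_wpM2l ?exprn_ge0 ?(le_trans ler01)//.
rewrite -[leRHS]powR_mulrn ?powR_ge0// -powRrM -[leLHS]powR_mulrn//.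
by apply: ler_powR_le1; rewrite ?be_ge0 ?mulr_gt0// mulrC.
Qed.

End growth.

Section growth_terms.
Context {R : realType}.
Variables (r m p : nat) (F V be b : R).
Hypotheses (r_gt0 : (0 < r)%N) (p_gt0 : (0 < p)%N).
Hypotheses (V_gt0 : 0 < V) (b_gt0 : 0 < b) (b_le2 : b <= 2).
Let L := 2 * F * (p.+1 ^ r)%:R / Num.sqrt V.
Let range_term := F ^+ 2 * m%:R `^ (2 - b) * p%:R `^ (2 * (r%:R - 1) + b)
  * r%:R `^ (4 - 2 * b) / V.
Let beta_term := be `^ b * (F ^+ 2 * p%:R ^+ (2 * r)%N / V).

Let range_term_ge0 : 0 <= range_term.
Proof. by apply: divr_ge0 (ltW V_gt0); do 3 rewrite mulr_ge0 ?powR_ge0//; exact: sqr_ge0. Qed.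

Let beta_term_ge0 : 0 <= beta_term.
Proof. by rewrite mulr_ge0 ?powR_ge0//; apply: divr_ge0 (ltW V_gt0); rewrite mulr_ge0 ?sqr_ge0 ?exprn_ge0. Qed.

Let L2 : L ^+ 2 = 4 * (F ^+ 2 / V) * p.+1%:R ^+ (2 * r)%N.
Proof.
rewrite /L exprMn exprVn sqr_sqrtr ?(ltW V_gt0)// natrX mulnC exprM.
by rewrite !exprMn; field; rewrite gt_eqF.
Qed.

Let p1 : p.+1%:R <= 2 * p%:R :> R.
Proof. by rewrite -natrM ler_nat; lia. Qed.

(** The powers of [p + 1] combine to the exponent [2 (r - 1) + b]. Passing from [p + 1] to [p] costs
    at most [2 ^ (2 r)], the remaining factor 4 comes from [(2 F) ^ 2], and [r ^ (4 - 2 b)] is at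
    least 1. *)
Lemma range_term_le :
  L ^+ 2 * (m%:R / p.+1%:R) `^ (2 - b) <= 4 ^+ r.+1 * (range_term + beta_term).
Proof.
apply: (@le_trans _ _ (4 ^+ r.+1 * range_term)); last first.
  by rewrite ler_wpM2l ?exprn_ge0// lerDl.
rewrite L2; set x := 2 * (r%:R - 1) + b.
have r1 : 1 <= r%:R :> R by rewrite ler1n.
have x0 : 0 <= x by rewrite addr_ge0 ?(ltW b_gt0)// mulr_ge0// subr_ge0.
have FV : 0 <= F ^+ 2 / V by rewrite divr_ge0 ?sqr_ge0// ltW.
have a0 : p.+1%:R != 0 :> R by rewrite pnatr_eq0.
have E : p.+1%:R ^+ (2 * r)%N * (m%:R / p.+1%:R) `^ (2 - b) =
    m%:R `^ (2 - b) * p.+1%:R `^ x :> R.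
  rewrite -powR_mulrn// [X in _ `^ X](_ : _ = (2 - b) + x); last by rewrite natrM /x; ring.
  rewrite powRD ?a0 ?implybT// mulrAC -powRM ?divr_ge0//.
  by rewrite mulrCA mulfV// mulr1.
rewrite -mulrA E.
have xle : p.+1%:R `^ x <= 4 ^+ r * p%:R `^ x.
  rewrite (@le_trans _ _ ((2 * p%:R) `^ x))//.
    by rewrite ge0_ler_powR ?nnegrE// mulr_ge0.
  rewrite powRM// ler_wpM2r ?powR_ge0//.
  rewrite (@le_trans _ _ (2 `^ (2 * r)%:R))//.
    apply: ler_powR; first by rewrite ler1n.
    rewrite natrM -subr_ge0 (_ : _ - x = 2 - b) ?subr_ge0//; rewrite /x; ring.
  by rewrite powR_mulrn// exprM -natrX.
have rle : 1 <= r%:R `^ (4 - 2 * b).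
  rewrite -[leLHS](powRr0 r%:R) ler_powR// (_ : _ - _ = 2 * (2 - b)); last by ring.
  by rewrite mulr_ge0// subr_ge0.
rewrite /range_term -/x [4 ^+ r.+1]exprS.
rewrite (_ : 4 * 4 ^+ r * _ = 4 * (F ^+ 2 / V) *
  (m%:R `^ (2 - b) * (4 ^+ r * p%:R `^ x * r%:R `^ (4 - 2 * b)))); last by ring.
apply: ler_wpM2l; first by rewrite mulr_ge0.
apply: ler_wpM2l; first exact: powR_ge0.
rewrite (le_trans xle)// ler_peMr//.
Qed.

Lemma beta_term_le : be `^ b * L ^+ 2 <= 4 ^+ r.+1 * (range_term + beta_term).
Proof.
apply: (@le_trans _ _ (4 ^+ r.+1 * beta_term)); last first.
  by rewrite ler_wpM2l ?exprn_ge0// lerDr.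
rewrite L2 /beta_term [4 ^+ r.+1]exprS.
have FV : 0 <= F ^+ 2 / V by rewrite divr_ge0 ?sqr_ge0// ltW.
have ple : p.+1%:R ^+ (2 * r)%N <= 4 ^+ r * p%:R ^+ (2 * r)%N :> R.
  rewrite (@le_trans _ _ ((2 * p%:R) ^+ (2 * r)%N))//.
    by rewrite lerXn2r ?nnegrE ?mulr_ge0.
  by rewrite exprMn [2 ^+ _](_ : _ = 4 ^+ r)// exprM -natrX.
rewrite (_ : 4 * 4 ^+ r * _ = be `^ b * (4 * (F ^+ 2 / V) *
  (4 ^+ r * p%:R ^+ (2 * r)%N))); last by ring.
apply: ler_wpM2l; first exact: powR_ge0.
by apply: ler_wpM2l => //; rewrite mulr_ge0.
Qed.

End growth_terms.

Theorem theorem2 (R : realType) (r : nat) (hr : (1 <= r)%N)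
  (d : nat -> measure_display) (T : forall n : nat, measurableType (d n))
  (P : forall n : nat, probability (T n) R)
  (X : forall n : nat, nat -> {RV (P n) >-> R})
  (X_stationary : forall n : nat, (1 <= n)%N -> strictly_stationary (X n))
  (d' : nat -> measure_display) (T' : forall n : nat, measurableType (d' n))
  (P' : forall n : nat, probability (T' n) R)
  (Y : forall n : nat, int -> {RV (P' n) >-> R})
  (Y_extends_X : forall n : nat, (1 <= n)%N -> two_sided_extension (X n) (Y n))
  (Y_regular : forall n : nat, (1 <= n)%N -> absolutely_regular (Y n))
  (f : forall n : nat, r.-tuple 'I_n.+1 -> r.-tuple R -> R) (F : nat -> R)
  (f_measurable : forall (n : nat) (j : r.-tuple 'I_n.+1),
    (1 <= n)%N -> increasing_index j -> measurable_fun [set: r.-tuple R] (f n j))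
  (f_bounded : forall (n : nat) (j : r.-tuple 'I_n.+1) (x : r.-tuple R),
    (1 <= n)%N -> increasing_index j -> `|f n j x| <= F n)
  (variance_gt0 : forall n : nat, (r <= n)%N ->
    (0 < 'V_(P n)[U_stat (f n) (X n)])%E)
  (m : nat -> nat) (m_gt0 : forall n : nat, (1 <= n)%N -> (1 <= m n)%N)
  (b0 : R) (b0_gt0 : 0 < b0) (b0_le : b0 <= 2 / 3)
  (growth : forall b : R, 0 < b -> b <= b0 ->
    F n ^+ 2 * (m n)%:R `^ (2 - b) * n%:R `^ (2 * (r%:R - 1) + b)
      * r%:R `^ (4 - 2 * b) / fine 'V_(P n)[U_stat (f n) (X n)]
    + beta_coef (Y n) (m n) `^ b
      * (F n ^+ 2 * n%:R ^+ (2 * r)%N / fine 'V_(P n)[U_stat (f n) (X n)])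
      @[n --> \oo] --> (0 : R)) :
  (forall k : nat, (1 <= k)%N ->
    ('E_(P n)[fun w => (standardized (P n) (U_stat (f n) (X n)) w ^+ k)%R])%E
      @[n --> \oo] --> ('E_(normal_prob (0 : R) 1)[fun x => (x ^+ k)%R])%E)
  /\
  (forall x : R,
    P n [set w | standardized (P n) (U_stat (f n) (X n)) w <= x]
      @[n --> \oo] --> normal_prob (0 : R) 1 `]-oo, x]).
Proof.
(* The index is shifted by [r]: for smaller indices there is no increasing tuple, the statistic is
   0, and its variance is not positive. *)
pose U n := U_stat (f (n + r)%N) (X (n + r)%N).
pose W n := standardized (P (n + r)%N) (U n).
pose N n := (n + r)%N.
have N_ge1 n : (1 <= N n)%N by rewrite /N addn_gt0 hr orbT.
have r_le n : (r <= N n)%N by exact: leq_addl.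
have mf n := fun j => @f_measurable (N n) j (N_ge1 n).
have fb n := fun j x => @f_bounded (N n) j x (N_ge1 n).
have V0 n := @variance_gt0 (N n) (r_le n).
have mU n : measurable_fun [set: T (N n)] (U n) by exact: measurable_U_stat (mf n).
have UB n := U_stat_bounded (fb n) (V0 n).
have mW n : measurable_fun [set: T (N n)] (W n) by exact: measurable_standardized (mU n).
have WB n : exists M : R, forall w, `|W n w| <= M.
  by eexists; exact: (standardized_bounded (P (N n)) (UB n)).
pose mo n k := \int[P (N n)]_w (W n w ^+ k).
have /choice[kap /all_and2[kap_rec kap_le]] := fun n =>
  standardized_cumulants hr (N_ge1 n) (@m_gt0 (N n) (N_ge1 n)) (@Y_extends_X (N n) (N_ge1 n)) (mf n) (fb n) (V0 n).
pose L n := scale (X (N n)) (f (N n)) (F (N n)).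
pose dl n : R := (m (N n))%:R / (N n).+1%:R.
pose be n := beta_coef (Y (N n)) (m (N n)).
have L_ge1 n : 1 <= L n by exact: scale_ge1 (mf n) (fb n) (V0 n).
have dl_ge0 n : 0 <= dl n by rewrite divr_ge0.
have be_ge0 n : 0 <= be n by exact: beta_coef_ge0.
have b0_lt2 : b0 < 2 by rewrite (le_lt_trans b0_le)// ltr_pdivrMr// -natrM ltr_nat.
have Vf n : 0 < fine 'V_(P (N n))[U n] by exact: (fine_variance_gt0 (mU n) (UB n) (V0 n)).
have squeeze0 (x y : nat -> R) c : (forall n, 0 <= x n <= c * y (N n)) ->
    y n @[n --> \oo] --> (0 : R) -> x n @[n --> \oo] --> (0 : R).
  move=> xy; rewrite -(cvg_shiftn r) => yc.
  apply: (@squeeze_cvgr _ _ _ _ (cst 0) (fun n => c * y (N n))).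
  - by apply: nearW => n; exact: xy.
  - exact: cvg_cst.
  - by rewrite -(mulr0 c); exact: cvgMr.
have le2 b : b <= b0 -> b <= 2 by move=> h; rewrite (le_trans h)// ltW.
have dl_cvg : L n ^+ 2 * dl n `^ (2 - b0) @[n --> \oo] --> (0 : R).
  apply: (squeeze0 _ _ (4 ^+ r.+1) _ (@growth b0 b0_gt0 (lexx _))) => n.
  rewrite mulr_ge0 ?sqr_ge0 ?powR_ge0//=.
  by apply: (range_term_le _ _ _ hr (N_ge1 n) (Vf n) b0_gt0); exact: ltW.
have be_cvg b : 0 < b -> b <= b0 -> be n `^ b * L n ^+ 2 @[n --> \oo] --> (0 : R).
  move=> b_gt0 bb0; apply: (squeeze0 _ _ (4 ^+ r.+1) _ (@growth b b_gt0 bb0)) => n.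
  rewrite mulr_ge0 ?sqr_ge0 ?powR_ge0//=.
  exact: (beta_term_le _ _ _ hr (N_ge1 n) (Vf n) b_gt0 (le2 b bb0)).
(* From this order on the exponent condition of [growth_range_cvg0] holds, so that all further
   cumulants vanish in the limit. *)
have [s sb] : exists s, forall i, (s <= i)%N -> 2 <= i.+1%:R * b0.
  exists (Num.bound (2 / b0)) => i si.
  rewrite -ler_pdivrMr// (le_trans (ltW (archi_boundP _)))//.
    by rewrite divr_ge0// ltW.
  by rewrite ler_nat (leq_trans si).
have kap_cvg i : (s <= i)%N -> kap n i @[n --> \oo] --> (0 : R).
  move=> /sb ib.
  have h1 := growth_range_cvg0 L_ge1 dl_ge0 b0_lt2 dl_cvg ib.
  have h2 := growth_beta_cvg0 L_ge1 be_ge0 b0_gt0 be_cvg i.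
  pose c1 : R := cumulant_cst i * i`!%:R * (1 + i)%:R ^+ i * (2 * r * r)%:R ^+ i.
  pose c2 : R := cumulant_split_cst i * (4 * (r * i.+1))%:R.
  have h : c1 * (L n ^+ i.+1 * dl n ^+ i) + c2 * (L n ^+ i.+1 * be n) @[n --> \oo] --> (0 : R).
    suff : c1 * (L n ^+ i.+1 * dl n ^+ i) + c2 * (L n ^+ i.+1 * be n) @[n --> \oo] --> c1 * 0 + c2 * 0.
      by rewrite !mulr0 addr0.
    by apply: cvgD; apply: cvgMr.
  apply/cvgr0Pnorm_le => e e0; move/cvgr0Pnorm_le : h => /(_ _ e0).
  apply: filterS => n hn; rewrite (le_trans (kap_le n i))// (le_trans _ hn)//.
  rewrite (le_trans _ (ler_norm _))// le_eqVlt; apply/orP; left; apply/eqP.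
  rewrite -/(L n) -/(dl n) -/(be n) [(_ * dl n) ^+ i]exprMn mulrDr [in RHS]/c1.
  congr (_ + _); last by rewrite mulrCA.
  by rewrite mulrCA -[RHS]mulrA; congr (_ * _); rewrite mulrCA.
have mo_cvg k : mo n k @[n --> \oo] --> (gauss_moment k : R).
  apply: (@janson _ mo kap s).
  - by move=> n K h; have [M WM] := WB n; exact: (moment_hankel (P (N n)) (mW n) WM).
  - by move=> n j p th; have [M WM] := WB n; exact: (moment_interpolation (P (N n)) (mW n) WM).
  - exact: kap_rec.
  - move=> n; rewrite /mo; under eq_Rintegral do rewrite expr0.
    by rewrite (Rintegral_cst _ measurableT) [fine _](_ : _ = 1) ?mulr1//= (probability_setT (P (N n))).
  - by move=> n; rewrite /mo; under eq_Rintegral do rewrite expr1;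
      exact: (standardized_mean (P (N n)) (mU n) (UB n)).
  - by move=> n; exact: standardized_variance (mU n) (UB n) (V0 n).
  - exact: kap_cvg.
split=> [k k1|x].
  rewrite -(cvg_shiftn r) expectation.unlock normal_moment.
  apply: cvg_EFin; last exact: mo_cvg.
  apply: nearW => n; have [M WM] := WB n.
  by apply: (integrable_fin_num measurableT); exact: (bounded_integrableX (P (N n)) (mW n) WM k).
have setE := le_set_itv x.
have dc := distribution_cvg mW WB mo_cvg (x := x).
rewrite -(cvg_shiftn r) -setE.
rewrite -[normal_prob _ _ _]fineK; last first.
  by rewrite setE fin_num_measure.
apply: cvg_EFin; last exact: dc.
apply: nearW => n; rewrite fin_num_measure//.
have := mW n measurableT _ (measurable_itv `]-oo, x]); rewrite setTI -setE.
exact.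
Qed.
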